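(* Let $k\in\mathbb{N}$, $k\ge 1$. There exist (i) complete bounded embedded complex $k$-dimensional submanifolds of $\mathbb{C}^{2k}$, and (ii) complete bounded embedded complex $k$-dimensional submanifolds of $\mathbb{C}^{4k}$ with strongly negative holomorphic sectional curvature.
   Context: A complete bounded embedded complex $k$-dimensional submanifold of $\mathbb{C}^n$ is the image $X(M)$ of a holomorphic immersion $X\colon M\to\mathbb{C}^n$ of a connected $k$-dimensional complex manifold $M$ such that: $X$ is an embedding (a homeomorphism onto its image), $X(M)$ is a bounded subset of $\mathbb{C}^n$, and $X$ is complete, i.e. the pull-back $X^*g$ of the Euclidean metric $g$ of $\mathbb{C}^n$ is a complete Riemannian metric on $M$. The holomorphic sectional curvature is that of the induced Kähler metric $X^*g$; it is strongly negative if it is bounded above by a negative constant. *)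

(* Defs.v *)
From HB Require Import structures.
From mathcomp Require Import all_boot all_order all_algebra.
From mathcomp Require Import all_classical all_reals all_analysis.
From mathcomp Require Import complex.

Set Implicit Arguments.
Unset Strict Implicit.
Unset Printing Implicit Defensive.

Import Order.TTheory GRing.Theory Num.Theory.
Import numFieldNormedType.Exports.

Local Open Scope classical_set_scope.
Local Open Scope ring_scope.

(* [R[i]] seen as a closed numeric field: this is the key under which the
   topology, the norm and the (complex-linear) differential ['d] are found.
   Points of C^k are row vectors, so a linear map acts by [v *m A]. *)
Definition cplx (R : realType) : numClosedFieldType := R[i].

Section Charts.
Variables (R : realType) (k : nat) (M : topologicalType).
Local Notation C := (cplx R).

Record chart := Chart {
  chart_dom : set M;
  chart_map : M -> 'rV[C]_k;
  chart_inv : 'rV[C]_k -> M;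
  chart_dom_open : open chart_dom;
  chart_img_open : open (chart_map @` chart_dom);
  chart_mapK : forall p, chart_dom p -> chart_inv (chart_map p) = p;
  chart_map_continuous : {within chart_dom, continuous chart_map};
  chart_inv_continuous :
    {within chart_map @` chart_dom, continuous chart_inv}
}.

Definition chart_img (c : chart) : set 'rV[C]_k := chart_map c @` chart_dom c.

(* Over the field C, [differentiable] is complex Frechet differentiability. *)
Definition holomorphic_transition (c c' : chart) : Prop :=
  forall p, chart_dom c p -> chart_dom c' p ->
    differentiable (chart_map c' \o chart_inv c) (chart_map c p).

End Charts.

Record complex_manifold (R : realType) (k : nat) := ComplexManifold {
  manifold_space :> topologicalType;
  atlas : set (chart R k manifold_space);
  manifold_nonempty : [set: manifold_space] !=set0;
  manifold_connected : connected [set: manifold_space];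
  manifold_hausdorff : hausdorff_space manifold_space;
  manifold_second_countable : @second_countable manifold_space;
  atlas_cover : forall p, exists c, atlas c /\ chart_dom c p;
  atlas_holomorphic : forall c c', atlas c -> atlas c' ->
    holomorphic_transition c c'
}.

Definition chart_at (R : realType) (k : nat) (M : complex_manifold R k)
    (p : M) : chart R k M :=
  projT1 (cid (atlas_cover p)).

Section Maps.
Variables (R : realType) (k n : nat) (M : complex_manifold R k).
Local Notation C := (cplx R).
Implicit Type X : M -> 'rV[C]_n.

Definition in_chart X (c : chart R k M) : 'rV[C]_k -> 'rV[C]_n :=
  X \o chart_inv c.

Definition holomorphic X : Prop :=
  forall c, atlas c -> forall z, chart_img c z ->
    differentiable (in_chart X c) z.

Definition holomorphic_immersion X : Prop :=
  holomorphic X /\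
  forall c, atlas c -> forall z, chart_img c z ->
    injective ('d (in_chart X c) z).

Definition topological_embedding X : Prop :=
  continuous X /\
  exists2 Y : 'rV[C]_n -> M, cancel X Y & {within range X, continuous Y}.

End Maps.

Section Hermitian.
Variables (R : realType) (k : nat).
Local Notation C := (cplx R).

(* h(v, w) = sum_ij G_ij v_i conj(w_j) *)
Definition herm (G : 'M[C]_k) (v w : 'rV[C]_k) : C :=
  \sum_i \sum_j G i j * v 0 i * (w 0 j)^*.

(* The Riemannian norm is that of Re h. *)
Definition sqnorm (G : 'M[C]_k) (v : 'rV[C]_k) : R :=
  complex.Re (herm G v v).

(* The coefficients of a Hermitian metric in each chart; no compatibility
   between charts is imposed, as it is automatic for the pull-backs below. *)
Definition hermitian_metric (M : complex_manifold R k) :=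
  chart R k M -> 'rV[C]_k -> 'M[C]_k.

End Hermitian.

Section PullBack.
Variables (R : realType) (k n : nat) (M : complex_manifold R k).
Local Notation C := (cplx R).

(* The matrix [1%:M] is the Euclidean metric of C^n, as the Hermitian form
   sum_a v_a conj(w_a). *)
Definition pullback_metric (X : M -> 'rV[C]_n) : hermitian_metric M :=
  fun c z => \matrix_(i, j)
    herm 1%:M ('d (in_chart X c) z (delta_mx 0 i))
              ('d (in_chart X c) z (delta_mx 0 j)).

End PullBack.

Section Completeness.
Variables (R : realType) (k : nat) (M : complex_manifold R k).
Local Notation C := (cplx R).
Local Notation re := (@complex.Re R).
Local Notation im := (@complex.Im R).

Definition real_derivable (f : R -> C) (t : R) : Prop :=
  derivable (re \o f) t 1 /\ derivable (im \o f) t 1.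

Definition real_derive (f : R -> C) (t : R) : C :=
  (derive1 (re \o f) t +i* derive1 (im \o f) t)%C.

Definition C1_curve (gamma : R -> M) : Prop :=
  continuous gamma /\
  forall c, atlas c -> forall t, chart_dom c (gamma t) -> forall j,
    let f := fun s => chart_map c (gamma s) 0 j in
    real_derivable f t /\ {for t, continuous (real_derive f)}.

Definition velocity (gamma : R -> M) (c : chart R k M) (t : R) : 'rV[C]_k :=
  \row_j real_derive (fun s => chart_map c (gamma s) 0 j) t.

Variable g : hermitian_metric M.

(* For a pull-back metric the value does not depend on the chart chosen. *)
Definition speed (gamma : R -> M) (t : R) : R :=
  let c := chart_at (gamma t) in
  Num.sqrt (sqnorm (g c (chart_map c (gamma t))) (velocity gamma c t)).

Definition curve_length (gamma : R -> M) : \bar R :=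
  (\int[lebesgue_measure]_(t in `[0%R, 1%R]) (speed gamma t)%:E)%E.

(* Using C^1 rather than piecewise C^1 curves gives the same set of lengths:
   a piecewise C^1 curve may be reparametrized so as to stop at its corners
   and at its end points. *)
Definition riemannian_dist (p q : M) : \bar R :=
  ereal_inf [set curve_length gamma | gamma in
    [set gamma | [/\ C1_curve gamma, gamma 0 = p & gamma 1 = q]]].

(* Completeness of M as a metric space; by Hopf-Rinow this is the same as
   geodesic completeness. *)
Definition complete_metric : Prop :=
  forall u : nat -> M,
    (forall e : R, 0 < e -> exists N : nat, forall i j : nat,
       (N <= i)%N -> (N <= j)%N -> (riemannian_dist (u i) (u j) < e%:E)%E) ->
    exists p : M, forall e : R, 0 < e -> exists N : nat, forall i : nat,
       (N <= i)%N -> (riemannian_dist (u i) p < e%:E)%E.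

End Completeness.

Section Curvature.
Variables (R : realType) (k : nat).
Local Notation C := (cplx R).
Implicit Type A : 'rV[C]_k -> 'M[C]_k.

Definition real_derive_along (f : 'rV[C]_k -> C) (z v : 'rV[C]_k) : C :=
  real_derive (fun t : R => f (z + (t%:C)%C *: v)) 0.

(* Wirtinger derivatives d/dz_l and d/dzbar_l, with z_l = x_l + i y_l. *)
Definition dz (l : 'I_k) (f : 'rV[C]_k -> C) (z : 'rV[C]_k) : C :=
  (real_derive_along f z (delta_mx 0 l)
   - 'i * real_derive_along f z ('i *: delta_mx 0 l)) / 2.

Definition dzbar (l : 'I_k) (f : 'rV[C]_k -> C) (z : 'rV[C]_k) : C :=
  (real_derive_along f z (delta_mx 0 l)
   + 'i * real_derive_along f z ('i *: delta_mx 0 l)) / 2.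

Definition dz_mx (l : 'I_k) A (z : 'rV[C]_k) : 'M[C]_k :=
  \matrix_(i, j) dz l (fun w => A w i j) z.

Definition dzbar_mx (l : 'I_k) A (z : 'rV[C]_k) : 'M[C]_k :=
  \matrix_(i, j) dzbar l (fun w => A w i j) z.

(* For a Kaehler metric [G] the Levi-Civita connection is the Chern
   connection, with Christoffel symbols
     Gamma_li^p = sum_q (d_l G_iq) (G^-1)_qp = [christoffel G l z i p]. *)
Definition christoffel (G : 'rV[C]_k -> 'M[C]_k) (l : 'I_k) (z : 'rV[C]_k) :
    'M[C]_k :=
  dz_mx l G z *m invmx (G z).

(* [kahler_curvature G l m z i j] is the component
     R_(i jbar l mbar) = - d_l dbar_m G_ij
                         + sum_qp (d_l G_iq) (G^-1)_qp (dbar_m G_pj). *)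
Definition kahler_curvature (G : 'rV[C]_k -> 'M[C]_k) (l m : 'I_k)
    (z : 'rV[C]_k) : 'M[C]_k :=
  - (dzbar_mx m (christoffel G l) z *m G z).

(* Since the Riemannian metric is Re h, with h the Hermitian form of [G], the
   sectional curvature of the real plane spanned by v and iv is
   2 R(v, vbar, v, vbar) / h(v, v)^2; for instance it is -4 on the unit disc
   with G = (1 - |z|^2)^-2. *)
Definition holomorphic_sectional_curvature (G : 'rV[C]_k -> 'M[C]_k)
    (z v : 'rV[C]_k) : R :=
  2 * complex.Re
        (\sum_l \sum_m v 0 l * (v 0 m)^* * herm (kahler_curvature G l m z) v v)
    / sqnorm (G z) v ^+ 2.

Definition strongly_negative_hsc (M : complex_manifold R k)
    (g : hermitian_metric M) : Prop :=
  exists2 a : R, 0 < a &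
    forall c, atlas c -> forall z, chart_img c z ->
    forall v, v != 0 -> holomorphic_sectional_curvature (g c) z v <= - a.

End Curvature.

Definition complete_bounded_embedding (R : realType) (k n : nat)
    (M : complex_manifold R k) (X : M -> 'rV[cplx R]_n) : Prop :=
  [/\ holomorphic_immersion X, topological_embedding X,
      bounded_set (range X) & complete_metric (pullback_metric X)].

(* Main.v *)
(** A labyrinth in the bidisc. The curve is the zero set of
    [F = a + b z + c w + F0], where [F0] is the sum over [n] and [i <= m_n] of
    [A_n (z^(m_n - i) w^i / tau_(n, i))^(N_n)]. The Reinhardt domains
    [K_n = {|z^(m_n - i) w^i| <= tau_(n, i) for all i}] exhaust the domain [Om]
    of convergence. With [N_n] large, a point of the boundary of [K_n] where one
    monomial of stage [n] dominates all the others by a fixed factor is not a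
    zero of [F], so the curve leaves [K_n] through small gates, near the corners
    where two adjacent monomials are of equal size. The position of the corners
    is read off [ln|w| - ln|z|], and since [m_n] changes by
    a factor 2 from one stage to the next, the gates of consecutive stages are
    at distance at least [c / (n + 2)]. A path leaving every [K_n] is therefore
    of infinite length, as the harmonic series diverges.
    The curve is smooth for generic [(a, b, c)]: the bad parameters are the
    image of [Om], of real dimension 4, under a locally Lipschitz map to C^3, so
    Baire's theorem applies.
    The manifold is a component of the k-fold product of the curve. Its image under
    [(z, w) |-> (z, w, z^2, w^2)] in each factor has negative holomorphic
    sectional curvature: by the Gauss equation in the form of Lagrange's
    identity, the curvature of a factor is governed by
    [|psi' /\ psi''|^2 >= 4 (|z'|^6 + |w'|^6)]. *)

(* Two opposite demands fix the degree [m_n]. In the coordinates [ln|z|], [ln|w|] the domain [K_n]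
   is a convex polygonal region, with one constraint for each slope [th = i / m_n] and offset
   [th (1 - th) + eps_n]. For [K_n] to lie inside [K_(n+1)], the fall of [eps_n] must exceed the
   error [1 / (4 m_n^2)] of interpolating [th (1 - th)] on [m_n] intervals. As [K_n] has to stay in
   the unit bidisc, these falls must have a finite sum. The gates, on the other hand, are about
   [1 / m_n] apart, and these distances must have an infinite sum. A degree of order [n] meets both
   demands. Strict concavity of [th (1 - th)] ensures that only adjacent monomials can be nearly
   equal and largest, so that a gate determines its corner. The choices are made in the order [A_n],
   [N_n]: [A_n] exceeds the sum of all earlier stages by a constant that the affine part cannot
   cancel, and [N_n] makes small what is not dominant. Since [N_n >= 2], [F0] has no constant or
   linear term, so for [(a, b, c)] near [(0, 1, 0)] the curve has a point near the origin and is not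
   empty. *)
From HB Require Import structures.
Require Import Defs.
From mathcomp Require Import all_boot all_order all_algebra.
From mathcomp Require Import all_classical all_reals all_analysis.
From mathcomp Require Import complex.
From mathcomp Require Import ring lra zify.

Set Implicit Arguments.
Unset Strict Implicit.
Unset Printing Implicit Defensive.

Import Order.TTheory GRing.Theory Num.Theory.
Import numFieldNormedType.Exports.

Local Open Scope classical_set_scope.
Local Open Scope ring_scope.

(** * Complex numbers and power series *)

Section ComplexBasics.
Variable R : realType.
Local Notation C := (cplx R).
Implicit Types z w : C.

(** The norm of [R[i]] takes its values in [R[i]]; [nc] is the same number as an element of [R],
    where real arithmetic decides inequalities. *)
Definition nc z : R := complex.Re `|z|.

Lemma ncE z : nc z = Num.sqrt (complex.Re z ^+ 2 + complex.Im z ^+ 2).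
Proof. by rewrite /nc (@normc_def R z). Qed.

Lemma nc_norm z : (nc z)%:C%C = `|z| :> C.
Proof. by rewrite /nc (@normc_def R z). Qed.

Lemma nc_ge0 z : 0 <= nc z. Proof. by rewrite ncE sqrtr_ge0. Qed.

Lemma nc_le_norm z (e : R) : (nc z <= e) = (`|z| <= e%:C%C :> C).
Proof. by rewrite -nc_norm (@lecR R). Qed.

Lemma nc_lt_norm z (e : R) : (nc z < e) = (`|z| < e%:C%C :> C).
Proof. by rewrite -nc_norm (@ltcR R). Qed.

Lemma nc0 : nc 0 = 0. Proof. by rewrite /nc normr0. Qed.
Lemma nc1 : nc 1 = 1. Proof. by rewrite /nc normr1. Qed.

Lemma ncN z : nc (- z) = nc z. Proof. by rewrite /nc normrN. Qed.
Lemma ncBC z w : nc (z - w) = nc (w - z). Proof. by rewrite -ncN opprB. Qed.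

Lemma ncM z w : nc (z * w) = nc z * nc w.
Proof.
suff h : (nc (z * w))%:C%C = (nc z * nc w)%:C%C :> C by case: h.
by rewrite rmorphM/= !nc_norm normrM.
Qed.

Lemma nc_eq0 z : (nc z == 0) = (z == 0).
Proof.
by rewrite -(normr_eq0 z) -nc_norm; apply/eqP/eqP => [->|[]]//.
Qed.

Lemma nc_gt0 z : (0 < nc z) = (z != 0).
Proof. by rewrite lt_neqAle nc_ge0 andbT eq_sym nc_eq0. Qed.

Lemma ncX z n : nc (z ^+ n) = nc z ^+ n.
Proof. by elim: n => [|n IH]; rewrite ?expr0 ?nc1// !exprS ncM IH. Qed.

Lemma ncV z : nc z^-1 = (nc z)^-1.
Proof.
have [->|z0] := eqVneq z 0; first by rewrite invr0 nc0 invr0.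
apply: (@mulfI _ (nc z)); first by rewrite nc_eq0.
by rewrite -ncM !divff ?nc1// nc_eq0.
Qed.

Lemma ncD z w : nc (z + w) <= nc z + nc w.
Proof.
by rewrite nc_le_norm rmorphD/= !nc_norm; exact: ler_normD.
Qed.

Lemma ncB z w : nc (z - w) <= nc z + nc w.
Proof. by rewrite -(ncN w) ncD. Qed.

Lemma nc_sum (I : Type) (r : seq I) (P : pred I) (f : I -> C) :
  nc (\sum_(i <- r | P i) f i) <= \sum_(i <- r | P i) nc (f i).
Proof.
elim/big_rec2: _ => [|i y x Pi h]; first by rewrite nc0.
by apply: le_trans (ncD _ _) _; rewrite lerD2l.
Qed.

Lemma nc_real (x : R) : nc x%:C%C = `|x|.
Proof. by rewrite ncE /= expr0n addr0 sqrtr_sqr. Qed.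

Lemma nc_nat n : nc n%:R = n%:R.
Proof.
by rewrite -(rmorph_nat (real_complex R)) nc_real ger0_norm ?ler0n.
Qed.

Lemma nc_Re z : `|complex.Re z| <= nc z.
Proof.
rewrite ncE -sqrtr_sqr.
by apply: (@ler_wsqrtr R (_ ^+ 2) (_ + _)); rewrite lerDl sqr_ge0.
Qed.

Lemma nc_Im z : `|complex.Im z| <= nc z.
Proof.
rewrite ncE -sqrtr_sqr.
by apply: (@ler_wsqrtr R (_ ^+ 2) (_ + _)); rewrite lerDr sqr_ge0.
Qed.

Lemma nc_ReIm z : nc z <= `|complex.Re z| + `|complex.Im z|.
Proof.
have s0 : 0 <= `|complex.Re z| + `|complex.Im z| by rewrite addr_ge0.
rewrite ncE -(ger0_norm s0) -[leRHS]sqrtr_sqr.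
apply: (@ler_wsqrtr R (_ + _) (_ ^+ 2)).
rewrite sqrrD !real_normK ?num_real// -addrA lerD2l lerDr.
by rewrite mulrn_wge0// mulr_ge0.
Qed.

Lemma cReD z w : complex.Re (z + w) = complex.Re z + complex.Re w.
Proof. by case: z w => [? ?] [? ?]. Qed.
Lemma cImD z w : complex.Im (z + w) = complex.Im z + complex.Im w.
Proof. by case: z w => [? ?] [? ?]. Qed.
Lemma cReN z : complex.Re (- z) = - complex.Re z.
Proof. by case: z => [? ?]. Qed.
Lemma cImN z : complex.Im (- z) = - complex.Im z.
Proof. by case: z => [? ?]. Qed.
Lemma cReM z w : complex.Re (z * w) =
  complex.Re z * complex.Re w - complex.Im z * complex.Im w.
Proof. by case: z w => [? ?] [? ?]. Qed.
Lemma cImM z w : complex.Im (z * w) =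
  complex.Re z * complex.Im w + complex.Im z * complex.Re w.
Proof. by case: z w => [? ?] [? ?]. Qed.

Lemma cRe_sum n (u : nat -> C) :
  complex.Re (\sum_(i < n) u i) = \sum_(i < n) complex.Re (u i).
Proof. by elim: n => [|n IH]; rewrite ?big_ord0// !big_ord_recr/= cReD IH. Qed.
Lemma cIm_sum n (u : nat -> C) :
  complex.Im (\sum_(i < n) u i) = \sum_(i < n) complex.Im (u i).
Proof. by elim: n => [|n IH]; rewrite ?big_ord0// !big_ord_recr/= cImD IH. Qed.

Lemma ltc_real (e : C) : 0 < e -> exists2 d : R, 0 < d & e = d%:C%C.
Proof.
move=> e0; exists (complex.Re e); move: e0; rewrite (@ltcE R) /= => /andP[/eqP i r] //.
by case: e i r => a b /= ->.
Qed.

Lemma nbhs_cplx z (A : set C) :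
  nbhs z A <-> exists2 e : R, 0 < e & forall w, nc (w - z) < e -> A w.
Proof.
split=> [/nbhs_ballP[e e0 eA]|[e e0 eA]].
  have [d d0 ed] := ltc_real e0; exists d => // w wd; apply: eA.
  by rewrite -ball_normE/= distrC ed -nc_lt_norm.
apply/nbhs_ballP; exists e%:C%C; first by rewrite /= (@ltcR R 0).
move=> w; rewrite -ball_normE/= => h; apply: eA.
by rewrite ncBC nc_lt_norm.
Qed.

Lemma nbhs_rVcplx n (p : 'rV[C]_n) (A : set 'rV[C]_n) :
  nbhs p A <->
  exists2 e : R, 0 < e &
    forall q : 'rV[C]_n, (forall j, nc (q 0 j - p 0 j) < e) -> A q.
Proof.
split=> [/nbhs_ballP[e e0 eA]|[e e0 eA]].
  have [d d0 ed] := ltc_real e0; exists d => // w wd; apply: eA; split=> // i j.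
  by rewrite ord1 -ball_normE/= distrC ed -nc_lt_norm.
apply/nbhs_ballP; exists e%:C%C; first by rewrite /= (@ltcR R 0).
move=> w h; apply: eA => j; have := h.2 0 j.
by rewrite -ball_normE/= => hh; rewrite ncBC nc_lt_norm.
Qed.

End ComplexBasics.

(** * Absolutely convergent complex series *)

Section ComplexSeries.
Variable R : realType.
Local Notation C := (cplx R).
Implicit Types (u v : nat -> C).

Definition sum_bounded u (M : R) := forall n, \sum_(i < n) nc (u i) <= M.

Definition is_csum u (s : C) :=
  forall e : R, 0 < e -> exists N : nat, forall n, (N <= n)%N ->
    nc (\sum_(i < n) u i - s) < e.

Lemma real_series_cvg (x : nat -> R) (M : R) :
  (forall n, \sum_(i < n) `|x i| <= M) -> exists s : R,
  forall e, 0 < e -> exists N : nat, forall n, (N <= n)%N ->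
    `|\sum_(i < n) x i - s| < e.
Proof.
move=> hM.
have c : cvgn (series (fun n => `|x n|)).
  apply: nondecreasing_is_cvgn.
    apply/nondecreasing_seqP => n.
    by rewrite /series/= big_nat_recr//= lerDl.
  by exists M => _ [n _ <-]; rewrite /series/= big_mkord.
have /cvg_ex[s cs] := normed_cvg c.
exists s => e e0; move/cvgrPdist_lt: cs => /(_ e e0) [N _ hN].
exists N => n Nn; have := hN n Nn.
by rewrite /series/= big_mkord distrC.
Qed.

Lemma is_csum_ex u M : sum_bounded u M -> exists s, is_csum u s.
Proof.
move=> hM.
have [|s hs] := @real_series_cvg (fun n => complex.Re (u n)) M.
  by move=> n; apply: le_trans (hM n); apply: ler_sum => i _; exact: nc_Re.
have [|t ht] := @real_series_cvg (fun n => complex.Im (u n)) M.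
  by move=> n; apply: le_trans (hM n); apply: ler_sum => i _; exact: nc_Im.
exists (s +i* t)%C => e e0.
have e20 : 0 < e / 2 by rewrite divr_gt0.
have [N1 h1] := hs _ e20; have [N2 h2] := ht _ e20.
exists (maxn N1 N2) => n; rewrite geq_max => /andP[n1 n2].
apply: le_lt_trans (nc_ReIm _) _.
rewrite cReD cImD cReN cImN cRe_sum cIm_sum/= [ltRHS](splitr e).
by apply: ltrD; [exact: h1|exact: h2].
Qed.

(** The default 0 of divergent series never enters an estimate: [csumP] identifies the sum under
    [sum_bounded]. *)
Definition csum u : C := xget 0 [set s | is_csum u s].

Lemma csumP u M : sum_bounded u M -> is_csum u (csum u).
Proof. by move=> /is_csum_ex[s hs]; apply: (xgetPex 0); exists s. Qed.

Lemma is_csum_uniq u s t : is_csum u s -> is_csum u t -> s = t.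
Proof.
move=> hs ht; apply/eqP; rewrite -subr_eq0 -nc_eq0; apply/negPn/negP => st0.
have d0 : 0 < nc (s - t) / 2 by rewrite divr_gt0// lt_neqAle eq_sym st0 nc_ge0.
have [N1 h1] := hs _ d0; have [N2 h2] := ht _ d0.
have := h1 (maxn N1 N2) (leq_maxl _ _); have := h2 (maxn N1 N2) (leq_maxr _ _).
set S := \sum_(i < _) _ => a b.
have := ncB (S - t) (S - s).
rewrite (_ : S - t - (S - s) = s - t); last by ring.
move=> /le_lt_trans/(_ (ltrD a b)); rewrite -splitr ltxx//.
Qed.

Lemma csumE u M s : sum_bounded u M -> is_csum u s -> csum u = s.
Proof. by move=> /csumP h; apply: is_csum_uniq. Qed.

Lemma csum_le u M : sum_bounded u M -> nc (csum u) <= M.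
Proof.
move=> hM; have hs := csumP hM; apply/ler_addgt0Pr => e e0.
have [N h] := hs _ e0; have := h N (leqnn _).
set S := \sum_(i < _) _ => a.
rewrite (_ : csum u = S - (S - csum u)); last by ring.
apply: le_trans (ncB _ _) _; apply: lerD; last exact: ltW.
by apply: le_trans (nc_sum _ _ _) _; exact: hM.
Qed.

Lemma sum_bounded_lin u v (a : C) M M' : sum_bounded u M -> sum_bounded v M' ->
  sum_bounded (fun n => a * u n + v n) (nc a * M + M').
Proof.
move=> hu hv n; apply: (@le_trans _ _ (\sum_(i < n) (nc a * nc (u i) + nc (v i)))).
  by apply: ler_sum => i _; rewrite -ncM ncD.
rewrite big_split/= -mulr_sumr; apply: lerD; last exact: hv.
by apply: ler_wpM2l; [exact: nc_ge0|exact: hu].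
Qed.

Lemma csum_lin u v (a : C) M M' : sum_bounded u M -> sum_bounded v M' ->
  csum (fun n => a * u n + v n) = a * csum u + csum v.
Proof.
move=> hu hv; apply: (csumE (sum_bounded_lin a hu hv)) => e e0; have a0 := nc_ge0 a.
have [|N1 h1] := csumP hu (e := e / 2 / (nc a + 1)).
  by rewrite !divr_gt0// ltr_wpDl.
have [|N2 h2] := csumP hv (e := e / 2); first by rewrite divr_gt0.
exists (maxn N1 N2) => n; rewrite geq_max => /andP[/h1 n1 /h2 n2].
rewrite big_split/= -mulr_sumr.
move: n1 n2; set S := \sum_(i < _) _; set T := \sum_(i < _) _ => n1 n2.
rewrite (_ : _ - _ = a * (S - csum u) + (T - csum v)); last by ring.
apply: le_lt_trans (ncD _ _) _; rewrite [ltRHS](splitr e) ler_ltD// ncM.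
move: n1; rewrite ltr_pdivlMr ?ltr_wpDl// => n1.
have := nc_ge0 (S - csum u); nra.
Qed.

Lemma csum_shift u M n : sum_bounded u M ->
  csum u = \sum_(i < n) u i + csum (fun k => u (n + k)%N).
Proof.
move=> hu; apply: (csumE hu) => e e0.
have hv : sum_bounded (fun k => u (n + k)%N) M.
  move=> k; have := hu (n + k)%N; rewrite big_split_ord/=.
  by apply: le_trans; rewrite lerDr; apply: sumr_ge0 => i _; exact: nc_ge0.
have [N h] := csumP hv e0; exists (n + N)%N => k nk.
have kE : k = (n + (k - n))%N by rewrite subnKC// (leq_trans _ nk)// leq_addr.
rewrite kE big_split_ord/= (_ : _ - _ = \sum_(i < k - n) u (n + i)%N
   - csum (fun k => u (n + k)%N)); last by ring.
by apply: h; rewrite leq_subRL// (leq_trans _ nk)// leq_addr.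
Qed.

Lemma eq_csum u v : u =1 v -> csum u = csum v.
Proof. by move=> /funext ->. Qed.

Lemma geometric_half n : \sum_(i < n) (2^-1 ^+ i) <= 2 :> R.
Proof.
suff : \sum_(i < n) (2^-1 ^+ i) = 2 - 2 * 2^-1 ^+ n :> R.
  by move=> ->; rewrite gerBl mulr_ge0// exprn_ge0// invr_ge0.
elim: n => [|n IH]; first by rewrite big_ord0 expr0 mulr1 subrr.
by rewrite big_ord_recr/= IH exprS; field.
Qed.

(* Newton's iteration with frozen derivative [b]. *)
Lemma solve_near (h : C -> C) (z0 b : C) (rho : R) : b != 0 ->
  (forall z z', nc (z - z0) <= rho -> nc (z' - z0) <= rho ->
     nc (h z - h z' - b * (z - z')) <= nc b / 2 * nc (z - z')) ->
  nc (h z0) <= nc b / 2 * rho ->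
  exists2 z, nc (z - z0) <= rho & h z = 0.
Proof.
move=> b0 hl h0.
have nb0 : 0 < nc b by rewrite nc_gt0.
have rho0 : 0 <= rho.
  by move: (le_trans (nc_ge0 _) h0); rewrite pmulr_rge0// divr_gt0.
pose T (z : C) : C := z - h z / b.
pose y n : C := iter n T z0.
pose u n : C := y n.+1 - y n.
have yS n : y n.+1 = y n - h (y n) / b by [].
have y0 : y 0 = z0 by [].
have uD n : u n = y n.+1 - y n by [].
clearbody u y; clear T.
have uE n : u n = - (h (y n) / b) by rewrite uD yS; ring.
have yE n : y n = z0 + \sum_(i < n) u i.
  elim: n => [|n IH]; first by rewrite big_ord0 addr0.
  by rewrite big_ord_recr/= addrA -IH uD; ring.
(* The increments will be bounded by [rho / 2] times powers of [1 / 2], which keeps all iterates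
   within [rho] of [z0]. *)
have geo n : \sum_(i < n) rho / 2 * 2^-1 ^+ i <= rho.
  rewrite -mulr_sumr; apply: le_trans (ler_wpM2l _ (geometric_half n)) _.
    by rewrite divr_ge0.
  by rewrite divfK.
have ub n : (forall i, (i < n)%N -> nc (u i) <= rho / 2 * 2^-1 ^+ i) ->
    nc (y n - z0) <= rho.
  move=> ih; rewrite yE addrAC subrr add0r; apply: le_trans (nc_sum _ _ _) _.
  by apply: le_trans (geo n); apply: ler_sum => i _; apply: ih.
have uB : forall n, nc (u n) <= rho / 2 * 2^-1 ^+ n.
  elim/ltn_ind => -[|n] IH.
    rewrite expr0 mulr1 uE ncN ncM ncV ler_pdivrMr//.
    by move: h0; rewrite y0; lra.
  have yn : nc (y n - z0) <= rho.
    by apply: ub => i ni; apply: IH; rewrite ltnS ltnW.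
  have yn1 : nc (y n.+1 - z0) <= rho by apply: ub => i ni; apply: IH.
  have := hl _ _ yn1 yn; rewrite -uD => hh.
  (* Since [h (y n) = - b * u n], the new increment is, up to sign, the linearization error over the
     last one, divided by [b]; the hypothesis on [h] halves it. *)
  have -> : u n.+1 = - ((h (y n.+1) - h (y n) - b * u n) / b).
    have -> : h (y n) = - (b * u n) by rewrite uE mulrN opprK mulrC divfK.
    by rewrite uE; field.
  rewrite ncN ncM ncV ler_pdivrMr//; apply: le_trans hh _.
  have := IH n (leqnn _); rewrite exprS; set q := 2^-1 ^+ n => hq.
  have : nc b * nc (u n) <= nc b * (rho / 2 * q) by rewrite ler_pM2l.
  lra.
have ubd : sum_bounded u rho.
  by move=> n; apply: le_trans (geo n); apply: ler_sum => i _; exact: uB.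
have yb n : nc (y n - z0) <= rho by apply: ub => i _; exact: uB.
exists (z0 + csum u).
  by rewrite addrAC subrr add0r; exact: csum_le ubd.
set z := z0 + csum u.
have zb : nc (z - z0) <= rho by rewrite /z addrAC subrr add0r; exact: csum_le ubd.
apply/eqP; rewrite -nc_eq0 eq_le nc_ge0 andbT; apply/ler_addgt0Pr => e e0.
rewrite add0r.
have [N hN] := csumP ubd (e := e / (4 * nc b)) ltac:(by rewrite divr_gt0// mulr_gt0).
have hN0 := hN N (leqnn _); have hN1 := hN N.+1 (leqnSn _).
have zy n : nc (z - y n) = nc (\sum_(i < n) u i - csum u).
  by rewrite ncBC /z yE; congr nc; ring.
move: hN0 hN1; rewrite -!zy !ltr_pdivlMr ?mulr_gt0// => hN0 hN1.
have hy : h (y N) = - (b * u N) by rewrite uE mulrN opprK mulrC divfK.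
(* The step to [y N.+1] cancels [h (y N)]: what is left is a linearization error plus [b] times a
   distance that tends to 0. *)
have -> : h z = (h z - h (y N) - b * (z - y N)) + b * (z - y N.+1).
  by rewrite hy uD; ring.
apply: le_trans (ncD _ _) _.
have := hl _ _ zb (yb N); rewrite [nc (b * _)]ncM.
have := nc_ge0 (z - y N); nra.
Qed.

End ComplexSeries.

(** * Power series in two variables and their second-order estimates *)

Section PowerSeries.
Variable R : realType.
Local Notation C := (cplx R).
Local Notation mono := (C * (nat * nat))%type.
Implicit Types (l : seq mono) (P : nat -> seq mono) (r t : R) (z w : C).

(** The factor [r] on the left avoids an exponent [a - 1] on the right, which would be truncated at
    [a = 0]. *)
Lemma pow_diff1 z z' r a : 0 <= r -> nc z <= r -> nc z' <= r ->
  nc (z' ^+ a - z ^+ a) * r <= a%:R * r ^+ a * nc (z' - z).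
Proof.
move=> r0 hz hz'; elim: a => [|a IH]; first by rewrite !expr0 subrr nc0 !mul0r.
have -> : z' ^+ a.+1 - z ^+ a.+1 = z' * (z' ^+ a - z ^+ a) + z ^+ a * (z' - z).
  by rewrite !exprS; ring.
have hza : nc (z ^+ a) <= r ^+ a by rewrite ncX lerXn2r ?nnegrE ?nc_ge0.
apply: le_trans (ler_wpM2r r0 (ncD _ _)) _.
rewrite !ncM mulrDl -natr1 !mulrDl mul1r exprS; apply: lerD.
  rewrite -[leLHS]mulrA; apply: le_trans (ler_pM _ _ hz' IH) _; rewrite ?nc_ge0//.
    by rewrite mulr_ge0 ?nc_ge0.
  by rewrite le_eqVlt; apply/orP; left; apply/eqP; ring.
rewrite mulrAC [_ * r]mulrC; apply: ler_wpM2r; first exact: nc_ge0.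
by apply: ler_wpM2l.
Qed.

(** The constant [a ^ 2] is cruder than [a (a - 1) / 2] but closes the induction, by
    [a ^ 2 + a <= (a + 1) ^ 2]. *)
Lemma pow_diff2 z z' r a : 0 <= r -> nc z <= r -> nc z' <= r ->
  nc (z' ^+ a - z ^+ a - a%:R * z ^+ a.-1 * (z' - z)) * r ^+ 2
    <= a%:R ^+ 2 * r ^+ a * nc (z' - z) ^+ 2.
Proof.
move=> r0 hz hz'; elim: a => [|a IH].
  by rewrite !expr0 !mul0r subrr subr0 nc0 mul0r expr0n/= !mul0r.
set D := z' - z in IH *; set d := nc D in IH *.
have d0 : 0 <= d by exact: nc_ge0.
set Q := _ - _ - _ in IH.
have -> : z' ^+ a.+1 - z ^+ a.+1 - a.+1%:R * z ^+ a.+1.-1 * D =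
    z' * Q + a%:R * z ^+ a.-1 * D ^+ 2.
  rewrite /Q /D /= -natr1; case: a {IH Q} => [|a]; rewrite /= ?exprS ?expr0; ring.
have hA : nc (a%:R * z ^+ a.-1 * D ^+ 2) * r ^+ 2 <= a%:R * r ^+ a.+1 * d ^+ 2.
  rewrite 2!ncM nc_nat [nc (D ^+ 2)]ncX -/d ncX mulrAC; apply: ler_wpM2r; first exact: sqr_ge0.
  case: a {IH Q} => [|a]; first by rewrite !mul0r.
  rewrite -[leLHS]mulrA; apply: ler_wpM2l => //=.
  have -> : r ^+ a.+2 = r ^+ a * r ^+ 2 by rewrite -exprD addn2.
  by apply: ler_wpM2r; [exact: sqr_ge0|rewrite lerXn2r ?nnegrE ?nc_ge0].
apply: le_trans (ler_wpM2r (sqr_ge0 _) (ncD _ _)) _.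
rewrite ncM mulrDl.
have h1 : nc z' * nc Q * r ^+ 2 <= a%:R ^+ 2 * r ^+ a.+1 * d ^+ 2.
  rewrite -[leLHS]mulrA; apply: le_trans (ler_pM _ _ hz' IH) _; rewrite ?nc_ge0//.
    by rewrite mulr_ge0 ?nc_ge0 ?sqr_ge0.
  by rewrite [r ^+ a.+1]exprS le_eqVlt; apply/orP; left; apply/eqP; ring.
apply: le_trans (lerD h1 hA) _; rewrite -!mulrDl.
apply: ler_wpM2r; first exact: sqr_ge0.
apply: ler_wpM2r; first by rewrite exprn_ge0.
by rewrite -natr1; have : 0 <= a%:R :> R by []; nra.
Qed.

(** Formal partial derivatives. At exponent 0 the truncated predecessor does no harm, as the
    coefficient becomes 0. *)
Definition dmz (u : mono) : mono := (u.1 * u.2.1%:R, (u.2.1.-1, u.2.2)).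
Definition dmw (u : mono) : mono := (u.1 * u.2.2%:R, (u.2.1, u.2.2.-1)).

Definition ev l z w : C := \sum_(u <- l) u.1 * z ^+ u.2.1 * w ^+ u.2.2.
Definition maj l r t : R := \sum_(u <- l) nc u.1 * r ^+ u.2.1 * t ^+ u.2.2.

Lemma maj_ge0 l r t : 0 <= r -> 0 <= t -> 0 <= maj l r t.
Proof.
by move=> r0 t0; apply: sumr_ge0 => u _; rewrite !mulr_ge0 ?nc_ge0 ?exprn_ge0.
Qed.

Lemma nc_ev l z w r t : nc z <= r -> nc w <= t -> nc (ev l z w) <= maj l r t.
Proof.
move=> hz hw; apply: le_trans (nc_sum _ _ _) _; apply: ler_sum => u _.
have r0 := le_trans (nc_ge0 _) hz; have t0 := le_trans (nc_ge0 _) hw.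
by rewrite !ncM !ncX !ler_pM ?mulr_ge0 ?exprn_ge0 ?nc_ge0//
   lerXn2r ?nnegrE ?nc_ge0.
Qed.

(** The remainder of a product consists of the two one-variable remainders and the product of the
    increments. Measuring all three against one [rho] below both radii produces a single square. *)
Lemma mono_quad z w z' w' r t rho a b :
  0 < rho -> rho <= r -> rho <= t ->
  nc z <= r -> nc z' <= r -> nc w <= t -> nc w' <= t ->
  nc (z' ^+ a * w' ^+ b - z ^+ a * w ^+ b
     - a%:R * z ^+ a.-1 * w ^+ b * (z' - z) - b%:R * z ^+ a * w ^+ b.-1 * (w' - w))
  * rho ^+ 2 <=
    (a + b)%:R ^+ 2 * r ^+ a * t ^+ b * (nc (z' - z) + nc (w' - w)) ^+ 2.
Proof.
move=> rho0 hr ht hz hz' hw hw'.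
have r0 : 0 < r by apply: lt_le_trans hr.
have t0 : 0 < t by apply: lt_le_trans ht.
have n0 := @nc_ge0 R.
have := pow_diff2 a (ltW r0) hz hz'; have := pow_diff2 b (ltW t0) hw hw'.
have := pow_diff1 a (ltW r0) hz hz'; have := pow_diff1 b (ltW t0) hw hw'.
set d := nc (z' - z); set e := nc (w' - w).
set A := z' ^+ a - z ^+ a; set B := w' ^+ b - w ^+ b.
set QA := A - _; set QB := B - _ => hB hA hQB hQA.
have -> : z' ^+ a * w' ^+ b - z ^+ a * w ^+ b
     - a%:R * z ^+ a.-1 * w ^+ b * (z' - z) - b%:R * z ^+ a * w ^+ b.-1 * (w' - w)
   = QA * w ^+ b + A * B + z ^+ a * QB by rewrite /QA /QB /A /B; ring.
have d0 : 0 <= d by exact: n0.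
have e0 : 0 <= e by exact: n0.
clearbody QA QB A B d e.
have hwb : nc (w ^+ b) <= t ^+ b by rewrite ncX lerXn2r ?nnegrE ?nc_ge0 ?(ltW t0).
have hza : nc (z ^+ a) <= r ^+ a by rewrite ncX lerXn2r ?nnegrE ?nc_ge0 ?(ltW r0).
have ra0 : 0 <= r ^+ a by rewrite exprn_ge0 ?ltW.
have tb0 : 0 <= t ^+ b by rewrite exprn_ge0 ?ltW.
have a0 : 0 <= a%:R :> R by [].
have b0 : 0 <= b%:R :> R by [].
have hQA' : nc QA * rho ^+ 2 <= a%:R ^+ 2 * r ^+ a * d ^+ 2.
  by apply: le_trans hQA; apply: ler_wpM2l => //; rewrite lerXn2r ?nnegrE ?(ltW r0) ?(ltW rho0).
have hQB' : nc QB * rho ^+ 2 <= b%:R ^+ 2 * t ^+ b * e ^+ 2.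
  by apply: le_trans hQB; apply: ler_wpM2l => //; rewrite lerXn2r ?nnegrE ?(ltW t0) ?(ltW rho0).
have hA' : nc A * rho <= a%:R * r ^+ a * d.
  by apply: le_trans hA; apply: ler_wpM2l.
have hB' : nc B * rho <= b%:R * t ^+ b * e.
  by apply: le_trans hB; apply: ler_wpM2l.
have tri : nc (QA * w ^+ b + A * B + z ^+ a * QB) <=
    nc QA * nc (w ^+ b) + nc A * nc B + nc (z ^+ a) * nc QB.
  by rewrite -!ncM; apply: le_trans (ncD _ _) _; rewrite lerD2r ncD.
apply: le_trans (ler_wpM2r (sqr_ge0 _) tri) _; rewrite !mulrDl.
have h1 : nc QA * nc (w ^+ b) * rho ^+ 2 <= a%:R ^+ 2 * r ^+ a * d ^+ 2 * t ^+ b.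
  by rewrite mulrAC; apply: ler_pM; rewrite ?n0// mulr_ge0 ?sqr_ge0 ?n0.
have h2 : nc A * nc B * rho ^+ 2 <= a%:R * r ^+ a * d * (b%:R * t ^+ b * e).
  rewrite (_ : _ * _ * _ = (nc A * rho) * (nc B * rho)); last by ring.
  by apply: ler_pM => //; rewrite mulr_ge0 ?n0 ?ltW.
have h3 : nc (z ^+ a) * nc QB * rho ^+ 2 <= r ^+ a * (b%:R ^+ 2 * t ^+ b * e ^+ 2).
  by rewrite -[leLHS]mulrA; apply: ler_pM => //; rewrite mulr_ge0 ?n0 ?sqr_ge0.
apply: le_trans (lerD (lerD h1 h2) h3) _.
rewrite natrD.
set X := a%:R in a0 *; set Y := b%:R in b0 *.
rewrite (_ : _ + _ + _ = (r ^+ a * t ^+ b) *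
  (X ^+ 2 * d ^+ 2 + X * d * Y * e + Y ^+ 2 * e ^+ 2)); last by ring.
rewrite (_ : (X + Y) ^+ 2 * _ * _ * _ = (r ^+ a * t ^+ b) *
  ((X + Y) ^+ 2 * (d + e) ^+ 2)); last by ring.
apply: ler_wpM2l; first by rewrite mulr_ge0.
have h4 : 0 <= X * d by rewrite mulr_ge0.
have h5 : 0 <= Y * e by rewrite mulr_ge0.
have h6 : X * d + Y * e <= (X + Y) * (d + e).
  by have := mulr_ge0 a0 e0; have := mulr_ge0 b0 d0; lra.
apply: (@le_trans _ _ ((X * d + Y * e) ^+ 2)).
  have : 0 <= X * d * (Y * e) by rewrite mulr_ge0.
  by lra.
by rewrite -exprMn lerXn2r ?nnegrE// ?addr_ge0// mulr_ge0 ?addr_ge0.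
Qed.

Definition maj2 l r t : R :=
  \sum_(u <- l) nc u.1 * (u.2.1 + u.2.2)%:R ^+ 2 * r ^+ u.2.1 * t ^+ u.2.2.

Lemma ev_quad l z w z' w' r t rho : 0 < rho -> rho <= r -> rho <= t ->
  nc z <= r -> nc z' <= r -> nc w <= t -> nc w' <= t ->
  nc (ev l z' w' - ev l z w - ev (map dmz l) z w * (z' - z)
      - ev (map dmw l) z w * (w' - w))
    <= maj2 l r t / rho ^+ 2 * (nc (z' - z) + nc (w' - w)) ^+ 2.
Proof.
move=> rho0 hr ht hz hz' hw hw'.
rewrite mulrAC ler_pdivlMr ?exprn_gt0//.
elim: l => [|[c [a b]] l IH].
  by rewrite /ev /maj2 !big_nil !mul0r !subr0 nc0 !mul0r.
rewrite /ev /maj2 /= !big_cons -/(ev _ _ _) -/(ev l z w) -/(ev (map dmz l) z w).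
rewrite -/(ev (map dmw l) z w) -/(maj2 l r t) /=.
set E' := ev l z' w' in IH *; set E := ev l z w in IH *.
set Ez := ev _ z w in IH *; set Ew := ev _ z w in IH *.
rewrite (_ : _ - _ - _ - _ =
  c * (z' ^+ a * w' ^+ b - z ^+ a * w ^+ b - a%:R * z ^+ a.-1 * w ^+ b * (z' - z)
     - b%:R * z ^+ a * w ^+ b.-1 * (w' - w))
  + (E' - E - Ez * (z' - z) - Ew * (w' - w))); last by ring.
apply: le_trans (ler_wpM2r (sqr_ge0 _) (ncD _ _)) _.
rewrite !mulrDl; apply: lerD => //.
have := ler_wpM2l (nc_ge0 c) (mono_quad a b rho0 hr ht hz hz' hw hw').
by rewrite ncM !mulrA.
Qed.

(** Differentiation brings in polynomial factors of the degree; this pays for them by a slight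
    enlargement of the radii. Bernoulli's inequality for the square root of [lam] gives linear
    growth, hence quadratic growth for [lam]. *)
Lemma poly_le_geom (lam : R) : 1 < lam -> exists2 K : R, 0 < K &
  forall n, (n%:R + 1) ^+ 2 <= K * lam ^+ n.
Proof.
move=> l1; pose mu := Num.sqrt lam.
have l0 : 0 <= lam by lra.
have mu1 : 1 < mu.
  rewrite ltNge; apply/negP => m1.
  by have := sqr_sqrtr l0; have := sqrtr_ge0 lam; rewrite -/mu; nra.
have h0 : 0 < mu - 1 by rewrite subr_gt0.
have mu2 : mu ^+ 2 = lam by exact: sqr_sqrtr.
clearbody mu.
have B n : 1 + n%:R * (mu - 1) <= mu ^+ n.
  elim: n => [|n IH]; first by rewrite mul0r addr0 expr0.
  rewrite exprS -natr1.
  have m0 : 0 <= mu by lra.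
  have := ler_wpM2l m0 IH.
  have : 0 <= n%:R * ((mu - 1) * (mu - 1)) by rewrite !mulr_ge0 ?(ltW h0).
  lra.
exists ((1 + (mu - 1)^-1) ^+ 2).
  by rewrite exprn_gt0// addr_gt0// invr_gt0.
move=> n.
have -> : lam ^+ n = (mu ^+ n) ^+ 2.
  by rewrite -exprM mulnC exprM mu2.
rewrite -exprMn; rewrite lerXn2r ?nnegrE ?addr_ge0//.
  by rewrite mulr_ge0 ?addr_ge0 ?invr_ge0 ?exprn_ge0// ltW//; lra.
apply: (@le_trans _ _ ((1 + (mu - 1)^-1) * (1 + n%:R * (mu - 1)))).
  have hn : mu - 1 != 0 by rewrite gt_eqF.
  have E (x h : R) : h != 0 -> (1 + h^-1) * (1 + x * h) = 1 + x * h + h^-1 + x.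
    by move=> ?; field.
  rewrite (E _ _ hn).
  have : 0 <= n%:R * (mu - 1) by rewrite mulr_ge0// ltW.
  have : 0 < (mu - 1)^-1 by rewrite invr_gt0.
  lra.
by apply: ler_wpM2l (B n); rewrite addr_ge0// invr_ge0 ltW.
Qed.

Lemma maj2_le l r t lam K : 0 <= r -> 0 <= t -> 0 <= lam ->
  (forall n, (n%:R + 1) ^+ 2 <= K * lam ^+ n) ->
  maj2 l r t <= K * maj l (lam * r) (lam * t).
Proof.
move=> r0 t0 l0 hK; rewrite /maj2 /maj mulr_sumr; apply: ler_sum => u _.
set a := u.2.1; set b := u.2.2.
rewrite !exprMn.
rewrite (_ : K * _ = nc u.1 * (K * (lam ^+ a * lam ^+ b)) * r ^+ a * t ^+ b);
  last by ring.
rewrite -exprD.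
apply: ler_wpM2r; first by rewrite exprn_ge0.
apply: ler_wpM2r; first by rewrite exprn_ge0.
apply: ler_wpM2l; first exact: nc_ge0.
apply: le_trans (hK _).
by rewrite lerXn2r ?nnegrE ?addr_ge0// lerDl.
Qed.

Lemma nat_le_geom n (lam K : R) :
  (forall n, (n%:R + 1) ^+ 2 <= K * lam ^+ n) -> n%:R <= K * lam ^+ n.
Proof.
move=> hK; apply: le_trans (hK n).
have : 0 <= n%:R :> R by []. 
nra.
Qed.

Lemma maj_dmz l r t lam K : 0 < r -> 0 <= t -> 1 <= lam -> 0 <= K ->
  (forall n, (n%:R + 1) ^+ 2 <= K * lam ^+ n) ->
  maj (map dmz l) r t <= K / r * maj l (lam * r) (lam * t).
Proof.
move=> r0 t0 l1 K0 hK; rewrite /maj big_map mulr_sumr; apply: ler_sum => u _ /=.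
set a := u.2.1; set b := u.2.2.
rewrite [leRHS]mulrAC ler_pdivlMr//= ncM nc_nat.
apply: (@le_trans _ _ (nc u.1 * a%:R * r ^+ a * t ^+ b)).
  rewrite -!mulrA; apply: ler_wpM2l; first exact: nc_ge0.
  case: a => [|a]; first by rewrite !mul0r.
  by rewrite /= exprS le_eqVlt; apply/orP; left; apply/eqP; ring.
rewrite !exprMn.
rewrite (_ : K * _ = nc u.1 * (K * lam ^+ a) * r ^+ a * (t ^+ b * lam ^+ b));
  last by ring.
have l0 : 0 <= lam by lra.
have k0 : 0 <= nc u.1 * (K * lam ^+ a) * r ^+ a.
  by rewrite !mulr_ge0 ?nc_ge0 ?exprn_ge0// ltW.
apply: (@le_trans _ _ (nc u.1 * (K * lam ^+ a) * r ^+ a * t ^+ b)).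
  apply: ler_wpM2r; first by rewrite exprn_ge0.
  apply: ler_wpM2r; first by rewrite exprn_ge0// ltW.
  by apply: ler_wpM2l; [exact: nc_ge0|exact: nat_le_geom].
by apply: ler_wpM2l => //; rewrite ler_peMr ?exprn_ge0// exprn_ege1.
Qed.

Lemma maj_dmw l r t lam K : 0 <= r -> 0 < t -> 1 <= lam -> 0 <= K ->
  (forall n, (n%:R + 1) ^+ 2 <= K * lam ^+ n) ->
  maj (map dmw l) r t <= K / t * maj l (lam * r) (lam * t).
Proof.
(* Exchanging the variables reduces the claim to [maj_dmz]. *)
pose sw (u : mono) : mono := (u.1, (u.2.2, u.2.1)).
have majsw k r' t' : maj (map sw k) r' t' = maj k t' r'.
  by rewrite /maj big_map; apply: eq_bigr => u _ /=; ring.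
move=> r0 t0 l1 K0 hK.
have := @maj_dmz (map sw l) t r lam K t0 r0 l1 K0 hK.
rewrite majsw; apply: le_trans.
rewrite -[leRHS]majsw -!map_comp /maj !big_map.
by rewrite le_eqVlt; apply/orP; left; apply/eqP; apply: eq_bigr => u _ /=.
Qed.

(** A series is a sequence of finite blocks of monomials, and [summ] is its normal convergence on
    the closed bidisc of radii [r] and [t]. *)
Definition summ P r t := exists M : R, forall n, \sum_(i < n) maj (P i) r t <= M.

Definition PS P z w : C := csum (fun n => ev (P n) z w).

Definition DZ P := fun n => map dmz (P n).
Definition DW P := fun n => map dmw (P n).

Lemma summ_scale P Q r t r' t' K : 0 <= K ->
  (forall n, maj (Q n) r t <= K * maj (P n) r' t') ->
  summ P r' t' -> summ Q r t.
Proof.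
move=> K0 h [M hM]; exists (K * M) => n.
apply: (@le_trans _ _ (\sum_(i < n) K * maj (P i) r' t')).
  by apply: ler_sum.
by rewrite -mulr_sumr ler_wpM2l.
Qed.

Lemma summ_DZ P r t lam : 0 < r -> 0 <= t -> 1 < lam ->
  summ P (lam * r) (lam * t) -> summ (DZ P) r t.
Proof.
move=> r0 t0 l1; have [K K0 hK] := poly_le_geom l1.
apply: (@summ_scale _ _ _ _ _ _ (K / r)); first by rewrite divr_ge0 ?ltW.
by move=> n; apply: maj_dmz => //; exact: ltW.
Qed.

Lemma summ_DW P r t lam : 0 <= r -> 0 < t -> 1 < lam ->
  summ P (lam * r) (lam * t) -> summ (DW P) r t.
Proof.
move=> r0 t0 l1; have [K K0 hK] := poly_le_geom l1.
apply: (@summ_scale _ _ _ _ _ _ (K / t)); first by rewrite divr_ge0 ?ltW.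
by move=> n; apply: maj_dmw => //; exact: ltW.
Qed.

Lemma PS_bounded P r t M z w : (forall n, \sum_(i < n) maj (P i) r t <= M) ->
  nc z <= r -> nc w <= t -> sum_bounded (fun n => ev (P n) z w) M.
Proof.
move=> hM hz hw n; apply: le_trans (hM n); apply: ler_sum => i _; exact: nc_ev.
Qed.

(** The remainder of each block is controlled by its majorant at the larger radii, uniformly in both
    points, so the bounds of the blocks can be summed. *)
Lemma PS_quad P r t lam : 0 < r -> 0 < t -> 1 < lam ->
  summ P (lam * r) (lam * t) ->
  exists2 M : R, 0 <= M & forall z w z' w',
    nc z <= r -> nc z' <= r -> nc w <= t -> nc w' <= t ->
    nc (PS P z' w' - PS P z w - PS (DZ P) z w * (z' - z) - PS (DW P) z w * (w' - w))
      <= M * (nc (z' - z) + nc (w' - w)) ^+ 2.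
Proof.
move=> r0 t0 l1 sP.
have [Mz hz] := summ_DZ r0 (ltW t0) l1 sP.
have [Mw hw] := summ_DW (ltW r0) t0 l1 sP.
have [K K0 hK] := poly_le_geom l1.
have [M hM] := sP.
pose rho := Num.min r t.
have rho0 : 0 < rho by rewrite /rho lt_min r0.
have rr : rho <= r by rewrite /rho ge_min lexx.
have rt : rho <= t by rewrite /rho ge_min lexx orbT.
have l0 : 0 <= lam by lra.
have M0 : 0 <= M by apply: le_trans (hM 0); rewrite big_ord0.
have hM' n : \sum_(i < n) maj (P i) r t <= M.
  apply: le_trans (hM n); apply: ler_sum => i _; apply: ler_sum => u _.
  have h a x : 0 < x -> x ^+ a <= (lam * x) ^+ a.
    move=> x0; rewrite lerXn2r ?nnegrE ?mulr_ge0//; try exact: ltW.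
    by rewrite ler_peMl ?ltW.
  by rewrite !ler_pM ?mulr_ge0 ?exprn_ge0 ?nc_ge0 ?h// ltW.
exists (K * M / rho ^+ 2); first by rewrite !mulr_ge0 ?invr_ge0 ?exprn_ge0 ?(ltW rho0)// ltW.
move=> z w z' w' hz1 hz2 hw1 hw2.
set D := (_ + _) ^+ 2.
pose rem n := ev (P n) z' w' - ev (P n) z w - ev (DZ P n) z w * (z' - z)
      - ev (DW P n) z w * (w' - w).
have remB : sum_bounded rem (K * M / rho ^+ 2 * D).
  move=> n; apply: (@le_trans _ _
      (\sum_(i < n) K * maj (P i) (lam * r) (lam * t) / rho ^+ 2 * D)).
    apply: ler_sum => i _; apply: le_trans (ev_quad _ rho0 rr rt hz1 hz2 hw1 hw2) _.
    apply: ler_wpM2r; first exact: sqr_ge0.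
    apply: ler_wpM2r; first by rewrite invr_ge0 sqr_ge0.
    by apply: maj2_le => //; exact: ltW.
  rewrite -!mulr_suml -mulr_sumr.
  apply: ler_wpM2r; first exact: sqr_ge0.
  apply: ler_wpM2r; first by rewrite invr_ge0 sqr_ge0.
  by apply: ler_wpM2l; [exact: ltW|exact: hM].
have -> : PS P z' w' - PS P z w - PS (DZ P) z w * (z' - z)
    - PS (DW P) z w * (w' - w) = csum rem; last exact: csum_le.
have b1 := PS_bounded hM' hz2 hw2.
have b2 := PS_bounded hM' hz1 hw1.
have b3 := PS_bounded hz hz1 hw1.
have b4 := PS_bounded hw hz1 hw1.
have l1' := sum_bounded_lin (-1) b2 b1.
have l2' := sum_bounded_lin (- (z' - z)) b3 l1'.
rewrite (_ : rem = fun n => - (w' - w) * ev (DW P n) z w +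
  (- (z' - z) * ev (DZ P n) z w + (-1 * ev (P n) z w + ev (P n) z' w'))).
  have E1 := csum_lin (-1) b2 b1; have E2 := csum_lin (- (z' - z)) b3 l1'.
  have E3 := csum_lin (- (w' - w)) b4 l2'.
  rewrite E3 E2 E1 -/(PS P z' w') -/(PS P z w) -/(PS (DZ P) z w) -/(PS (DW P) z w).
  by move: (PS P z' w') (PS P z w) (PS _ z w) (PS _ z w) => x1 x2 x3 x4; ring.
by apply/funext => n; rewrite /rem; ring.
Qed.

End PowerSeries.

(** * Generic parameters *)

(** Makes row vectors both complete and normed, the setting of Baire's theorem in
    [generic_params]. *)
HB.instance Definition _ (R : realType) (m n : nat) :=
  Complete.copy 'M[R]_(m, n) 'M[R]_(m, n).

Section Genericity.
Variable R : realType.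

Lemma nbhs_rVreal n (p : 'rV[R]_n) (A : set 'rV[R]_n) :
  nbhs p A <-> exists2 e : R, 0 < e &
    forall q : 'rV[R]_n, (forall j, `|q 0 j - p 0 j| < e) -> A q.
Proof.
split=> [/nbhs_ballP[e e0 eA]|[e e0 eA]].
  exists e => // w wd; apply: eA; split=> // i j.
  by rewrite ord1 -ball_normE/= distrC.
apply/nbhs_ballP; exists e => // w h; apply: eA => j; have := h.2 0 j.
by rewrite -ball_normE/= distrC.
Qed.

(* Pigeonhole: [m ^ b] separated grid points cannot lie in an image that is
   covered by the images of [O(m ^ a)] small cells. *)
Lemma lipschitz_image_nowhere_dense a b (K : set 'rV[R]_a)
    (Phi : 'rV[R]_a -> 'rV[R]_b) (L B : R) : (a < b)%N -> compact K ->
  (forall x j, K x -> `|x 0 j| <= B) ->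
  (forall x y (d : R), K x -> K y -> (forall j, `|x 0 j - y 0 j| <= d) ->
     forall i, `|Phi x 0 i - Phi y 0 i| <= L * d) ->
  open (~` (Phi @` K)) /\ dense (~` (Phi @` K)).
Proof.
move=> ab cK KB lip.
pose M := Num.max 1 L.
have M0 : 0 < M by rewrite lt_max ltr01.
have LM : L <= M by rewrite le_max lexx orbT.
split.
  apply: closed_openC; apply: compact_closed; first exact: norm_hausdorff.
  apply: continuous_compact cK; apply/subspace_continuousP => x Kx V.
  move=> /nbhs_rVreal[e e0 eV]; apply/nbhs_rVreal.
  exists (e / (2 * M)); first by rewrite divr_gt0// mulr_gt0.
  move=> y xy Ky; apply: eV => j.
  apply: le_lt_trans (lip y x (e / (2 * M)) Ky Kx _ j) _.
    by move=> i; exact/ltW.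
  have ds : 0 < e / (2 * M) by rewrite divr_gt0// mulr_gt0.
  apply: (@le_lt_trans _ _ (M * (e / (2 * M)))); first by rewrite ler_pM2r.
  have -> : M * (e / (2 * M)) = e / 2 by field; rewrite gt_eqF.
  by rewrite ltr_pdivrMr// ltr_pMr// ltr1n.
move=> O [th0 Oth0] oO.
have /nbhs_rVreal[e e0 eO] : nbhs th0 O by apply: open_nbhs_nbhs.
apply: contrapT => noth.
have im th : O th -> exists2 x, K x & Phi x = th.
  move=> Oth; apply: contrapT => h; apply: noth; exists th; split; first exact: Oth.
  by move=> [x Kx xth]; apply: h; exists x.
(* The grid has [m ^ b] points, of spacing [h = e / m]. A cell has side [s = h / (2 M)], so an axis
   of length [2 max(0, B)] meets at most [c m] cells, which makes [c ^ a m ^ a] in all. With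
   [m = c ^ a + 1] this is less than [m ^ (a + 1) <= m ^ b]. *)
pose c := (Num.trunc (4 * Num.max 0 B * M / e)).+1.
pose m := (c ^ a).+1.
have m0 : 0 < m%:R :> R by rewrite ltr0n.
pose h := e / m%:R.
have h0 : 0 < h by rewrite divr_gt0.
pose s := h / (2 * M).
have s0 : 0 < s by rewrite divr_gt0// mulr_gt0.
pose th (v : {ffun 'I_b -> 'I_m}) : 'rV[R]_b := \row_i (th0 0 i + h * (v i)%:R).
have Oth v : O (th v).
  apply: eO => j; rewrite mxE addrAC subrr add0r normrM gtr0_norm// normr_nat.
  by rewrite /h mulrAC ltr_pdivrMr// ltr_pM2l// ltr_nat.
pose x v : 'rV[R]_a := s2val (cid2 (im _ (Oth v))).
have Kx v : K (x v) by rewrite /x; case: cid2.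
have xth v : Phi (x v) = th v by rewrite /x; case: cid2.
pose cell (v : {ffun 'I_b -> 'I_m}) (j : 'I_a) := Num.trunc ((x v 0 j + Num.max 0 B) / s).
have bnd v j : 0 <= (x v 0 j + Num.max 0 B) / s < (c * m)%:R.
  have xB : `|x v 0 j| <= Num.max 0 B by rewrite (le_trans (KB _ _ (Kx v)))// le_max lexx orbT.
  move: xB; set B' := Num.max 0 B; rewrite ler_norml => /andP[x1 x2].
  apply/andP; split; first by rewrite divr_ge0 ?(ltW s0)//; lra.
  rewrite ltr_pdivrMr// /s /h.
  have : 4 * B' * M / e < c%:R by exact: truncnS_gt.
  rewrite ltr_pdivrMr// natrM => hc.
  have E (C' m' M' : R) : m' != 0 -> M' != 0 ->
      C' * m' * (e / m' / (2 * M')) = C' * e / (2 * M').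
    by move=> ? ?; field; apply/andP.
  rewrite E ?gt_eqF//.
  rewrite ltr_pdivlMr ?mulr_gt0//.
  apply: le_lt_trans hc.
  by have : 0 <= (B' - x v 0 j) * M; [rewrite mulr_ge0 ?subr_ge0 ?(ltW M0)|lra].
have cb v j : (cell v j < c * m)%N.
  by have /andP[b1 b2] := bnd v j; rewrite /cell truncn_lt_nat.
pose f (v : {ffun 'I_b -> 'I_m}) : {ffun 'I_a -> 'I_(c * m)} :=
  [ffun j => Ordinal (cb v j)].
(* Preimages in one cell have images at distance at most [M s = h / 2], whereas distinct grid points
   differ by at least [h] in some coordinate. *)
have injf : injective f.
  move=> v w fvw; apply/ffunP => i; apply/val_inj/eqP; apply/negPn/negP => ne.
  have d j : `|x v 0 j - x w 0 j| <= s.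
    have /ffunP/(_ j) := fvw; rewrite !ffunE => -[cvw].
    have /andP[v1 v2] := bnd v j; have /andP[w1 w2] := bnd w j.
    have /andP[v3 v4] := truncn_itv v1; have /andP[w3 w4] := truncn_itv w1.
    move: v3 v4 w3 w4; rewrite /cell in cvw; rewrite cvw -natr1.
    move: (Num.trunc _)%:R => T; rewrite !(ler_pdivlMr _ _ s0) !(ltr_pdivrMr _ _ s0).
    move=> v3 v4 w3 w4.
    by rewrite ler_norml; apply/andP; split; lra.
  have := lip _ _ _ (Kx v) (Kx w) d i; rewrite !xth !mxE.
  apply/negP; rewrite -ltNge.
  apply: (@le_lt_trans _ _ (h / 2)).
    rewrite (_ : h / 2 = M * s); first by rewrite ler_pM2r.
    have E (h' M' : R) : M' != 0 -> h' / 2 = M' * (h' / (2 * M')) by move=> ?; field.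
    by rewrite /s; apply: E; rewrite gt_eqF.
  apply: (@lt_le_trans _ _ h); first by rewrite ltr_pdivrMr// ltr_pMr// ltr1n.
  rewrite (_ : _ - _ = h * ((v i)%:R - (w i)%:R)); last by ring.
  rewrite normrM gtr0_norm// ler_peMr ?(ltW h0)//.
  move: ne; rewrite neq_ltn => /orP[] lt.
    by rewrite distrC ger0_norm ?subr_ge0 ?ler_nat ?(ltnW lt)// lerBrDl natr1 ler_nat.
  by rewrite ger0_norm ?subr_ge0 ?ler_nat ?(ltnW lt)// lerBrDl natr1 ler_nat.
have := leq_card _ injf; rewrite !card_ffun !card_ord expnMn; apply/negP.
rewrite -ltnNge; apply: (@leq_trans (m ^ a.+1)); last by rewrite leq_exp2l// ltnS expn_gt0.
by rewrite expnS ltn_pmul2r ?expn_gt0.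
Qed.

Local Notation C := (cplx R).

Definition cvec m (x : 'rV[R]_(m + m)) (j : 'I_m) : C :=
  (x 0 (lshift m j) +i* x 0 (rshift m j))%C.

Definition rvec m (u : 'I_m -> C) : 'rV[R]_(m + m) :=
  row_mx (\row_j complex.Re (u j)) (\row_j complex.Im (u j)).

Lemma rvecK m (u : 'I_m -> C) j : cvec (rvec u) j = u j.
Proof.
by rewrite /cvec /rvec row_mxEl row_mxEr !mxE; case: (u j).
Qed.

Lemma cvec_dist m (x y : 'rV[R]_(m + m)) (j : 'I_m) (d : R) :
  (forall i, `|x 0 i - y 0 i| <= d) -> nc (cvec x j - cvec y j) <= 2 * d.
Proof.
move=> h; apply: le_trans (nc_ReIm _) _; rewrite /= mulrDl mul1r.
by apply: lerD; exact: h.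
Qed.

Lemma rvec_dist m (u v : 'I_m -> C) (d : R) :
  (forall j, nc (u j - v j) <= d) -> forall i, `|rvec u 0 i - rvec v 0 i| <= d.
Proof.
move=> h i; rewrite /rvec -(fintype.splitK i); case: (fintype.split i) => j /=.
  rewrite !row_mxEl !mxE -cReN -cReD; apply: le_trans (h j); exact: nc_Re.
rewrite !row_mxEr !mxE -cImN -cImD; apply: le_trans (h j); exact: nc_Im.
Qed.

Lemma compact_polydisc m (r : 'I_m -> R) :
  compact [set x : 'rV[R]_(m + m) | forall j, nc (cvec x j) <= r j].
Proof.
pose B := \sum_j `|r j|.
have rB j : r j <= B.
  apply: le_trans (ler_norm _) _; rewrite /B (bigD1 j)//= lerDl.
  exact: sumr_ge0.
apply: bounded_closed_compact.
  exists B; split=> [|M BM x hx]; first exact: num_real.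
  apply: le_trans (ltW BM).
  have B0 : 0 <= B by exact: sumr_ge0.
  rewrite [leLHS]/Num.norm/= mx_normrE; apply: bigmax_le => // -[i j] _ /=.
  rewrite ord1; rewrite -(fintype.splitK j).
  case: (fintype.split j) => k /=; apply: le_trans (le_trans (hx k) (rB k)).
    exact: (nc_Re (cvec x k)).
  exact: (nc_Im (cvec x k)).
rewrite -[X in closed X]setCK; apply: open_closedC; rewrite openE => x hx.
have [j hj] : exists j, r j < nc (cvec x j).
  apply: contrapT => h; apply: hx => j; rewrite leNgt; apply/negP => lt.
  by apply: h; exists j.
apply/nbhs_rVreal; exists ((nc (cvec x j) - r j) / 4).
  by rewrite divr_gt0// subr_gt0.
move=> y xy hy; have := hy j.
have : nc (cvec y j - cvec x j) <= 2 * ((nc (cvec x j) - r j) / 4).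
  by apply: cvec_dist => i; apply: ltW.
have := ncB (cvec y j) (cvec y j - cvec x j).
rewrite opprB addrCA subrr addr0.
lra.
Qed.

(** Countably many closed bidiscs stand for the domain. A negative radius gives an empty one, which
    serves as a dummy in the enumeration of [regular_params]. *)
Lemma generic_params (f g h : C -> C -> C) (r t : nat -> R) (a0 b0 c0 : C) (eta : R) :
  0 < eta ->
  (forall n, exists2 L : R, 0 <= L & forall z w z' w',
    nc z <= r n -> nc w <= t n -> nc z' <= r n -> nc w' <= t n ->
    [/\ nc (f z w - f z' w') <= L * (nc (z - z') + nc (w - w')),
        nc (g z w - g z' w') <= L * (nc (z - z') + nc (w - w')) &
        nc (h z w - h z' w') <= L * (nc (z - z') + nc (w - w'))]) ->
  exists a b c : C, [/\ nc (a - a0) < eta, nc (b - b0) < eta, nc (c - c0) < eta &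
    forall n z w, nc z <= r n -> nc w <= t n ->
      ~ [/\ f z w = a, g z w = b & h z w = c]].
Proof.
move=> eta0 lip.
pose i0 : 'I_2 := ord0; pose i1 : 'I_2 := lift ord0 ord0.
pose tr (a b c : C) (j : 'I_3) : C := nth 0 [:: a; b; c] j.
pose Phi (x : 'rV[R]_(2 + 2)) : 'rV[R]_(3 + 3) :=
  rvec (tr (f (cvec x i0) (cvec x i1)) (g (cvec x i0) (cvec x i1))
           (h (cvec x i0) (cvec x i1))).
pose rad n (j : 'I_2) : R := nth 0 [:: r n; t n] j.
pose K n := [set x : 'rV[R]_(2 + 2) | forall j, nc (cvec x j) <= rad n j].
have K0 n x : K n x -> nc (cvec x i0) <= r n by move=> /(_ i0).
have K1 n x : K n x -> nc (cvec x i1) <= t n by move=> /(_ i1).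
have od n : open (~` (Phi @` K n)) /\ dense (~` (Phi @` K n)).
  have [L L0 hL] := lip n.
  apply: (@lipschitz_image_nowhere_dense _ _ _ _ (L * 4) (`|r n| + `|t n|)) => //.
  - exact: compact_polydisc.
  - move=> x j Kx; rewrite -(fintype.splitK j); case: (fintype.split j) => k /=.
      apply: le_trans (nc_Re (cvec x k)) _; apply: le_trans (Kx k) _.
      case: k => -[|[|//]] ? /=; rewrite /rad/=; apply: le_trans (ler_norm _) _;
        by rewrite ?lerDl ?lerDr.
    apply: le_trans (nc_Im (cvec x k)) _; apply: le_trans (Kx k) _.
    case: k => -[|[|//]] ? /=; rewrite /rad/=; apply: le_trans (ler_norm _) _;
      by rewrite ?lerDl ?lerDr.
  - move=> x y d Kx Ky xy; apply: rvec_dist => j.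
    have [hf hg hh] := hL _ _ _ _ (K0 _ _ Kx) (K1 _ _ Kx) (K0 _ _ Ky) (K1 _ _ Ky).
    have c0' := cvec_dist i0 xy; have c1' := cvec_dist i1 xy.
    have hD : L * (nc (cvec x i0 - cvec y i0) + nc (cvec x i1 - cvec y i1)) <= L * 4 * d.
      by rewrite -mulrA; apply: ler_wpM2l => //; lra.
    by apply: le_trans hD; case: j => -[|[|[|//]]] ?.
have := Baire od.
(* Half of [eta] for each real coordinate, as a modulus is at most the sum of the absolute values of
   its two parts. *)
move=> /(_ [set x | forall i, `|x 0 i - rvec (tr a0 b0 c0) 0 i| < eta / 2]).
case.
- exists (rvec (tr a0 b0 c0)) => i /=; rewrite subrr normr0; exact: divr_gt0.
- rewrite openE => x hx; apply/nbhs_rVreal.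
  pose e := \big[Order.min/eta / 2]_i (eta / 2 - `|x 0 i - rvec (tr a0 b0 c0) 0 i|).
  exists e.
    rewrite /e; apply: (big_ind (fun y => 0 < y)) => [|u v u0 v0|i _].
    - exact: divr_gt0.
    - by rewrite lt_min u0.
    - by rewrite subr_gt0; exact: hx.
  move=> y xy i; have := xy i; have : e <= eta / 2 - `|x 0 i - rvec (tr a0 b0 c0) 0 i|.
    by rewrite /e; exact: bigmin_le_cond.
  rewrite (_ : y 0 i - rvec (tr a0 b0 c0) 0 i =
    (y 0 i - x 0 i) + (x 0 i - rvec (tr a0 b0 c0) 0 i)); last by ring.
  have := ler_normD (y 0 i - x 0 i) (x 0 i - rvec (tr a0 b0 c0) 0 i).
  lra.
move=> x [hx xB].
pose j0 : 'I_3 := ord0; pose j1 : 'I_3 := lift ord0 ord0; pose j2 : 'I_3 := ord_max.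
have near j : nc (cvec x j - tr a0 b0 c0 j) < eta.
  rewrite -[tr _ _ _ j]rvecK; apply: le_lt_trans (nc_ReIm _) _.
  by rewrite [ltRHS]splitr /=; apply: ltrD; exact: hx.
exists (cvec x j0), (cvec x j1), (cvec x j2); split; [exact: (near j0)|
  exact: (near j1)|exact: (near j2)|].
move=> n z w zr wt [hf hg hh]; apply: (xB n I).
have trE : tr z w 0 = tr z w 0 by [].
pose p : 'rV[R]_(2 + 2) := rvec (fun j : 'I_2 => nth 0 [:: z; w] j).
exists p; first by move=> j; rewrite /p rvecK; case: j => -[|[|//]] ?.
have p0 : cvec p i0 = z by rewrite /p rvecK.
have p1 : cvec p i1 = w by rewrite /p rvecK.
rewrite /Phi p0 p1 hf hg hh; apply/rowP => i.
rewrite -(fintype.splitK i); case: (fintype.split i) => j /=; rewrite /rvec ?row_mxEl ?row_mxEr mxE.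
  by case: j => -[|[|[|//]]] ?; rewrite /tr /=; congr (x 0 _); apply/val_inj.
by case: j => -[|[|[|//]]] ?; rewrite /tr /=; congr (x 0 _); apply/val_inj.
Qed.

End Genericity.

(** * Implicit functions *)

Section OneVariable.
Variable R : realType.
Local Notation C := (cplx R).

(** The remainder is quadratic, as it is for every holomorphic function; the rules of
    differentiation then become explicit inequalities without limits. *)
Definition hder (f : C -> C) (z a : C) := exists2 d : R, 0 < d &
  exists2 M : R, 0 <= M & forall z', nc (z' - z) < d ->
    nc (f z' - f z - a * (z' - z)) <= M * nc (z' - z) ^+ 2.

Lemma hder_cst c z : hder (fun=> c) z 0.
Proof.
exists 1 => //; exists 0 => // z' _.
by rewrite subrr sub0r mul0r oppr0 nc0 mul0r.
Qed.

Lemma hder_id z : hder id z 1.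
Proof.
exists 1 => //; exists 0 => // z' _.
by rewrite mul1r subrr nc0 mul0r.
Qed.

Lemma hder_near f g z a (d : R) : 0 < d ->
  (forall z', nc (z' - z) < d -> f z' = g z') -> hder f z a -> hder g z a.
Proof.
move=> d0 fg [e e0 [M M0 h]]; exists (Num.min d e); first by rewrite lt_min d0.
exists M => // z'; rewrite lt_min => /andP[z'd z'e].
by rewrite -!fg ?h// subrr nc0.
Qed.

Lemma hder_lip f z a : hder f z a -> exists2 d : R, 0 < d &
  exists2 L : R, 0 <= L & forall z', nc (z' - z) < d ->
    nc (f z' - f z) <= L * nc (z' - z).
Proof.
move=> [d d0 [M M0 h]]; exists (Num.min d 1); first by rewrite lt_min d0/=.
exists (M + nc a); first by rewrite addr_ge0 ?nc_ge0.
move=> z'; rewrite lt_min => /andP[zd z1].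
rewrite (_ : f z' - f z = (f z' - f z - a * (z' - z)) + a * (z' - z)); last by ring.
apply: le_trans (ncD _ _) _; rewrite mulrDl; apply: lerD; last by rewrite ncM.
apply: le_trans (h _ zd) _; apply: ler_wpM2l => //.
by have := nc_ge0 (z' - z); nra.
Qed.

Lemma hderD f g z a b : hder f z a -> hder g z b ->
  hder (fun z => f z + g z) z (a + b).
Proof.
move=> [d d0 [M M0 hf]] [e e0 [N N0 hg]].
exists (Num.min d e); first by rewrite lt_min d0.
exists (M + N); first exact: addr_ge0.
move=> z'; rewrite lt_min => /andP[/hf zd /hg ze].
rewrite (_ : _ - _ - _ = (f z' - f z - a * (z' - z)) + (g z' - g z - b * (z' - z)));
  last by ring.
by apply: le_trans (ncD _ _) _; rewrite mulrDl lerD.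
Qed.

Lemma hderM f g z a b : hder f z a -> hder g z b ->
  hder (fun z => f z * g z) z (a * g z + f z * b).
Proof.
move=> hf0 hg0; have [d d0 [M M0 hf]] := hf0; have [e e0 [N N0 hg]] := hg0.
have [d1 d10 [L L0 lf]] := hder_lip hf0; have [e1 e10 [K K0 lg]] := hder_lip hg0.
exists (Num.min (Num.min d e) (Num.min d1 e1)).
  by rewrite !lt_min d0 e0 d10.
exists (M * nc (g z) + N * nc (f z) + L * K).
  by rewrite !addr_ge0 ?mulr_ge0 ?nc_ge0.
move=> z'; rewrite !lt_min => /andP[/andP[/hf zd /hg ze] /andP[/lf zd1 /lg ze1]].
rewrite (_ : _ - _ - _ = (f z' - f z - a * (z' - z)) * g z
   + (g z' - g z - b * (z' - z)) * f z + (f z' - f z) * (g z' - g z)); last by ring.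
apply: le_trans (ncD _ _) _; rewrite [leRHS]mulrDl; apply: lerD.
  apply: le_trans (ncD _ _) _; rewrite [leRHS]mulrDl !ncM; apply: lerD.
    by rewrite [leRHS]mulrAC ler_wpM2r ?nc_ge0.
  by rewrite [leRHS]mulrAC ler_wpM2r ?nc_ge0.
rewrite ncM (_ : L * K * _ = (L * nc (z' - z)) * (K * nc (z' - z))); last by ring.
by apply: ler_pM; rewrite ?nc_ge0.
Qed.

Lemma hderV f z a : f z != 0 -> hder f z a ->
  hder (fun z => (f z)^-1) z (- a / f z ^+ 2).
Proof.
move=> fz0 hf0; have [d d0 [M M0 hf]] := hf0.
have [d1 d10 [L L0 lf]] := hder_lip hf0.
have n0 : 0 < nc (f z) by rewrite nc_gt0.
(* Within this distance of [z] the value [f z'] keeps at least half the modulus of [f z]. *)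
pose e := nc (f z) / (2 * (L + 1)).
have e0 : 0 < e by rewrite divr_gt0// mulr_gt0// ltr_wpDl.
exists (Num.min (Num.min d d1) e); first by rewrite !lt_min d0 d10.
set A := nc (f z) in n0 *.
exists (2 * L ^+ 2 / A ^+ 3 + M / A ^+ 2).
  by rewrite addr_ge0// divr_ge0 ?mulr_ge0 ?exprn_ge0 ?nc_ge0.
move=> z'; rewrite !lt_min => /andP[/andP[/hf zd /lf zd1] ze].
set x := nc (z' - z) in zd zd1 ze *.
have x0 : 0 <= x by exact: nc_ge0.
have half : A / 2 <= nc (f z').
  have h1 : L * x <= A / 2.
    move: ze; rewrite /e ltr_pdivlMr ?mulr_gt0 ?ltr_wpDl// => ze.
    by have := mulr_ge0 L0 x0; lra.
  have := ncB (f z') (f z' - f z).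
  by rewrite opprB addrCA subrr addr0 -/A; lra.
have fz'0 : f z' != 0 by rewrite -nc_gt0; apply: lt_le_trans half; exact: divr_gt0.
have E (u v w : C) : u != 0 -> v != 0 ->
    u^-1 - v^-1 - - a / v ^+ 2 * w = (u - v) ^+ 2 / (u * v ^+ 2) -
      (u - v - a * w) / v ^+ 2.
  by move=> u0 v0; field; rewrite ?u0 ?v0.
rewrite E//; apply: le_trans (ncB _ _) _.
have -> : nc ((f z' - f z) ^+ 2 / (f z' * f z ^+ 2)) =
    nc (f z' - f z) ^+ 2 / (nc (f z') * A ^+ 2) by rewrite ncM ncX ncV ncM ncX.
have -> : nc ((f z' - f z - a * (z' - z)) / f z ^+ 2) =
    nc (f z' - f z - a * (z' - z)) / A ^+ 2 by rewrite ncM ncV ncX.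
rewrite [leRHS]mulrDl; apply: lerD; last first.
  by rewrite [leRHS]mulrAC ler_wpM2r// invr_ge0 exprn_ge0 ?nc_ge0.
have y0 : 0 < nc (f z') by rewrite nc_gt0.
rewrite ler_pdivrMr ?mulr_gt0 ?exprn_gt0//.
have E' (y B : R) : 0 < B -> 2 * L ^+ 2 / B ^+ 3 * x ^+ 2 * (y * B ^+ 2) =
    (L * x) ^+ 2 * (y / (B / 2)).
  by move=> B0; field; rewrite ?gt_eqF.
rewrite E'//; apply: (@le_trans _ _ ((L * x) ^+ 2)).
  by rewrite lerXn2r ?nnegrE ?nc_ge0 ?mulr_ge0.
rewrite ler_peMr ?exprn_ge0 ?mulr_ge0// ler_pdivlMr ?divr_gt0//.
by rewrite mul1r.
Qed.

Fixpoint smooth (n : nat) (U : set C) (f : C -> C) : Prop :=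
  if n is n'.+1 then
    exists2 f' : C -> C, (forall z, U z -> hder f z (f' z)) & smooth n' U f'
  else True.

Lemma smoothW n U f : smooth n.+1 U f -> smooth n U f.
Proof.
by elim: n f => [//|n IH] f /= [f' hf sf]; exists f' => //; exact: IH.
Qed.

Lemma smooth_cst n U c : smooth n U (fun=> c).
Proof.
elim: n c => [//|n IH] c /=; exists (fun=> 0) => // z _; exact: hder_cst.
Qed.

Lemma smooth_id n U : smooth n U id.
Proof.
case: n => [//|n] /=; exists (fun=> 1) => [z _|]; first exact: hder_id.
exact: smooth_cst.
Qed.

Lemma smoothD n U f g : smooth n U f -> smooth n U g ->
  smooth n U (fun z => f z + g z).
Proof.
elim: n f g => [//|n IH] f g /= [f' hf sf] [g' hg sg].
exists (fun z => f' z + g' z); last exact: IH.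
by move=> z Uz; apply: hderD; auto.
Qed.

Lemma smoothM n U f g : smooth n U f -> smooth n U g ->
  smooth n U (fun z => f z * g z).
Proof.
elim: n f g => [//|n IH] f g sf0 sg0.
have sf1 := smoothW sf0; have sg1 := smoothW sg0.
move: sf0 sg0 => /= [f' hf sf] [g' hg sg].
exists (fun z => f' z * g z + f z * g' z); last by apply: smoothD; exact: IH.
by move=> z Uz; apply: hderM; auto.
Qed.

Lemma smoothN n U f : smooth n U f -> smooth n U (fun z => - f z).
Proof.
move=> sf; have := smoothM (smooth_cst n U (-1)) sf.
by under eq_fun do rewrite mulN1r.
Qed.

Lemma smoothV n (U : set C) f : (forall z, U z -> f z != 0) -> smooth n U f ->
  smooth n U (fun z => (f z)^-1).
Proof.
move=> f0; elim: n => [//|n IH] sf; have sf1 := IH (smoothW sf).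
move: sf => /= [f' hf sf]; exists (fun z => - f' z / f z ^+ 2).
  by move=> z Uz; apply: hderV; auto.
apply: smoothM; first exact: smoothN.
have := smoothM sf1 sf1.
by under eq_fun do rewrite -invfM.
Qed.

End OneVariable.

Section TwoVariables.
Variable R : realType.
Local Notation C := (cplx R).
Implicit Types (f : C -> C -> C).

(** The bound is uniform in both points near [(z0, w0)], which is more than differentiability there:
    Newton's iteration compares arbitrary pairs of nearby points. *)
Definition qder f fz fw (z0 w0 : C) := exists2 d : R, 0 < d &
  exists2 M : R, 0 <= M & forall z w z' w',
    nc (z - z0) < d -> nc (w - w0) < d -> nc (z' - z0) < d -> nc (w' - w0) < d ->
    nc (f z' w' - f z w - fz z w * (z' - z) - fw z w * (w' - w))
      <= M * (nc (z' - z) + nc (w' - w)) ^+ 2.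

(* Such a [G] consists of smooth functions, which is what the implicit function
   theorem below needs in place of a theory of analytic functions. *)
Definition dclosed (Om : C -> C -> Prop) (G : set (C -> C -> C)) :=
  forall f, G f -> exists fz fw, [/\ G fz, G fw &
    forall z w, Om z w -> qder f fz fw z w].

(** Lets [curve_chart] solve for [z] where [Fw] vanishes. *)
Lemma dclosed_flip Om G : dclosed Om G ->
  dclosed (fun z w => Om w z) [set f | G (fun z w => f w z)].
Proof.
move=> h f /h[fz [fw [Gz Gw q]]].
exists (fun z w => fw w z), (fun z w => fz w z); split => // z w /q.
move=> [d d0 [M M0 hM]]; exists d => //; exists M => // x y x' y' hx hy hx' hy'.
have := hM _ _ _ _ hy hx hy' hx'; rewrite [in leRHS]addrC; apply: le_trans.
by rewrite -!addrA [- _ + - _]addrC.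
Qed.

Variables (Om : C -> C -> Prop) (G : set (C -> C -> C)).
Hypothesis GD : dclosed Om G.

Lemma qder_bounded f fz fw z0 w0 : qder f fz fw z0 w0 -> exists2 d : R, 0 < d &
  exists2 B : R, 0 <= B & forall z w, nc (z - z0) < d -> nc (w - w0) < d ->
    nc (f z w) <= B.
Proof.
move=> [d d0 [M M0 h]]; exists (Num.min d 1); first by rewrite lt_min d0/=.
exists (nc (f z0 w0) + nc (fz z0 w0) + nc (fw z0 w0) + M * 4).
  by rewrite !addr_ge0 ?mulr_ge0 ?nc_ge0.
move=> z w; rewrite !lt_min => /andP[zd z1] /andP[wd w1].
have z00 : nc (z0 - z0) < d by rewrite subrr nc0.
have w00 : nc (w0 - w0) < d by rewrite subrr nc0.
have := h _ _ _ _ z00 w00 zd wd.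
set E := f z w - _ - _ - _.
have -> : f z w = E + (f z0 w0 + fz z0 w0 * (z - z0) + fw z0 w0 * (w - w0)).
  by rewrite /E; ring.
move=> hE; apply: le_trans (ncD _ _) _.
have h1 := ncD (f z0 w0 + fz z0 w0 * (z - z0)) (fw z0 w0 * (w - w0)).
have h2 := ncD (f z0 w0) (fz z0 w0 * (z - z0)).
move: h1 h2; rewrite !ncM => h1 h2.
have a0 := nc_ge0 (z - z0); have b0 := nc_ge0 (w - w0).
have c0 := nc_ge0 (fz z0 w0); have e0 := nc_ge0 (fw z0 w0).
have h3 : nc (fz z0 w0) * nc (z - z0) <= nc (fz z0 w0) by apply: ler_piMr => //; exact: ltW.
have h4 : nc (fw z0 w0) * nc (w - w0) <= nc (fw z0 w0) by apply: ler_piMr => //; exact: ltW.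
have h5 : M * (nc (z - z0) + nc (w - w0)) ^+ 2 <= M * 4.
  by apply: ler_wpM2l => //; nra.
lra.
Qed.

Lemma qder_lip f z0 w0 : G f -> Om z0 w0 -> exists2 d : R, 0 < d &
  exists2 L : R, 0 <= L & forall z w z' w',
    nc (z - z0) < d -> nc (w - w0) < d -> nc (z' - z0) < d -> nc (w' - w0) < d ->
    nc (f z' w' - f z w) <= L * (nc (z' - z) + nc (w' - w)).
Proof.
move=> Gf Op; have [fz [fw [Gz Gw q]]] := GD Gf.
have [d d0 [M M0 h]] := q _ _ Op.
have [fzz [fzw [_ _ qz]]] := GD Gz; have [fwz [fww [_ _ qw]]] := GD Gw.
have [e e0 [A A0 hA]] := qder_bounded (qz _ _ Op).
have [e' e'0 [B B0 hB]] := qder_bounded (qw _ _ Op).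
exists (Num.min (Num.min d 1) (Num.min e e')); first by rewrite !lt_min d0 e0 e'0 ltr01.
exists (M * 4 + A + B); first by rewrite !addr_ge0 ?mulr_ge0.
move=> z w z' w'; rewrite !lt_min.
move=> /andP[/andP[zd z1] /andP[ze ze']] /andP[/andP[wd w1] /andP[we we']].
move=> /andP[/andP[z'd z'1] _] /andP[/andP[w'd w'1] _].
have := h _ _ _ _ zd wd z'd w'd.
set E := f z' w' - _ - _ - _.
have -> : f z' w' - f z w = E + (fz z w * (z' - z) + fw z w * (w' - w)).
  by rewrite /E; ring.
move=> hE; apply: le_trans (ncD _ _) _.
have := ncD (fz z w * (z' - z)) (fw z w * (w' - w)); rewrite !ncM => h1.
have Az := hA _ _ ze we; have Bz := hB _ _ ze' we'.
have a0 := nc_ge0 (z' - z); have b0 := nc_ge0 (w' - w).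
have h2 := ler_wpM2r a0 Az; have h3 := ler_wpM2r b0 Bz.
have x2 : nc (z' - z) <= 2.
  rewrite (_ : z' - z = (z' - z0) - (z - z0)); last by ring.
  by apply: le_trans (ncB _ _) _; lra.
have y2 : nc (w' - w) <= 2.
  rewrite (_ : w' - w = (w' - w0) - (w - w0)); last by ring.
  by apply: le_trans (ncB _ _) _; lra.
have h5 : M * (nc (z' - z) + nc (w' - w)) ^+ 2 <= M * (4 * (nc (z' - z) + nc (w' - w))).
  by apply: ler_wpM2l => //; nra.
have := mulr_ge0 A0 b0; have := mulr_ge0 B0 a0.
lra.
Qed.

Lemma hder_comp2 f fz fw (g : C -> C) z a :
  qder f fz fw z (g z) -> hder g z a ->
  hder (fun z => f z (g z)) z (fz z (g z) + fw z (g z) * a).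
Proof.
move=> [d d0 [M M0 h]] hg0; have [e e0 [N N0 hg]] := hg0.
have [d1 d10 [L L0 lg]] := hder_lip hg0.
exists (Num.min (Num.min d e) (Num.min d1 (d / (L + 1)))).
  by rewrite !lt_min d0 e0 d10 divr_gt0// ltr_wpDl.
exists (M * (1 + L) ^+ 2 + nc (fw z (g z)) * N).
  by rewrite addr_ge0 // mulr_ge0 ?sqr_ge0 ?nc_ge0.
move=> z'; rewrite !lt_min => /andP[/andP[zd ze] /andP[zd1 zd2]].
have hgz := hg _ ze; have lgz := lg _ zd1.
have z00 : nc (z - z) < d by rewrite subrr nc0.
have w00 : nc (g z - g z) < d by rewrite subrr nc0.
have x0 := nc_ge0 (z' - z).
have gd : nc (g z' - g z) < d.
  apply: le_lt_trans lgz _.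
  by move: zd2; rewrite ltr_pdivlMr ?ltr_wpDl//; lra.
have := h _ _ _ _ z00 w00 zd gd.
set E := _ - _ - _ - _ => hE.
rewrite (_ : _ - _ - _ = E + fw z (g z) * (g z' - g z - a * (z' - z))); last first.
  by rewrite /E; ring.
apply: le_trans (ncD _ _) _; rewrite ncM [leRHS]mulrDl; apply: lerD.
  apply: le_trans hE _; rewrite -mulrA; apply: ler_wpM2l => //.
  rewrite -exprMn lerXn2r ?nnegrE ?addr_ge0 ?mulr_ge0 ?nc_ge0//.
    by rewrite addr_ge0.
  by rewrite mulrDl mul1r lerD2l.
by rewrite -mulrA; apply: ler_wpM2l => //; exact: nc_ge0.
Qed.

Hypothesis OmO : forall z0 w0, Om z0 w0 -> exists2 d : R, 0 < d &
  forall z w, nc (z - z0) < d -> nc (w - w0) < d -> Om z w.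

(* The quadratic remainder in both variables makes the solution [g]
   differentiable, with derivative [- Fz / Fw]. *)
Lemma implicit F Fz Fw z0 w0 : G F -> G Fz -> G Fw ->
  (forall z w, Om z w -> qder F Fz Fw z w) ->
  Om z0 w0 -> F z0 w0 = 0 -> Fw z0 w0 != 0 ->
  exists (r rho : R) (g : C -> C), [/\ 0 < r, r <= rho,
    forall n, smooth n [set z | nc (z - z0) < r] g,
    forall z, nc (z - z0) < r ->
      [/\ nc (g z - w0) < rho, Om z (g z) & F z (g z) = 0] &
    forall z w, nc (z - z0) < r -> nc (w - w0) < rho -> F z w = 0 -> w = g z].
Proof.
move=> GF GFz GFw hF Op Fp b0; set b := Fw z0 w0 in b0.
have [d d0 [M M0 q]] := hF _ _ Op.
have [d1 d10 [L1 L10 l1]] := qder_lip GFw Op.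
have [d2 d20 [L2 L20 l2]] := qder_lip GF Op.
have [d3 d30 o3] := OmO Op.
have nb0 : 0 < nc b by rewrite nc_gt0.
(* The second bound makes [w |-> F z w - b w] Lipschitz with constant [|b| / 2], as [solve_near]
   requires. *)
pose rho := Num.min (Num.min (Num.min d d1) (Num.min d2 d3) / 2)
  (nc b / (4 * (M + L1 + 1))).
have ML : 0 < M + L1 + 1 by rewrite ltr_wpDl// addr_ge0.
have rho0 : 0 < rho.
  by rewrite /rho lt_min !divr_gt0// ?mulr_gt0// !lt_min d0 d10 d20.
have rhod : rho < Num.min (Num.min d d1) (Num.min d2 d3).
  have : rho <= Num.min (Num.min d d1) (Num.min d2 d3) / 2 by rewrite /rho ge_min lexx.
  by lra.
have rhob : 4 * rho * (M + L1 + 1) <= nc b.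
  have : rho <= nc b / (4 * (M + L1 + 1)) by rewrite /rho ge_min lexx orbT.
  by rewrite ler_pdivlMr ?mulr_gt0//; lra.
move: rhod; rewrite !lt_min => /andP[/andP[rd rd1] /andP[rd2 rd3]].
clearbody rho.
(* The second bound gives [|F z w0| <= |b| rho / 4], the starting condition of [solve_near] on the
   disc of radius [rho / 2]. Solutions found there lie strictly within [rho]. *)
pose r := Num.min rho (nc b * rho / (4 * (L2 + 1))).
have L21 : 0 < L2 + 1 by rewrite ltr_wpDl.
have r0 : 0 < r by rewrite /r lt_min rho0 divr_gt0 ?mulr_gt0.
have rr : r <= rho by rewrite /r ge_min lexx.
have rb : 4 * r * (L2 + 1) <= nc b * rho.
  have : r <= nc b * rho / (4 * (L2 + 1)) by rewrite /r ge_min lexx orbT.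
  by rewrite ler_pdivlMr ?mulr_gt0//; lra.
clearbody r.
have tri (x y c : C) (s : R) : nc (x - c) <= s -> nc (y - c) <= s ->
    nc (x - y) <= 2 * s.
  move=> hx hy; rewrite (_ : x - y = (x - c) - (y - c)); last by ring.
  by apply: le_trans (ncB _ _) _; lra.
have lin z w w' : nc (z - z0) < r -> nc (w - w0) <= rho -> nc (w' - w0) <= rho ->
    nc (F z w - F z w' - b * (w - w')) <= nc b / 2 * nc (w - w').
  move=> hz hw hw'.
  have zz : nc (z - z0) < rho by apply: lt_le_trans rr.
  have := q z w' z w (lt_trans zz rd) (le_lt_trans hw' rd) (lt_trans zz rd)
     (le_lt_trans hw rd).
  have := l1 z0 w0 z w'.
  rewrite !subrr !nc0 mulr0 subr0 add0r -/b => /(_ d10 d10 (lt_trans zz rd1)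
     (le_lt_trans hw' rd1)) hb hq.
  rewrite (_ : _ - _ - _ = (F z w - F z w' - Fw z w' * (w - w')) +
     (Fw z w' - b) * (w - w')); last by ring.
  apply: le_trans (ncD _ _) _; rewrite ncM.
  have ww := tri _ _ _ _ hw hw'.
  have x0 := nc_ge0 (w - w').
  have h1 : nc (Fw z w' - b) <= L1 * (2 * rho).
    by apply: le_trans hb _; apply: ler_wpM2l => //; lra.
  have h2 := ler_wpM2r x0 h1.
  have h3 : M * nc (w - w') ^+ 2 <= M * (2 * rho) * nc (w - w').
    by rewrite -mulrA; apply: ler_wpM2l => //; rewrite expr2; apply: ler_wpM2r.
  have h4 := ler_wpM2r x0 rhob.
  have h5 := mulr_ge0 (ltW rho0) x0.
  lra.
(* This lower bound yields the uniqueness of the solution and the Lipschitz constant [Lam] of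
   [g]. *)
have inj z w w' : nc (z - z0) < r -> nc (w - w0) <= rho -> nc (w' - w0) <= rho ->
    nc b / 2 * nc (w - w') <= nc (F z w - F z w').
  move=> hz hw hw'; have h := lin _ _ _ hz hw hw'.
  have := ncB (F z w - F z w') (F z w - F z w' - b * (w - w')).
  rewrite (_ : _ - (_ - _ - _) = b * (w - w')); last by ring.
  by rewrite ncM; lra.
have ex z : nc (z - z0) < r -> exists w, nc (w - w0) <= rho / 2 /\ F z w = 0.
  move=> hz; have zz : nc (z - z0) < rho by apply: lt_le_trans rr.
  have [||w hw Fw0] := @solve_near R (F z) w0 b (rho / 2) b0; last by exists w.
    by move=> w w' hw hw'; apply: lin => //; lra.
  have := l2 z0 w0 z w0; rewrite !subrr !nc0 addr0 Fp subr0.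
  move=> /(_ d20 d20 (lt_trans zz rd2) d20) h; apply: le_trans h _.
  have := ler_wpM2l L20 (ltW hz).
  lra.
pose g (z : C) : C := xget 0 [set w | nc (w - w0) <= rho / 2 /\ F z w = 0].
have gP z : nc (z - z0) < r -> nc (g z - w0) <= rho / 2 /\ F z (g z) = 0.
  by move=> hz; have /(xgetPex 0) := ex z hz.
have gP2 z : nc (z - z0) < r -> nc (g z - w0) <= rho.
  by move=> /gP[h _]; lra.
clearbody g.
have Omg z : nc (z - z0) < r -> Om z (g z).
  move=> hz; apply: o3; first by lra.
  by have := gP2 z hz; lra.
have Fwb z : nc (z - z0) < r -> nc b / 2 <= nc (Fw z (g z)).
  move=> hz; have hw := gP2 z hz.
  have := l1 z0 w0 z (g z); rewrite !subrr !nc0 -/b => /(_ d10 d10) h.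
  have {}h := h ltac:(lra) ltac:(lra).
  have := ncB (Fw z (g z)) (Fw z (g z) - b).
  rewrite opprB addrCA subrr addr0 => h'.
  have h2 : L1 * (nc (z - z0) + nc (g z - w0)) <= L1 * (2 * rho).
    by apply: ler_wpM2l => //; lra.
  have := mulr_ge0 M0 (ltW rho0).
  lra.
have Fw0 z : nc (z - z0) < r -> Fw z (g z) != 0.
  by move=> hz; rewrite -nc_gt0; have := Fwb _ hz; lra.
pose g' (z : C) : C := - (Fz z (g z) * (Fw z (g z))^-1).
pose Lam := 2 * L2 / nc b.
have Lam0 : 0 <= Lam by rewrite /Lam divr_ge0 ?(ltW nb0)// mulr_ge0.
have lipg z z' : nc (z - z0) < r -> nc (z' - z0) < r ->
    nc (g z' - g z) <= Lam * nc (z' - z).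
  move=> hz hz'; have hw := gP2 _ hz; have hw' := gP2 _ hz'.
  have i1 := inj _ _ _ hz' hw' hw.
  have := l2 z (g z) z' (g z) ltac:(lra) ltac:(lra) ltac:(lra) ltac:(lra).
  rewrite subrr nc0 addr0 (gP z hz).2 subr0 => h.
  move: i1; rewrite (gP z' hz').2 sub0r ncN => i1.
  rewrite /Lam mulrAC ler_pdivlMr//; lra.
have derg z : nc (z - z0) < r -> hder g z (g' z).
  move=> hz; have hw := gP2 _ hz.
  exists (r - nc (z - z0)); first by rewrite subr_gt0.
  exists (2 * M * (1 + Lam) ^+ 2 / nc b).
    by rewrite divr_ge0 ?(ltW nb0)// mulr_ge0 ?sqr_ge0// mulr_ge0.
  move=> z' zz'.
  have hz' : nc (z' - z0) < r.
    rewrite (_ : z' - z0 = (z' - z) + (z - z0)); last by ring.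
    by apply: le_lt_trans (ncD _ _) _; lra.
  have hw' := gP2 _ hz'.
  have := q z (g z) z' (g z') ltac:(lra) ltac:(lra) ltac:(lra) ltac:(lra).
  rewrite (gP z hz).2 (gP z' hz').2 subr0 sub0r.
  have -> : - (Fz z (g z) * (z' - z)) - Fw z (g z) * (g z' - g z) =
      - (Fw z (g z) * (g z' - g z - g' z * (z' - z))).
    by rewrite /g'; field; exact: Fw0.
  rewrite ncN ncM => hq; have lg := lipg _ _ hz hz'.
  have hf := Fwb _ hz.
  set X := nc (g z' - g z - g' z * (z' - z)) in hq *.
  have X0 : 0 <= X by exact: nc_ge0.
  have x0 := nc_ge0 (z' - z); have y0 := nc_ge0 (g z' - g z).
  have h1 : M * (nc (z' - z) + nc (g z' - g z)) ^+ 2 <=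
      M * ((1 + Lam) * nc (z' - z)) ^+ 2.
    apply: ler_wpM2l => //.
    rewrite lerXn2r ?nnegrE ?addr_ge0 ?mulr_ge0 ?addr_ge0//.
    by rewrite mulrDl mul1r lerD2l.
  rewrite exprMn in h1.
  have h2 := ler_wpM2r X0 hf.
  rewrite mulrAC ler_pdivlMr//; lra.
(* [g] and all functions [f z (g z)] with [f] in [G] gain derivatives together: [g'] is built from
   [Fz] and [Fw] along the graph, and these are such functions. *)
have sg n : smooth n [set z | nc (z - z0) < r] g /\
    forall f, G f -> smooth n [set z | nc (z - z0) < r] (fun z => f z (g z)).
  elim: n => [//|n [IHg IHf]].
  have sg' : smooth n [set z | nc (z - z0) < r] g'.
    apply: smoothN; apply: smoothM; first exact: IHf.
    by apply: smoothV; [exact: Fw0|exact: IHf].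
  split; first by exists g'.
  move=> f Gf; have [fz [fw [Gfz Gfw qf]]] := GD Gf.
  exists (fun z => fz z (g z) + fw z (g z) * g' z).
    move=> z hz; apply: hder_comp2; last exact: derg.
    by apply: qf; exact: Omg.
  by apply: smoothD; [exact: IHf|apply: smoothM => //; exact: IHf].
exists r, rho, g; split => //.
- by move=> n; have [] := sg n.
- move=> z hz; split; [|exact: Omg|exact: (gP z hz).2].
  by have [h _] := gP z hz; lra.
- move=> z w hz hw Fzw; have := inj z w (g z) hz (ltW hw) (gP2 _ hz).
  rewrite Fzw (gP z hz).2 subrr nc0 pmulr_rle0 ?divr_gt0// => h.
  by apply/eqP; rewrite -subr_eq0 -nc_eq0 eq_le h nc_ge0.
Qed.

End TwoVariables.

Section CurveChart.
Variable R : realType.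
Local Notation C := (cplx R).

(* Points of C^2 are indexed by [bool]; [e] is the coordinate that serves as
   local parameter. *)
Lemma curve_chart (Om : C -> C -> Prop) (G : set (C -> C -> C)) F Fz Fw
    (q : bool -> C) : dclosed Om G ->
  (forall z0 w0, Om z0 w0 -> exists2 d : R, 0 < d &
    forall z w, nc (z - z0) < d -> nc (w - w0) < d -> Om z w) ->
  G F -> G Fz -> G Fw -> (forall z w, Om z w -> qder F Fz Fw z w) ->
  Om (q false) (q true) -> F (q false) (q true) = 0 ->
  ~ (Fz (q false) (q true) = 0 /\ Fw (q false) (q true) = 0) ->
  exists (e : bool) (phi : bool -> C -> C) (r rho : R),
  [/\ 0 < r <= rho, forall v, phi e v = v,
      forall n b, smooth n [set v | nc (v - q e) < r] (phi b),
      forall v, nc (v - q e) < r ->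
        [/\ Om (phi false v) (phi true v), F (phi false v) (phi true v) = 0 &
           forall b, nc (phi b v - q b) < rho] &
      forall q' : bool -> C, F (q' false) (q' true) = 0 -> nc (q' e - q e) < r ->
        (forall b, nc (q' b - q b) < rho) -> forall b, q' b = phi b (q' e)].
Proof.
move=> GD OmO GF GFz GFw hF Op Fp sing.
have [Fw0|Fw0] := eqVneq (Fw (q false) (q true)) 0; last first.
  have [r [rho [g [r0 rr sg gP gU]]]] := implicit GD OmO GF GFz GFw hF Op Fp Fw0.
  exists false, (fun b v => if b then g v else v), r, rho; split => //.
  - by rewrite r0.
  - by move=> n [|] //; exact: smooth_id.
  - move=> v hv; have [h1 h2 h3] := gP v hv; split => //.
    by case=> //; exact: lt_le_trans rr.
  - move=> q' Fq' h1 h2 [|] //; apply: gU => //; exact: h2 true.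
have Fz0 : Fz (q false) (q true) != 0 by apply/eqP => h; apply: sing.
have OmO' z0 w0 : Om w0 z0 -> exists2 d : R, 0 < d &
    forall z w, nc (z - z0) < d -> nc (w - w0) < d -> Om w z.
  by move=> /OmO[d d0 h]; exists d => // z w hz hw; exact: h.
have hF' z w : Om w z ->
    qder (fun z w => F w z) (fun z w => Fw w z) (fun z w => Fz w z) z w.
  move=> /hF[d d0 [M M0 hM]]; exists d => //; exists M => // x y x' y' hx hy hx' hy'.
  have := hM _ _ _ _ hy hx hy' hx'; rewrite [in leRHS]addrC; apply: le_trans.
  by rewrite -!addrA [- _ + - _]addrC.
have [r [rho [g [r0 rr sg gP gU]]]] := @implicit R _ _ (dclosed_flip GD) OmO'
  (fun z w => F w z) (fun z w => Fw w z) (fun z w => Fz w z) (q true) (q false)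
  GF GFw GFz hF' Op Fp Fz0.
exists true, (fun b v => if b then v else g v), r, rho; split => //.
- by rewrite r0.
- by move=> n [|] //; exact: smooth_id.
- move=> v hv; have [h1 h2 h3] := gP v hv; split => //.
  by case=> //; exact: lt_le_trans rr.
- move=> q' Fq' h1 h2 [|] //; apply: gU => //; exact: h2 false.
Qed.

End CurveChart.

(** * The labyrinth *)

Section Scales.

(** The logarithm keeps [edges n] comparable with [n + 1]; the parity term makes consecutive stages
    differ, on which [gates_apart] relies. *)
Definition lev (n : nat) : nat := trunc_log 2 n.+1 + odd n.
Definition edges (n : nat) : nat := 2 ^ lev n.

Lemma edges_gt0 n : (0 < edges n)%N. Proof. by rewrite expn_gt0. Qed.

Lemma edges_le n : (edges n <= 2 * n.+1)%N.
Proof.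
rewrite /edges /lev expnD mulnC leq_mul//; first by case: (odd n).
exact: trunc_logP.
Qed.

Lemma edges_ge n : (n.+1 <= 2 * edges n)%N.
Proof.
have := trunc_log_ltn n.+1 (isT : (1 < 2)%N); rewrite expnS => /ltnW/leq_trans; apply.
by rewrite leq_mul// /edges /lev leq_exp2l// leq_addr.
Qed.

Lemma lev_neq n : lev n != lev n.+1.
Proof.
rewrite /lev /=.
have h1 : (trunc_log 2 n.+1 <= trunc_log 2 n.+2)%N by exact: leq_trunc_log.
have := trunc_log_ltn n.+1 (isT : (1 < 2)%N); set l := trunc_log 2 n.+1 => h2.
have := trunc_logP (isT : (1 < 2)%N) (isT : (0 < n.+2)%N).
move: h1; rewrite -/l; set l' := trunc_log 2 n.+2 => h1 h3.
have [e|ne] := eqVneq l l'; first by rewrite -e; case: (odd n); lia.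
have ll : (l < l')%N by rewrite ltn_neqAle ne.
(* Where the logarithm jumps, [n.+2] is a power of 2, so [n] is even and both summands of [lev]
   grow. *)
have h4 : n.+2 = (2 ^ l.+1)%N.
  by apply/eqP; rewrite eqn_leq h2/=; apply: leq_trans h3; rewrite leq_exp2l.
have : ~~ odd n.+2 by rewrite h4 oddX.
by rewrite /= negbK => /negbTE ->; lia.
Qed.

Variable R : realType.

(** The fall [eps n - eps n.+1] is at least [2 / (n + 1)^2]: one half covers the interpolation error
    [1 / (4 m^2)] with [m = edges n], the other is the margin in [KK_step]. *)
Definition eps (n : nat) : R := 4 / n.+1%:R.
(** Below [1 / edges n], so that near-maxima occur only at neighbouring indices, and a quarter of
    the separation [1 / (4 (n + 2))] in [gates_apart]. *)
Definition kap (n : nat) : R := (16 * n.+2%:R)^-1.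

Lemma kap_gt0 n : 0 < kap n.
Proof. by rewrite invr_gt0 mulr_gt0. Qed.

Lemma kap_edges n : kap n * (edges n)%:R < 1.
Proof.
rewrite mulrC ltr_pdivrMr ?mulr_gt0// mul1r -natrM ltr_nat.
by have := edges_le n; lia.
Qed.

(* [lgg n i] is, up to the factor [edges n], the affine function
   (1 - th) x + th y + th (1 - th) + eps n of x = ln |z|, y = ln |w|, with
   th = i / edges n. *)
Definition lgg n i (x y : R) : R :=
  (edges n)%:R * x + i%:R * (y - x)
  + i%:R * ((edges n)%:R - i%:R) / (edges n)%:R + (edges n)%:R * eps n.

(** This is [1 / tau_(n, i)]. The monomial form [gg] of the exponential of [lgg] stays meaningful
    and continuous where [r] or [t] vanishes. *)
Definition cgg n i : R :=
  expR (i%:R * ((edges n)%:R - i%:R) / (edges n)%:R + (edges n)%:R * eps n).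

Definition gg n i (r t : R) : R := cgg n i * r ^+ (edges n - i) * t ^+ i.

Lemma cgg_gt0 n i : 0 < cgg n i. Proof. exact: expR_gt0. Qed.

Lemma gg_ge0 n i r t : 0 <= r -> 0 <= t -> 0 <= gg n i r t.
Proof. by move=> r0 t0; rewrite !mulr_ge0 ?exprn_ge0 ?(ltW (cgg_gt0 n i)). Qed.

Lemma gg_le n i r t r' t' : 0 <= r <= r' -> 0 <= t <= t' ->
  gg n i r t <= gg n i r' t'.
Proof.
move=> /andP[r0 rr] /andP[t0 tt].
have r'0 := le_trans r0 rr; have t'0 := le_trans t0 tt.
have c0 := ltW (cgg_gt0 n i).
by rewrite !ler_pM ?mulr_ge0 ?exprn_ge0 ?lerXn2r.
Qed.

Lemma gg_exp n i r t : 0 < r -> 0 < t -> (i <= edges n)%N ->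
  gg n i r t = expR (lgg n i (ln r) (ln t)).
Proof.
move=> r0 t0 ie; rewrite /gg /lgg /cgg.
have -> : r ^+ (edges n - i) = expR ((edges n)%:R * ln r - i%:R * ln r).
  by rewrite -mulrBl -natrB// expRM_natl lnK ?posrE.
have -> : t ^+ i = expR (i%:R * ln t) by rewrite expRM_natl lnK ?posrE.
by rewrite -!expRD; congr expR; ring.
Qed.

Definition KK n r t := forall i, (i <= edges n)%N -> gg n i r t <= 1.

(** The last term, the excess over affine interpolation in the index, comes from the strictly
    concave summand [i (m - i) / m] with [m = edges n]. *)
Lemma lgg_interp n i j k x y : (i <= k <= j)%N ->
  (j - i)%:R * lgg n k x y = (j - k)%:R * lgg n i x y + (k - i)%:R * lgg n j x y
    + (k - i)%:R * (j - k)%:R * (j - i)%:R / (edges n)%:R.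
Proof.
move=> /andP[ik kj]; rewrite !natrB// ?(leq_trans ik)// /lgg.
have e0 : (edges n)%:R != 0 :> R by rewrite pnatr_eq0 -lt0n edges_gt0.
by move: (edges n)%:R e0 (eps n) => m m0 ep; field.
Qed.

Lemma edges_natr0 n : (0 : R) < (edges n)%:R.
Proof. by rewrite ltr0n edges_gt0. Qed.

Lemma eps_step n : eps n - eps n.+1 - (4 * (edges n)%:R ^+ 2)^-1 >= (n.+1%:R ^+ 2)^-1.
Proof.
have h : (n.+1%:R : R) <= 2 * (edges n)%:R by rewrite -natrM ler_nat edges_ge.
have e0 := edges_natr0 n.
have n0 : (0 : R) < n.+1%:R by [].
have h1 : (4 * (edges n)%:R ^+ 2)^-1 <= (n.+1%:R ^+ 2 : R)^-1.
  rewrite lef_pV2 ?posrE ?mulr_gt0 ?exprn_gt0//.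
  rewrite (_ : 4 * _ = (2 * (edges n)%:R) ^+ 2); last by ring.
  by rewrite lerXn2r ?nnegrE ?mulr_ge0.
suff : 2 * (n.+1%:R ^+ 2 : R)^-1 <= eps n - eps n.+1.
  move: h1 (eps n) (eps n.+1); move: (4 * _)^-1 (n.+1%:R ^+ 2)^-1 => p q.
  by move=> h1 e1 e2; lra.
rewrite /eps -[n.+2%:R]natr1; have : (1 : R) <= n.+1%:R by rewrite ler1n.
move: (n.+1%:R) n0 => m m0 m1 {h h1}.
have m2 : 0 < m + 1 by lra.
rewrite -subr_ge0.
rewrite (_ : _ - _ = 2 * (m - 1) / (m ^+ 2 * (m + 1))); last first.
  by field; rewrite !gt_eqF.
by rewrite divr_ge0// mulr_ge0 ?subr_ge0 ?sqr_ge0 ?(ltW m2).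
Qed.

(** The slope [i / edges n.+1] lies between two neighbouring slopes of stage [n]. Interpolating
    there costs at most [1 / (4 m^2)], which the fall of [eps] outweighs. *)
Lemma lgg_step n x y i : (forall j, (j <= edges n)%N -> lgg n j x y <= 0) ->
  (0 < i < edges n.+1)%N -> lgg n.+1 i x y <= - (n.+1%:R ^+ 2)^-1.
Proof.
move=> h /andP[i0 im'].
set m := edges n; set m' := edges n.+1 in im' *.
have m0 : (0 : R) < m%:R by exact: edges_natr0.
have m'0 : (0 : R) < m'%:R by exact: edges_natr0.
pose j := (i * m %/ m')%N.
have dE := divn_eq (i * m) m'; rewrite -/j in dE.
have dl : (i * m %% m' < m')%N by rewrite ltn_mod edges_gt0.
set a := (i * m %% m')%N in dE dl.
have jm : (j < m)%N by rewrite /j ltn_divLR ?edges_gt0// mulnC ltn_pmul2l// edges_gt0.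
have h1 := h j (ltnW jm); have h2 := h j.+1 jm.
(* [th = i / m'] lies between [j / m] and [j.+1 / m], at relative position
   [a / m']. *)
pose lam : R := a%:R / m'%:R.
have lam0 : 0 <= lam by rewrite divr_ge0.
have lam1 : lam <= 1 by rewrite ler_pdivrMr// mul1r ler_nat ltnW.
have iE : i%:R = (j%:R + lam) * m'%:R / m%:R :> R.
  have E (J N b M : R) : N != 0 -> (J * N + b) / M = (J + b / N) * N / M.
    by move=> N0; rewrite [(J + b / N) * N]mulrDl divfK.
  by rewrite /lam -E ?gt_eqF// -natrM -natrD -dE natrM mulfK ?gt_eqF.
have key : lgg n.+1 i x y = m'%:R / m%:R * ((1 - lam) * lgg n j x y + lam * lgg n j.+1 x y)
   + m'%:R * (lam * (1 - lam) / m%:R ^+ 2 - eps n + eps n.+1).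
  rewrite /lgg -/m -/m' iE -[j.+1%:R]natr1.
  have E (l M M' J e e' : R) : M != 0 -> M' != 0 ->
      M' * x + (J + l) * M' / M * (y - x) + (J + l) * M' / M * (M' - (J + l) * M' / M) / M'
        + M' * e' =
      M' / M * ((1 - l) * (M * x + J * (y - x) + J * (M - J) / M + M * e) +
      l * (M * x + (J + 1) * (y - x) + (J + 1) * (M - (J + 1)) / M + M * e)) +
      M' * (l * (1 - l) / M ^+ 2 - e + e').
    by move=> M0 M'0; field; rewrite ?M0 ?M'0.
  by apply: E; rewrite gt_eqF.
rewrite key.
have c1 : m'%:R / m%:R * ((1 - lam) * lgg n j x y + lam * lgg n j.+1 x y) <= 0.
  rewrite pmulr_rle0 ?divr_gt0//.
  have := mulr_ge0_le0 lam0 h2; have l1 : 0 <= 1 - lam by rewrite subr_ge0.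
  by have := mulr_ge0_le0 l1 h1; lra.
have c2 : lam * (1 - lam) / m%:R ^+ 2 <= (4 * m%:R ^+ 2)^-1.
  rewrite [leRHS]invfM; apply: ler_wpM2r; first by rewrite invr_ge0 exprn_ge0.
  by have := sqr_ge0 (lam - 2^-1); rewrite sqrrB; lra.
have := eps_step n; rewrite -/m.
set q := (n.+1%:R ^+ 2)^-1 => hq.
have q0 : 0 <= q by rewrite invr_ge0 exprn_ge0.
have m'1 : (1 : R) <= m'%:R by rewrite ler1n edges_gt0.
set X := lam * _ / _ in c2 *; set Y := (4 * _)^-1 in c2 hq *.
have h3 : X - eps n + eps n.+1 <= - q by lra.
have := ler_wpM2l (ltW m'0) h3; have := ler_wpM2r q0 m'1.
lra.
Qed.

Lemma KK_t n r t : 0 <= t -> KK n r t -> t <= expR (- eps n).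
Proof.
move=> t0 /(_ _ (leqnn _)); rewrite /gg /cgg subnn expr0 mulr1 subrr mulr0 mul0r add0r.
rewrite expRM_natl -exprMn => h.
rewrite expRN -[leRHS]mul1r ler_pdivlMr ?expR_gt0// mulrC.
rewrite leNgt; apply/negP => lt; move: h; rewrite leNgt => /negP; apply.
by rewrite exprn_egt1// -lt0n edges_gt0.
Qed.

Lemma KK_r n r t : 0 <= r -> KK n r t -> r <= expR (- eps n).
Proof.
move=> r0 /(_ 0%N (leq0n _)); rewrite /gg /cgg subn0 expr0 mulr1 !mul0r add0r.
rewrite expRM_natl -exprMn => h.
rewrite expRN -[leRHS]mul1r ler_pdivlMr ?expR_gt0// mulrC.
rewrite leNgt; apply/negP => lt; move: h; rewrite leNgt => /negP; apply.
by rewrite exprn_egt1// -lt0n edges_gt0.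
Qed.

(** More than the inclusion of [K_n] in [K_(n+1)]: a high power turns this gap into a summable bound
    of the whole stage [n.+1] on [K_n]. *)
Lemma KK_step n r t i : 0 <= r -> 0 <= t -> KK n r t -> (i <= edges n.+1)%N ->
  gg n.+1 i r t <= expR (- (n.+1%:R ^+ 2)^-1).
Proof.
move=> r0 t0 K ie.
(* The extreme monomials are pure powers of one variable, controlled by [KK_r] and [KK_t]. *)
have edge (x : R) : 0 <= x -> x <= expR (- eps n) ->
    expR ((edges n.+1)%:R * eps n.+1) * x ^+ edges n.+1 <= expR (- (n.+1%:R ^+ 2)^-1).
  move=> x0 xe; rewrite expRM_natl -exprMn.
  have h1 : expR (eps n.+1) * x <= expR (- (n.+1%:R ^+ 2)^-1).
    apply: (@le_trans _ _ (expR (eps n.+1) * expR (- eps n))).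
      by rewrite ler_pM2l ?expR_gt0.
    rewrite -expRD ler_expR; have := eps_step n.
    have : 0 <= (4 * (edges n)%:R ^+ 2 : R)^-1 by rewrite invr_ge0 mulr_ge0 ?exprn_ge0.
    move: (4 * _)^-1 (n.+1%:R ^+ 2)^-1 (eps n) (eps n.+1) => p q e1 e2.
    by lra.
  have y0 : 0 <= expR (eps n.+1) * x by rewrite mulr_ge0 ?expR_ge0.
  have y1 : expR (eps n.+1) * x <= 1.
    by apply: le_trans h1 _; rewrite expR_le1 oppr_le0 invr_ge0 exprn_ge0.
  apply: le_trans h1; rewrite -[leRHS]expr1; apply: ler_wiXn2l => //.
  exact: edges_gt0.
have [->|i0] := posnP i.
  rewrite /gg /cgg subn0 expr0 mulr1 !mul0r add0r; apply: edge => //; exact: KK_r K.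
move: ie; rewrite leq_eqVlt => /predU1P[->|im].
  rewrite /gg /cgg subnn expr0 mulr1 subrr mulr0 mul0r add0r.
  apply: edge => //; exact: KK_t K.
have [r00|rn] := eqVneq r 0.
  by rewrite /gg r00 expr0n subn_eq0 leqNgt im /= mulr0 mul0r expR_ge0.
have [t00|tn] := eqVneq t 0.
  by rewrite /gg t00 expr0n (gtn_eqF i0) /= mulr0 expR_ge0.
have rp : 0 < r by rewrite lt_neqAle eq_sym rn.
have tp : 0 < t by rewrite lt_neqAle eq_sym tn.
rewrite gg_exp//; last exact: ltnW.
rewrite ler_expR; apply: lgg_step; last by rewrite i0.
move=> j je; have := K j je; rewrite gg_exp// -expR0 ler_expR//.
Qed.

Lemma KK_lt n r t i : 0 <= r -> 0 <= t -> KK n r t -> (i <= edges n.+1)%N ->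
  gg n.+1 i r t < 1.
Proof.
move=> r0 t0 K ie; apply: le_lt_trans (KK_step r0 t0 K ie) _.
by rewrite expR_lt1 oppr_lt0 invr_gt0 exprn_gt0.
Qed.

Lemma KK_S n r t : 0 <= r -> 0 <= t -> KK n r t -> KK n.+1 r t.
Proof. by move=> r0 t0 K i ie; apply: ltW; exact: KK_lt. Qed.

Lemma KK_le n n' r t : 0 <= r -> 0 <= t -> (n <= n')%N -> KK n r t -> KK n' r t.
Proof.
move=> r0 t0 /subnKC <-; elim: (n' - n)%N => [|k IH]; first by rewrite addn0.
by move=> K; rewrite addnS; apply: KK_S => //; exact: IH.
Qed.

Lemma KK_le1 n r t : 0 <= r -> 0 <= t -> KK n r t -> r <= 1 /\ t <= 1.
Proof.
move=> r0 t0 K.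
have e0 : expR (- eps n) <= 1 by rewrite expR_le1 oppr_le0 divr_ge0.
by split; [apply: le_trans (KK_r r0 K) e0|apply: le_trans (KK_t t0 K) e0].
Qed.

Definition gate n r t := exists i j, [/\ (i <= edges n)%N, (j <= edges n)%N, i != j,
  gg n i r t = 1 & expR (- kap n) < gg n j r t].

(** Otherwise [lgg_interp], at the intermediate index next to the one where [lgg] vanishes, would
    give a positive value: its excess is at least [1 / edges n], which is larger than [kap n]. *)
Lemma gate_adjacent n i j x y : (i < j <= edges n)%N ->
  (forall k, (k <= edges n)%N -> lgg n k x y <= 0) ->
  - kap n < lgg n i x y -> - kap n < lgg n j x y ->
  (lgg n i x y = 0 \/ lgg n j x y = 0) -> j = i.+1.
Proof.
move=> /andP[ij je] K hi hj ij0.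
apply/eqP; rewrite eqn_leq ij andbT leqNgt; apply/negP => ij2.
have m0 := edges_natr0 n; have k0 := kap_gt0 n.
have km : kap n < (edges n)%:R^-1.
  by rewrite -[ltRHS]mul1r ltr_pdivlMr// kap_edges.
have step k : (i < k < j)%N -> (j - k)%:R * lgg n i x y + (k - i)%:R * lgg n j x y
    + (k - i)%:R * (j - k)%:R * (j - i)%:R / (edges n)%:R <= 0.
  move=> /andP[ik kj]; rewrite -lgg_interp ?(ltnW ik) ?(ltnW kj)//.
  have ke := K k (leq_trans (ltnW kj) je).
  by rewrite pmulr_rle0// ltr0n subn_gt0.
have big : (2 : R) <= (j - i)%:R by rewrite ler_nat; lia.
have hn (x' : R) : 1 <= x' -> 2 <= x' + 1 -> kap n < x' * (x' + 1) / (edges n)%:R.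
  move=> h1 h2; apply: lt_le_trans km _.
  by rewrite ler_peMl ?invr_ge0 ?(ltW m0)//; nra.
case: ij0 => h0.
  have := step i.+1; rewrite ltnSn ij2 => /(_ isT); rewrite h0 mulr0 add0r.
  rewrite subSnn !mul1r (_ : (j - i)%N = (j - i.+1).+1); last by lia.
  rewrite -[(j - i.+1).+1%:R]natr1; have : (1 : R) <= (j - i.+1)%:R by rewrite ler1n; lia.
  move=> h1; have h2 := hn _ h1 ltac:(lra).
  by lra.
have := step j.-1; rewrite (_ : (i < j.-1 < j)%N); last by lia.
move=> /(_ isT); rewrite h0 mulr0 addr0 (_ : (j - j.-1)%N = 1%N); last by lia.
rewrite mulr1 mul1r (_ : (j - i)%N = (j.-1 - i).+1); last by lia.
rewrite -[(j.-1 - i).+1%:R]natr1; have : (1 : R) <= (j.-1 - i)%:R by rewrite ler1n; lia.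
move=> h1; have h2 := hn _ h1 ltac:(lra).
by lra.
Qed.

(* Consecutive [lgg] differ by [2 s - (2 i + 1) / edges n] where
   [s = (y - x + 1) / 2]: near a gate, [s] is close to an odd multiple of
   [(2 edges n)^-1]. *)
Lemma gateP n r t : 0 <= r -> 0 <= t -> KK n r t -> gate n r t ->
  [/\ expR (- 12) <= r, expR (- 12) <= t & exists u, odd u /\
    `|(ln t - ln r + 1) / 2 - u%:R / (2 * (edges n)%:R)| <= kap n / 2].
Proof.
move=> r0 t0 K [i [j [ie je ij gi gj]]].
(* On an axis at most one monomial of the stage is nonzero, so no gate lies there. *)
have rp : 0 < r.
  rewrite lt_neqAle r0 andbT eq_sym; apply/eqP => r00.
  have zero k : (k < edges n)%N -> gg n k r t = 0.
    by move=> h; rewrite /gg r00 expr0n subn_eq0 leqNgt h /= mulr0 mul0r.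
  have [ilt|ilt] := ltnP i (edges n).
    by move: gi; rewrite zero// => /esym/eqP; rewrite oner_eq0.
  have ji : (j < edges n)%N by lia.
  by move: gj; rewrite zero// ltNge expR_ge0.
have tp : 0 < t.
  rewrite lt_neqAle t0 andbT eq_sym; apply/eqP => t00.
  have zero k : (0 < k)%N -> gg n k r t = 0.
    by move=> h; rewrite /gg t00 expr0n (gtn_eqF h) /= mulr0.
  have [ilt|ilt] := ltnP 0 i.
    by move: gi; rewrite zero// => /esym/eqP; rewrite oner_eq0.
  have ji : (0 < j)%N by lia.
  by move: gj; rewrite zero// ltNge expR_ge0.
set x := ln r; set y := ln t.
have K' k : (k <= edges n)%N -> lgg n k x y <= 0.
  by move=> ke; have := K k ke; rewrite gg_exp// -expR0 ler_expR.
have li : lgg n i x y = 0.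
  by move: gi; rewrite gg_exp// -[RHS]expR0 => /expR_inj.
have lj : - kap n < lgg n j x y by move: gj; rewrite gg_exp// ltr_expR.
have k0 := kap_gt0 n; have m0 := edges_natr0 n.
have [u [uo [ue [hs hi]]]] : exists u, odd u /\ ((u <= 2 * edges n)%N /\
   (`|(y - x + 1) / 2 - u%:R / (2 * (edges n)%:R)| <= kap n / 2 /\ True)).
  have adj k : - kap n <= lgg n k.+1 x y - lgg n k x y <= kap n ->
      `|(y - x + 1) / 2 - (2 * k + 1)%:R / (2 * (edges n)%:R)| <= kap n / 2.
    move=> /andP[h1 h2].
    have E : lgg n k.+1 x y - lgg n k x y =
        2 * ((y - x + 1) / 2 - (2 * k + 1)%:R / (2 * (edges n)%:R)).
      rewrite /lgg natrD natrM -[k.+1%:R]natr1.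
      have E (M k' e : R) : M != 0 ->
        M * x + (k' + 1) * (y - x) + (k' + 1) * (M - (k' + 1)) / M + e
         - (M * x + k' * (y - x) + k' * (M - k') / M + e) =
        2 * ((y - x + 1) / 2 - (2 * k' + 1) / (2 * M)).
        by move=> M0; field.
      by apply: E; rewrite gt_eqF.
    by rewrite E in h1 h2; rewrite ler_norml; apply/andP; split; lra.
  have [lt|lt|/eqP] := ltngtP i j; last by rewrite (negbTE ij).
    have jE : j = i.+1.
      apply: (@gate_adjacent n i j x y) => //; [by rewrite lt|by rewrite li oppr_lt0|by left].
    exists (2 * i + 1)%N; split; first by rewrite oddD oddM.
    split; first by lia.
    split => //; apply: adj; rewrite -jE li subr0 (ltW lj)/=.
    by apply: le_trans (K' j je) _; exact: ltW.
  have iE : i = j.+1.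
    apply: (@gate_adjacent n j i x y) => //; [by rewrite lt|by rewrite li oppr_lt0|by right].
  exists (2 * j + 1)%N; split; first by rewrite oddD oddM.
  split; first by lia.
  split => //; apply: adj; rewrite -iE li sub0r; apply/andP; split.
    by rewrite lerN2; apply: le_trans (K' j je) _; exact: ltW.
  by rewrite lerNl; exact: ltW.
have kap1 : kap n <= 1 / 2.
  rewrite /kap mul1r lef_pV2 ?posrE ?mulr_gt0//.
  by have : (1 : R) <= n.+2%:R; [rewrite ler1n|lra].
pose s := (y - x + 1) / 2.
have sE : y = x + 2 * s - 1 by rewrite /s; lra.
have sb : -1 <= s <= 2.
  move: hs; rewrite -/s ler_norml => /andP[h1 h2].
  have : u%:R / (2 * (edges n)%:R) <= 1 :> R.
    by rewrite ler_pdivrMr ?mulr_gt0// mul1r -natrM ler_nat.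
  have : 0 <= u%:R / (2 * (edges n)%:R) :> R by rewrite divr_ge0// mulr_ge0// ltW.
  move: (u%:R / _) h1 h2 => v h1 h2 h3 h4.
  by apply/andP; split; lra.
pose th : R := i%:R / (edges n)%:R.
have th0 : 0 <= th by rewrite divr_ge0.
have th1 : th <= 1 by rewrite ler_pdivrMr// mul1r ler_nat.
have e4 : 0 <= eps n <= 4.
  rewrite /eps divr_ge0//= ler_pdivrMr//.
  by have : (1 : R) <= n.+1%:R; [rewrite ler1n|lra].
(* Solving [lgg n i = 0] for [x] bounds both logarithms from below, as [th] is in [[0, 1]], [s] in
   [[-1, 2]] and [eps n] in [[0, 4]]; the constant 12 is generous. *)
have xE : x = th ^+ 2 - 2 * th * s - eps n.
  move: li; rewrite /lgg sE /th; have m1 : (edges n)%:R != 0 :> R by rewrite gt_eqF.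
  have E (M k' e s' : R) : M != 0 ->
     M * x + k' * (x + 2 * s' - 1 - x) + k' * (M - k') / M + M * e =
     M * (x - ((k' / M) ^+ 2 - 2 * (k' / M) * s' - e)) by move=> M0; field.
  by rewrite E// => /eqP; rewrite mulf_eq0 (negbTE m1) subr_eq0 => /eqP.
move: sb e4 => /andP[s1 s2] /andP[e1 e2].
have x12 : -12 <= x by rewrite xE; nra.
have y12 : -12 <= y by rewrite sE xE; nra.
split.
- by rewrite -[leRHS]lnK ?posrE// ler_expR.
- by rewrite -[leRHS]lnK ?posrE// ler_expR.
- by exists u.
Qed.

(** Over the larger power of 2 as common denominator, one numerator is even and the other odd, so
    they differ by at least 1. *)
Lemma gates_apart n (u u' : nat) : odd u -> odd u' ->
  (4 * n.+2%:R)^-1 <= `|u%:R / (2 * (edges n)%:R) - u'%:R / (2 * (edges n.+1)%:R)| :> R.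
Proof.
suff W a b (v v' : nat) : (a < b)%N -> odd v -> odd v' -> (2 ^ b <= 2 * n.+2)%N ->
    (4 * n.+2%:R)^-1 <= `|v%:R / (2 * (2 ^ a)%:R) - v'%:R / (2 * (2 ^ b)%:R)| :> R.
  have := lev_neq n; rewrite neq_ltn => /orP[] h uo u'o.
    by apply: W => //; exact: edges_le n.+1.
  rewrite distrC; apply: W => //; apply: leq_trans (edges_le n) _.
  by rewrite leq_mul.
move=> ab vo v'o bn.
have [w bE] : exists w, (2 ^ b = 2 * w * 2 ^ a)%N.
  exists (2 ^ (b - a).-1)%N; rewrite -expnS prednK ?subn_gt0//.
  by rewrite -expnD subnK// ltnW.
have a0 : (0 : R) < (2 ^ a)%:R by rewrite ltr0n expn_gt0.
have b0 : (0 : R) < (2 ^ b)%:R by rewrite ltr0n expn_gt0.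
have w0 : (0 : R) < w%:R.
  by move: b0; rewrite bE !natrM pmulr_lgt0// pmulr_rgt0.
have -> : v%:R / (2 * (2 ^ a)%:R) - v'%:R / (2 * (2 ^ b)%:R) =
    ((v * (2 * w))%:R - v'%:R) / (2 * (2 ^ b)%:R) :> R.
  rewrite bE !natrM; move: (2 ^ a)%:R (w%:R) a0 w0 => A W A0 W0.
  by field; rewrite !gt_eqF.
rewrite normrM [X in _ <= _ * X]gtr0_norm ?invr_gt0 ?mulr_gt0//.
have : 1 <= `|(v * (2 * w))%:R - v'%:R| :> R.
  have [h|h|h] := ltngtP (v * (2 * w))%N v'.
  - by rewrite distrC ger0_norm ?subr_ge0 ?ler_nat ?(ltnW h)// lerBrDl natr1 ler_nat.
  - by rewrite ger0_norm ?subr_ge0 ?ler_nat ?(ltnW h)// lerBrDl natr1 ler_nat.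
  - by move: v'o; rewrite -h oddM oddM /= andbF.
move=> h; apply: le_trans (ler_wpM2r _ h); last by rewrite invr_ge0 mulr_ge0.
rewrite mul1r lef_pV2 ?posrE ?mulr_gt0//.
rewrite (_ : 4 * n.+2%:R = 2 * (2 * n.+2)%:R); last by rewrite natrM; ring.
by rewrite ler_pM2l// ler_nat.
Qed.

Lemma ln_lip (d a b : R) : 0 < d -> d <= a -> d <= b ->
  `|ln a - ln b| <= `|a - b| / d.
Proof.
move=> d0; suff W x y : d <= x -> x <= y -> `|ln y - ln x| <= `|y - x| / d.
  move=> da db; case: (leP a b) => h; last by apply: W => //; exact: ltW.
  by rewrite distrC [`|a - b|]distrC; apply: W.
move=> dx xy.
have x0 : 0 < x by apply: lt_le_trans dx.
have y0 : 0 < y by apply: lt_le_trans xy.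
rewrite !ger0_norm ?subr_ge0 ?ler_ln ?posrE//.
rewrite -ln_div ?posrE//.
have -> : y / x = 1 + (y - x) / x by field; rewrite gt_eqF.
have yx0 : 0 <= (y - x) / x by rewrite divr_ge0 ?subr_ge0// ltW.
apply: le_trans (le_ln1Dx _) _; first by apply: lt_le_trans yx0; rewrite ltrN10.
by apply: ler_wpM2l; rewrite ?subr_ge0// lef_pV2 ?posrE.
Qed.

(** Where gates occur the logarithm is Lipschitz with constant [exp 12]; the 4 is the one of
    [gates_apart]. *)
Definition cstep : R := expR (- 12) / 4.

Lemma gate_dist n r t r' t' (d : R) : 0 <= r -> 0 <= t -> 0 <= r' -> 0 <= t' ->
  KK n r t -> gate n r t -> KK n.+1 r' t' -> gate n.+1 r' t' ->
  `|r - r'| <= d -> `|t - t'| <= d -> cstep / (2 * n.+2%:R) <= d.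
Proof.
move=> r0 t0 r'0 t'0 K g K' g' rd td.
have [rb tb [u [uo hu]]] := gateP r0 t0 K g.
have [r'b t'b [u' [u'o hu']]] := gateP r'0 t'0 K' g'.
have e0 : 0 < expR (- 12) :> R by exact: expR_gt0.
have lr := ln_lip e0 rb r'b; have lt := ln_lip e0 tb t'b.
have h1 : `|r - r'| / expR (- 12) <= d / expR (- 12) by rewrite ler_pM2r ?invr_gt0.
have h2 : `|t - t'| / expR (- 12) <= d / expR (- 12) by rewrite ler_pM2r ?invr_gt0.
have ga := gates_apart n uo u'o.
have kk : kap n.+1 <= kap n.
  by rewrite /kap lef_pV2 ?posrE ?mulr_gt0// ler_pM2l// ler_nat.
have kE : kap n = (4 * n.+2%:R)^-1 / 4 by rewrite /kap; field.
rewrite /cstep -mulrA mulrC -ler_pdivlMr//.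
have -> : 4^-1 / (2 * n.+2%:R) = (4 * n.+2%:R)^-1 / 2 :> R by field.
move: lr lt h1 h2 ga hu hu' kk; rewrite kE.
move: (4 * _)^-1 (kap n.+1) (`|r - r'| / _) (`|t - t'| / _) (d / _) => q k a b c.
move: (u%:R / _) (u'%:R / _) (ln r) (ln t) (ln r') (ln t') => U U' x y x' y'.
rewrite !ler_norml => /andP[? ?] /andP[? ?] ? ? h /andP[? ?] /andP[? ?] ?.
(* Each gate is located up to half its [kap], together at most [q / 4], while the gates are at least
   [q] apart; the path has to make up the difference. *)
suff : `|U - U'| <= c + q / 4 by lra.
by rewrite ler_norml; apply/andP; split; lra.
Qed.

End Scales.

(** * Paths through the stages *)

Section Labyrinth.
Variable R : realType.
Implicit Types (a b : R -> R).

Lemma gg_continuous n i a b x : {for x, continuous a} -> {for x, continuous b} ->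
  {for x, continuous (fun s => gg n i (a s) (b s))}.
Proof.
move=> ca cb; apply: continuousM; first apply: continuousM; first exact: cst_continuous.
  exact: (continuous_comp ca (@exprn_continuous R _ (a x))).
exact: (continuous_comp cb (@exprn_continuous R _ (b x))).
Qed.

Lemma bigmax_continuous (s : seq nat) (f : nat -> R -> R) :
  (forall i, continuous (f i)) ->
  continuous (fun y => \big[Num.max/0]_(i <- s) f i y).
Proof.
move=> cf; elim: s => [|i s IH].
  have -> : (fun y => \big[Num.max/0]_(i <- [::]) f i y) = cst 0.
    by apply/funext => y; rewrite big_nil.
  by move=> x; exact: cst_continuous.
have -> : (fun y => \big[Num.max/0]_(i <- i :: s) f i y) =
    (f i \max (fun y => \big[Num.max/0]_(i <- s) f i y))%R.
  by apply/funext => y; rewrite big_cons.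
by move=> x; apply: continuous_max; [exact: cf|exact: IH].
Qed.

(** The intermediate value theorem for the largest monomial of the stage along the path. *)
Lemma stage_cross n a b t0 : continuous a -> continuous b -> t0 <= 1 ->
  KK n (a t0) (b t0) -> ~ KK n (a 1) (b 1) ->
  exists t1, [/\ t0 <= t1, t1 <= 1, KK n (a t1) (b t1) &
    exists2 i, (i <= edges n)%N & gg n i (a t1) (b t1) = 1].
Proof.
move=> ca cb t01 K0 K1.
pose phi s := \big[Num.max/0]_(i <- iota 0 (edges n).+1) gg n i (a s) (b s).
have phi1 s : (phi s <= 1) <-> KK n (a s) (b s).
  split=> [h i ie|h].
    apply: le_trans h; rewrite /phi; apply: (@le_bigmax_seq _ _ _ _ _ i) => //.
    by rewrite mem_iota/= add0n ltnS.
  rewrite /phi big_seq; apply: (big_ind (fun y => y <= 1)) => //.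
    by move=> x y x1 y1; rewrite ge_max x1.
  by move=> i; rewrite mem_iota/= add0n ltnS; exact: h.
have cphi : continuous phi.
  by apply: bigmax_continuous => i x; apply: gg_continuous; [exact: ca|exact: cb].
have p0 : phi t0 <= 1 by exact/phi1.
have p1 : 1 <= phi 1 by rewrite leNgt; apply/negP => /ltW/phi1.
have [t1] := @IVT R phi t0 1 1 t01 (continuous_subspaceT cphi)
  ltac:(by rewrite ge_min p0 le_max p1 orbT).
rewrite in_itv/= => /andP[t0t t1t] pt; exists t1; split => //.
  by apply/phi1; rewrite pt.
apply: contrapT => hn.
have : phi t1 < 1.
  rewrite /phi big_seq; apply: (big_ind (fun y => y < 1)) => //.
    by move=> x y x1 y1; rewrite gt_max x1.
  move=> i; rewrite mem_iota/= add0n ltnS => ie.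
  have := (phi1 t1).1; rewrite pt => /(_ (lexx _))/(_ i ie).
  by rewrite le_eqVlt => /predU1P[h|//]; exfalso; apply: hn; exists i.
by rewrite pt ltxx.
Qed.

Lemma harmonic_unbounded n0 (B : R) : exists J, (n0 < J)%N /\
  B < \sum_(n0 <= l < J) (l.+2%:R)^-1.
Proof.
apply: contrapT => hn; apply: (@dvg_harmonic R).
have nd : nondecreasing_seq (series (@harmonic R)).
  apply/nondecreasing_seqP => n; rewrite /series/= big_nat_recr//= lerDl.
  by rewrite invr_ge0.
apply: nondecreasing_is_cvgn => //.
exists (\sum_(0 <= k < n0.+1) (k.+1%:R)^-1 + Num.max 0 B) => _ [n _ <-].
rewrite /series/=.
have [nn|nn] := leqP n n0.+1.
  apply: le_trans (nd _ _ nn) _; rewrite /series/= lerDl le_max lexx//.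
rewrite (big_cat_nat (n := n0.+1))//=; last exact: ltnW.
rewrite lerD2l -(prednK (leq_ltn_trans (leq0n _) nn)) big_add1/=.
rewrite leNgt; apply/negP => lt; apply: hn; exists n.-1.
split; first by rewrite -ltnS prednK// (leq_ltn_trans _ nn).
by apply: le_lt_trans lt; rewrite le_max lexx orbT.
Qed.

(* [len t] bounds the length of the path up to time [t]; each consecutive pair
   of gates costs a multiple of [1 / n]. *)
Lemma labyrinth n0 (B : R) : exists J, (n0 <= J)%N /\
  forall (a b len : R -> R), continuous a -> continuous b ->
  (forall s, 0 <= a s) -> (forall s, 0 <= b s) ->
  (forall s s', 0 <= s -> s <= s' -> s' <= 1 ->
     `|a s - a s'| <= len s' - len s /\ `|b s - b s'| <= len s' - len s) ->
  (forall n s i, KK n (a s) (b s) -> (i <= edges n)%N -> gg n i (a s) (b s) = 1 ->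
     gate n (a s) (b s)) ->
  len 1 - len 0 <= B -> KK n0 (a 0) (b 0) -> KK J (a 1) (b 1).
Proof.
have c0 : 0 < cstep R by rewrite /cstep divr_gt0 ?expR_gt0.
have [J [nJ hJ]] := harmonic_unbounded n0.+1 (2 * B / cstep R).
exists J; split; first by lia.
move=> a b len ca cb a0 b0 hl hg hB K0; apply: contrapT => KJ.
have notK n : (n <= J)%N -> ~ KK n (a 1) (b 1).
  by move=> nJ' /(KK_le (a0 _) (b0 _) nJ').
have l0 s s' : 0 <= s -> s <= s' -> s' <= 1 -> len s <= len s'.
  move=> h1 h2 h3; have [h _] := hl _ _ h1 h2 h3.
  by rewrite -subr_ge0; apply: le_trans h.
(* A path that leaves [K_J] passes a gate of every stage from [n0.+1] to [J]. By [gate_dist] each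
   passage to the next gate costs a further term of a multiple of the harmonic series. *)
have main k : (n0.+1 + k <= J)%N -> exists s, [/\ 0 <= s, s <= 1,
    KK (n0.+1 + k) (a s) (b s), gate (n0.+1 + k) (a s) (b s) &
    cstep R / 2 * \sum_(n0.+1 <= l < n0.+1 + k) (l.+2%:R)^-1 <= len s - len 0].
  elim: k => [|k IH] kJ.
    rewrite addn0 in kJ *.
    have [t1 [h1 h2 h3 [i ie gi]]] := stage_cross ca cb ler01
      (KK_S (a0 _) (b0 _) K0) (notK _ kJ).
    exists t1; split => //; first exact: hg gi.
    by rewrite big_geq// mulr0 subr_ge0; exact: l0.
  have [s [s0 s1 Ks gs hs]] := IH ltac:(lia).
  rewrite addnS in kJ *.
  have [t1 [h1 h2 h3 [i ie gi]]] := stage_cross ca cb s1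
      (KK_S (a0 _) (b0 _) Ks) (notK _ kJ).
  have gt : gate (n0.+1 + k).+1 (a t1) (b t1) by exact: hg gi.
  exists t1; split => //; first exact: le_trans h1.
  rewrite big_nat_recr ?leq_addr//= mulrDr.
  have [ha hb] := hl _ _ s0 h1 h2.
  have := gate_dist (a0 _) (b0 _) (a0 _) (b0 _) Ks gs h3 gt ha hb.
  have -> X : cstep R / (2 * X) = cstep R / 2 * X^-1 by rewrite invfM mulrA.
  move: (cstep R / 2 * _^-1) (cstep R / 2 * \sum_(_ <= _ < _) _) hs => p q hs hp.
  by rewrite -lerBrDr; apply: le_trans hs _; lra.
have [s [s0 s1 _ _]] := main (J - n0.+1)%N ltac:(lia).
rewrite (subnKC (ltnW nJ)) => hs.
have := l0 _ _ s0 s1 (lexx _).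
have h : cstep R / 2 * (2 * B / cstep R) < cstep R / 2 * \sum_(n0.+1 <= l < J) (l.+2%:R)^-1.
  by rewrite ltr_pM2l// divr_gt0.
have E : cstep R / 2 * (2 * B / cstep R) = B by field; rewrite gt_eqF.
by rewrite E in h; lra.
Qed.

End Labyrinth.

(** * The power series that forms the walls *)

Section Construction.
Variable R : realType.
Local Notation C := (cplx R).
Local Notation mono := (C * (nat * nat))%type.

Lemma geom_small (c x e : R) : 0 <= x < 1 -> 0 < e ->
  exists N, forall n, (N <= n)%N -> c * x ^+ n <= e.
Proof.
move=> /andP[x0 x1] e0.
have := @cvg_geometric R `|c| x ltac:(by rewrite ger0_norm).
move=> /cvgrPdist_le/(_ e e0)[N _ h]; exists N => n Nn.
have := h n Nn; rewrite sub0r normrN /geometric/= => h'.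
apply: le_trans h'; apply: le_trans (ler_norm _) _.
by rewrite !normrM normr_id.
Qed.

(** The exponent has three tasks: to exclude linear terms, to bring the total of the monomials below
    [exp (- kap n)] under 1, and to make the stages summable on each earlier [K]. *)
Definition stage_ok n (A : R) N := [/\ (2 <= N)%N,
  (edges n).+1%:R * A * expR (- kap R n) ^+ N <= 1 &
  (0 < n)%N -> (edges n).+1%:R * A * expR (- (n%:R ^+ 2)^-1) ^+ N <= 2^-1 ^+ n].

Lemma stage_ex n A : exists N, stage_ok n A N.
Proof.
have x1 : 0 <= expR (- kap R n) < 1 by rewrite expR_ge0 expR_lt1 oppr_lt0 kap_gt0.
have [N1 h1] := geom_small ((edges n).+1%:R * A) x1 ltr01.
have [N2 h2] : exists N, forall k, (N <= k)%N -> (0 < n)%N ->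
    (edges n).+1%:R * A * expR (- (n%:R ^+ 2)^-1) ^+ k <= 2^-1 ^+ n.
  have [->|n0] := posnP n; first by exists 0%N.
  have x2 : 0 <= expR (- (n%:R ^+ 2 : R)^-1) < 1.
    by rewrite expR_ge0 expR_lt1 oppr_lt0 invr_gt0 exprn_gt0// ltr0n.
  have e0 : 0 < 2^-1 ^+ n :> R by rewrite exprn_gt0.
  have [N2 h2] := geom_small ((edges n).+1%:R * A) x2 e0.
  by exists N2 => k /h2.
exists (maxn 2 (maxn N1 N2)); split; first exact: leq_maxl.
- by apply: h1; rewrite leq_max leq_maxl orbT.
- by move=> n0; apply: h2 => //; rewrite leq_max leq_maxr orbT.
Qed.

Definition expo n A : nat := projT1 (cid (stage_ex n A)).

Lemma expoP n A : stage_ok n A (expo n A).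
Proof. by rewrite /expo; case: cid. Qed.

Definition TT n : R := expR ((edges n)%:R + (edges n)%:R * eps R n).

Lemma cgg_le n i : (i <= edges n)%N -> cgg R n i <= TT n.
Proof.
move=> ie; rewrite /cgg /TT ler_expR lerD2r.
rewrite ler_pdivrMr ?edges_natr0//.
have i0 : (0 : R) <= i%:R by []. 
have i1 : (i%:R : R) <= (edges n)%:R by rewrite ler_nat.
nra.
Qed.

(* [BB n] bounds the sum of the first [n] stages on the unit bidisc; the
   [n]-th stage has size [AA n] on its walls. *)
Fixpoint BB n : R := if n is n'.+1 then
  BB n' + (edges n').+1%:R * (BB n' + 10) * TT n' ^+ expo n' (BB n' + 10) else 0.

Arguments BB : simpl never.

Definition AA n := BB n + 10.
Definition NN n := expo n (AA n).

Lemma BB_S n : BB n.+1 = BB n + (edges n).+1%:R * AA n * TT n ^+ NN n.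
Proof. by []. Qed.

Lemma BB_ge0 n : 0 <= BB n.
Proof.
by elim: n => [//|n IH]; rewrite BB_S /AA addr_ge0// !mulr_ge0 ?addr_ge0 ?exprn_ge0 ?expR_ge0.
Qed.

Lemma AA_gt0 n : 0 < AA n.
Proof. by have := BB_ge0 n; rewrite /AA; lra. Qed.

Definition F0 n : seq mono :=
  [seq (((AA n * cgg R n i ^+ NN n)%:C)%C : C,
    (((edges n - i) * NN n)%N, (i * NN n)%N)) | i <- iota 0 (edges n).+1].

Definition term n i (z w : C) : C := ((AA n * cgg R n i ^+ NN n)%:C)%C *
   z ^+ ((edges n - i) * NN n) * w ^+ (i * NN n).

Lemma ev_F0 n z w : ev (F0 n) z w = \sum_(i <- iota 0 (edges n).+1) term n i z w.
Proof. by rewrite /ev big_map. Qed.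

Lemma nc_term n i z w : nc (term n i z w) = AA n * gg n i (nc z) (nc w) ^+ NN n.
Proof.
have A0 := ltW (AA_gt0 n); have c0 := ltW (cgg_gt0 R n i).
rewrite /term !ncM !ncX nc_real ger0_norm ?mulr_ge0 ?exprn_ge0//.
by rewrite /gg !exprMn !exprM !mulrA.
Qed.

Lemma maj_F0 n r t : maj (F0 n) r t =
  \sum_(i <- iota 0 (edges n).+1) AA n * gg n i r t ^+ NN n.
Proof.
rewrite /maj big_map; apply: eq_bigr => i _ /=.
have A0 := ltW (AA_gt0 n); have c0 := ltW (cgg_gt0 R n i).
rewrite nc_real ger0_norm ?mulr_ge0 ?exprn_ge0//.
by rewrite /gg !exprMn !exprM !mulrA.
Qed.

Lemma sum_iota_le n (f : nat -> R) (c : R) :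
  (forall i, (i <= edges n)%N -> f i <= c) ->
  \sum_(i <- iota 0 (edges n).+1) f i <= (edges n).+1%:R * c.
Proof.
move=> h; apply: (@le_trans _ _ (\sum_(i <- iota 0 (edges n).+1) c)).
  by rewrite big_seq [leRHS]big_seq; apply: ler_sum => i; rewrite mem_iota => /andP[_ ie]; apply: h.
by rewrite big_const_seq count_predT size_iota iter_addr_0 mulr_natl.
Qed.

Lemma maj_early n r t : 0 <= r <= 1 -> 0 <= t <= 1 ->
  maj (F0 n) r t <= BB n.+1 - BB n.
Proof.
move=> /andP[r0 r1] /andP[t0 t1]; rewrite maj_F0 BB_S [leRHS]addrAC subrr add0r -mulrA.
apply: sum_iota_le => i ie; apply: ler_wpM2l; first exact: ltW (AA_gt0 n).
rewrite lerXn2r ?nnegrE ?gg_ge0 ?expR_ge0//; apply: le_trans (cgg_le ie).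
rewrite /gg -mulrA ler_piMr ?(ltW (cgg_gt0 R n i))//.
by rewrite mulr_ile1 ?exprn_ge0 ?exprn_ile1.
Qed.

Lemma maj_late n r t : 0 <= r -> 0 <= t -> KK n r t ->
  maj (F0 n.+1) r t <= 2^-1 ^+ n.+1.
Proof.
move=> r0 t0 K; have [_ _ /(_ isT)] := expoP n.+1 (AA n.+1); apply: le_trans.
rewrite maj_F0 -mulrA; apply: sum_iota_le => i ie.
apply: ler_wpM2l; first exact: ltW (AA_gt0 _).
by rewrite lerXn2r ?nnegrE ?gg_ge0 ?expR_ge0//; exact: KK_step.
Qed.

Lemma maj_later n l r t : 0 <= r -> 0 <= t -> KK n r t -> (n < l)%N ->
  maj (F0 l) r t <= 2^-1 ^+ l.
Proof.
case: l => // l r0 t0 K; rewrite ltnS => nl; apply: maj_late => //.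
exact: KK_le K.
Qed.

Lemma maj_early_sum n r t : 0 <= r <= 1 -> 0 <= t <= 1 ->
  \sum_(l < n) maj (F0 l) r t <= BB n.
Proof.
move=> hr ht; elim: n => [|n IH]; first by rewrite big_ord0.
rewrite big_ord_recr; have := maj_early n hr ht.
move: IH; move: (BB n.+1) (BB n) (\sum_(_ < _) _) (maj _ _ _) => b b' S m.
by rewrite /= => h1 h2; lra.
Qed.

Lemma half_tail n k : \sum_(l < k) 2^-1 ^+ (n.+1 + l) <= 1 :> R.
Proof.
have -> : \sum_(l < k) 2^-1 ^+ (n.+1 + l) = 2^-1 ^+ n.+1 * \sum_(l < k) 2^-1 ^+ l :> R.
  by rewrite mulr_sumr; apply: eq_bigr => l _; rewrite exprD.
apply: le_trans (ler_wpM2l _ (geometric_half R k)) _; first by rewrite exprn_ge0.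
rewrite exprS mulrAC mulVf// mul1r exprn_ile1 ?invr_ge0// invf_le1//.
by rewrite ler1n.
Qed.

Lemma maj_late_sum n k r t : 0 <= r -> 0 <= t -> KK n r t ->
  \sum_(l < k) maj (F0 (n.+1 + l)) r t <= 1.
Proof.
move=> r0 t0 K; apply: le_trans (half_tail n k); apply: ler_sum => l _.
by apply: maj_later K _ => //; rewrite addSn ltnS leq_addr.
Qed.

Lemma sum_maj_F0 n k r t : 0 <= r -> 0 <= t -> KK n r t ->
  \sum_(l < k) maj (F0 l) r t <= BB n.+1 + 1.
Proof.
move=> r0 t0 K; have [r1 t1] := KK_le1 r0 t0 K.
apply: (@le_trans _ _ (\sum_(l < n.+1 + k) maj (F0 l) r t)).
  rewrite addnC big_split_ord/= lerDl; apply: sumr_ge0 => i _; exact: maj_ge0.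
rewrite big_split_ord/=; apply: lerD; last exact: maj_late_sum.
by apply: maj_early_sum; apply/andP.
Qed.

Lemma summ_F0 n r t : 0 <= r -> 0 <= t -> KK n r t -> summ F0 r t.
Proof. by move=> r0 t0 K; exists (BB n.+1 + 1) => k; exact: sum_maj_F0. Qed.

(** The dominant monomial has modulus [AA n = BB n + 10]. The earlier stages take away at most
    [BB n], the rest of stage [n] at most 1, and all later stages together at most 1. What remains
    is more than [a + b z + c w] can cancel. *)
Lemma wall n z w i : KK n (nc z) (nc w) -> (i <= edges n)%N ->
  gg n i (nc z) (nc w) = 1 -> ~ gate n (nc z) (nc w) -> 7 <= nc (PS F0 z w).
Proof.
move=> K ie gi ng; have z0 := nc_ge0 z; have w0 := nc_ge0 w.
have [z1 w1] := KK_le1 z0 w0 K.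
have sb : sum_bounded (fun l => ev (F0 l) z w) (BB n.+1 + 1).
  by apply: (@PS_bounded _ F0 (nc z) (nc w)) => // k; exact: sum_maj_F0.
have tb : sum_bounded (fun l => ev (F0 (n.+1 + l)%N) z w) 1.
  apply: (@PS_bounded _ (fun l => F0 (n.+1 + l)%N) (nc z) (nc w)) => // k.
  exact: maj_late_sum.
have E : PS F0 z w = \sum_(l < n) ev (F0 l) z w + ev (F0 n) z w +
   csum (fun l => ev (F0 (n.+1 + l)%N) z w).
  by rewrite /PS (csum_shift n.+1 sb) big_ord_recr.
have h1 : nc (\sum_(l < n) ev (F0 l) z w) <= BB n.
  apply: le_trans (nc_sum _ _ _) _.
  apply: le_trans (maj_early_sum n (r := nc z) (t := nc w) _ _); try exact/andP.
  by apply: ler_sum => l _; exact: nc_ev.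
have h3 := csum_le tb.
have h2 : AA n - 1 <= nc (ev (F0 n) z w).
  have im : i \in iota 0 (edges n).+1 by rewrite mem_iota.
  rewrite ev_F0 (bigD1_seq i im (iota_uniq _ _))/=.
  have ti : nc (term n i z w) = AA n by rewrite nc_term gi expr1n mulr1.
  have rest : nc (\sum_(j <- iota 0 (edges n).+1 | j != i) term n j z w) <= 1.
    apply: le_trans (nc_sum _ _ _) _.
    have [_ h _] := expoP n (AA n); apply: le_trans h.
    rewrite -/(NN n) big_mkcond -mulrA.
    apply: sum_iota_le => j je.
    have pos : 0 <= AA n * expR (- kap R n) ^+ NN n.
      by rewrite mulr_ge0 ?exprn_ge0 ?expR_ge0// ltW// AA_gt0.
    case: ifPn => // ji; rewrite nc_term.
    apply: ler_wpM2l; first exact: ltW (AA_gt0 n).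
    rewrite lerXn2r ?nnegrE ?gg_ge0 ?expR_ge0// leNgt; apply/negP => lt.
    by apply: ng; exists i, j; split => //; rewrite eq_sym.
  set S := \sum_(_ <- _ | _) _ in rest *.
  have := ncB (term n i z w + S) S; rewrite addrK ti; lra.
rewrite E; set X := \sum_(_ < _) _ in h1 *; set Y := ev _ _ _ in h2 *.
set Z := csum _ in h3 *.
have := ncB (X + Y + Z) (X + Z); rewrite (_ : X + Y + Z - (X + Z) = Y); last by ring.
have := ncD X Z; move: h2; rewrite /AA; lra.
Qed.

End Construction.

(** * Series convergent on the union of the [K_n] *)

Section ReinhardtClass.
Variable R : realType.
Local Notation C := (cplx R).
Local Notation mono := (C * (nat * nat))%type.
Implicit Types (P Q : nat -> seq mono) (r t : R).

(** The strict inequality of [KK_lt] leaves room, by continuity. *)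
Lemma KK_widen n r t : 0 <= r -> 0 <= t -> KK n r t ->
  exists2 e : R, 0 < e & KK n.+1 (r + e) (t + e).
Proof.
move=> r0 t0 K.
have cont i : {for (0 : R), continuous (fun s : R => gg n.+1 i (r + s) (t + s))}.
  by apply: gg_continuous; apply: continuousD;
    [exact: cst_continuous|exact: cvg_id|exact: cst_continuous|exact: cvg_id].
have : \forall s \near (0 : R), forall i : 'I_(edges n.+1).+1,
    gg n.+1 i (r + s) (t + s) < 1.
  apply: (@filter_forall R _ (fun (i : 'I_(edges n.+1).+1) s =>
    gg n.+1 i (r + s) (t + s) < 1) (nbhs (0 : R))) => i.
  have gi : gg n.+1 i (r + 0) (t + 0) < 1 by rewrite !addr0; apply: KK_lt => //; rewrite -ltnS.
  exact: (cont i _ (lt_nbhsl gi)).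
move=> /nbhs_ballP[d d0 hd]; exists (d / 2); first exact: divr_gt0.
move=> i ie; apply: ltW; have := hd (d / 2).
rewrite -ball_normE/= sub0r normrN gtr0_norm ?divr_gt0// => h.
have := h _ (Ordinal (ie : (i < (edges n.+1).+1)%N)); apply.
by rewrite ltr_pdivrMr// ltr_pMr// ltr1n.
Qed.

Lemma KK_sub n r t r' t' : 0 <= r' <= r -> 0 <= t' <= t -> KK n r t -> KK n r' t'.
Proof. by move=> hr ht K i ie; apply: le_trans (K i ie); exact: gg_le. Qed.

Lemma KK_scale n r t : 0 < r -> 0 < t -> KK n r t ->
  exists2 lam : R, 1 < lam & KK n.+1 (lam * r) (lam * t).
Proof.
move=> r0 t0 K; have [e e0 Ke] := KK_widen (ltW r0) (ltW t0) K.
pose d := Num.min (e / r) (e / t).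
have d0 : 0 < d by rewrite lt_min !divr_gt0.
exists (1 + d); first by rewrite ltrDl.
have dr : d * r <= e by rewrite -ler_pdivlMr// ge_min lexx.
have dt : d * t <= e by rewrite -ler_pdivlMr// ge_min lexx orbT.
by apply: KK_sub Ke; rewrite mulrDl mul1r lerD2l ?dr ?dt andbT addr_ge0 ?mulr_ge0 ?ltW.
Qed.

Definition Omega (z w : C) := exists n, KK n (nc z) (nc w).

(** Positive radii suffice, since [KK_widen] encloses every point of [Omega] in a bidisc with
    positive radii, and they can be divided by in [summ_DZ] and [summ_DW]. *)
Definition convergent P := forall n r t, 0 < r -> 0 < t -> KK n r t -> summ P r t.

Definition Hol : set (C -> C -> C) := [set f | exists2 P, convergent P & f = PS P].

Lemma convergent_DZ P : convergent P -> convergent (DZ P).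
Proof.
move=> cP n r t r0 t0 K; have [lam l1 Kl] := KK_scale r0 t0 K.
have l0 : 0 < lam by lra.
apply: (summ_DZ r0 (ltW t0) l1); apply: cP Kl; exact: mulr_gt0.
Qed.

Lemma convergent_DW P : convergent P -> convergent (DW P).
Proof.
move=> cP n r t r0 t0 K; have [lam l1 Kl] := KK_scale r0 t0 K.
have l0 : 0 < lam by lra.
apply: (summ_DW (ltW r0) t0 l1); apply: cP Kl; exact: mulr_gt0.
Qed.

Lemma Omega_open z0 w0 : Omega z0 w0 -> exists2 d : R, 0 < d &
  forall z w, nc (z - z0) < d -> nc (w - w0) < d -> Omega z w.
Proof.
move=> [n K]; have [e e0 Ke] := KK_widen (nc_ge0 _) (nc_ge0 _) K.
exists e => // z w hz hw; exists n.+1; apply: KK_sub Ke; rewrite nc_ge0/=.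
  by have := ncD z0 (z - z0); rewrite addrCA subrr addr0; lra.
by have := ncD w0 (w - w0); rewrite addrCA subrr addr0; lra.
Qed.

Lemma PS_qder P z0 w0 : convergent P -> Omega z0 w0 ->
  qder (PS P) (PS (DZ P)) (PS (DW P)) z0 w0.
Proof.
move=> cP [n K]; have [e e0 Ke] := KK_widen (nc_ge0 _) (nc_ge0 _) K.
have r0 : 0 < nc z0 + e by rewrite ltr_wpDl ?nc_ge0.
have t0 : 0 < nc w0 + e by rewrite ltr_wpDl ?nc_ge0.
have [lam l1 Kl] := KK_scale r0 t0 Ke; have l0 : 0 < lam by lra.
have [M M0 hM] := PS_quad r0 t0 l1 (cP _ _ _ (mulr_gt0 l0 r0) (mulr_gt0 l0 t0) Kl).
exists e => //; exists M => // z w z' w' hz hw hz' hw'.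
have near (x y : C) : nc (x - y) < e -> nc x <= nc y + e.
  by have := ncD y (x - y); rewrite addrCA subrr addr0; lra.
by apply: hM; exact: near.
Qed.

Lemma Hol_dclosed : dclosed Omega Hol.
Proof.
move=> f [P cP ->]; exists (PS (DZ P)), (PS (DW P)); split.
- by exists (DZ P) => //; exact: convergent_DZ.
- by exists (DW P) => //; exact: convergent_DW.
- by move=> z w; exact: PS_qder.
Qed.

Lemma PS_bd P n r t : convergent P -> 0 < r -> 0 < t -> KK n r t ->
  exists2 B : R, 0 <= B & forall z w, nc z <= r -> nc w <= t -> nc (PS P z w) <= B.
Proof.
move=> cP r0 t0 K; have [B hB] := cP _ _ _ r0 t0 K; exists B.
  by have := hB 0; rewrite big_ord0.
by move=> z w hz hw; apply: csum_le; exact: PS_bounded hB hz hw.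
Qed.

Lemma PS_lip P n r t : convergent P -> 0 < r -> 0 < t -> KK n r t ->
  exists2 L : R, 0 <= L & forall z w z' w',
    nc z <= r -> nc w <= t -> nc z' <= r -> nc w' <= t ->
    nc (PS P z w - PS P z' w') <= L * (nc (z - z') + nc (w - w')).
Proof.
move=> cP r0 t0 K; have [lam l1 Kl] := KK_scale r0 t0 K.
have l0 : 0 < lam by lra.
have [r1 t1] := KK_le1 (ltW r0) (ltW t0) K.
have [M M0 hM] := PS_quad r0 t0 l1 (cP _ _ _ (mulr_gt0 l0 r0) (mulr_gt0 l0 t0) Kl).
have [A A0 hA] := PS_bd (convergent_DZ cP) r0 t0 K.
have [B B0 hB] := PS_bd (convergent_DW cP) r0 t0 K.
(* All points lie in the unit bidisc, so the two increments add up to at most 4 and the quadratic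
   remainder becomes linear. *)
exists (M * 4 + A + B); first by rewrite !addr_ge0 ?mulr_ge0.
move=> z' w' z w hz' hw' hz hw.
have split4 (x y u v : C) : x - y = (x - y - u - v) + (u + v) by ring.
rewrite (split4 (PS P z' w') (PS P z w) (PS (DZ P) z w * (z' - z))
  (PS (DW P) z w * (w' - w))).
have := hM _ _ _ _ hz hz' hw hw'.
set E := _ - _ - _ - _ => hE; clearbody E; apply: le_trans (ncD _ _) _.
have := ncD (PS (DZ P) z w * (z' - z)) (PS (DW P) z w * (w' - w)); rewrite !ncM => h1.
have a0 := nc_ge0 (z' - z); have b0 := nc_ge0 (w' - w).
have h2 := ler_wpM2r a0 (hA _ _ hz hw); have h3 := ler_wpM2r b0 (hB _ _ hz hw).
have x2 := ncB z' z; have y2 := ncB w' w.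
have h5 : M * (nc (z' - z) + nc (w' - w)) ^+ 2 <= M * (4 * (nc (z' - z) + nc (w' - w))).
  by apply: ler_wpM2l => //; nra.
move: h1 h2 h3; move: (PS (DZ P) z w) (PS (DW P) z w) => u v h1 h2 h3.
have := mulr_ge0 A0 b0; have := mulr_ge0 B0 a0.
clear hM hA hB hz hw hz' hw' cP K Kl.
lra.
Qed.

Lemma mul_lip (f g : C -> C -> C) (Dm : C -> C -> Prop) (A B L K : R) :
  0 <= A -> 0 <= B -> 0 <= L -> 0 <= K ->
  (forall z w, Dm z w -> nc (f z w) <= A) -> (forall z w, Dm z w -> nc (g z w) <= B) ->
  (forall z w z' w', Dm z w -> Dm z' w' ->
    nc (f z w - f z' w') <= L * (nc (z - z') + nc (w - w'))) ->
  (forall z w z' w', Dm z w -> Dm z' w' ->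
    nc (g z w - g z' w') <= K * (nc (z - z') + nc (w - w'))) ->
  forall z w z' w', Dm z w -> Dm z' w' ->
    nc (f z w * g z w - f z' w' * g z' w') <= (L * B + A * K) * (nc (z - z') + nc (w - w')).
Proof.
move=> A0 B0 L0 K0 hA hB hL hK z w z' w' d d'.
rewrite (_ : _ - _ = (f z w - f z' w') * g z w + f z' w' * (g z w - g z' w')); last by ring.
apply: le_trans (ncD _ _) _; rewrite !ncM [leRHS]mulrDl; apply: lerD.
  by rewrite mulrAC; apply: ler_pM; rewrite ?nc_ge0//; [exact: hL|exact: hB].
by rewrite -mulrA; apply: ler_pM; rewrite ?nc_ge0//; [exact: hA|exact: hK].
Qed.

Definition lin_part (a b c : C) : nat -> seq mono := fun n =>
  if n is 0 then [:: (a, (0, 0)); (b, (1, 0)); (c, (0, 1))]%N else [::].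

Definition addPS P Q n := P n ++ Q n.

Lemma maj_cat (l l' : seq mono) r t : maj (l ++ l') r t = maj l r t + maj l' r t.
Proof. by rewrite /maj big_cat. Qed.

Lemma ev_cat (l l' : seq mono) z w : ev (l ++ l') z w = ev l z w + ev l' z w :> C.
Proof. by rewrite /ev big_cat. Qed.

Lemma convergent_add P Q : convergent P -> convergent Q -> convergent (addPS P Q).
Proof.
move=> cP cQ n r t r0 t0 K; have [A hA] := cP _ _ _ r0 t0 K.
have [B hB] := cQ _ _ _ r0 t0 K; exists (A + B) => k.
rewrite /addPS; under eq_bigr do rewrite maj_cat.
by rewrite big_split; apply: lerD; [exact: hA|exact: hB].
Qed.

Lemma convergent_fin P : (forall n, P n.+1 = [::]) -> convergent P.
Proof.
move=> P0 _ r t r0 t0 _; exists (maj (P 0%N) r t) => -[|k].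
  by rewrite big_ord0; apply: maj_ge0; exact: ltW.
rewrite big_ord_recl big1 ?addr0// => i _.
by rewrite /= /bump/= P0 /maj big_nil.
Qed.

Lemma PS_fin P z w : (forall n, P n.+1 = [::]) -> PS P z w = ev (P 0%N) z w.
Proof.
move=> P0; have b : sum_bounded (fun n => ev (P n) z w) (nc (ev (P 0%N) z w)).
  case=> [|k]; first by rewrite big_ord0 nc_ge0.
  rewrite big_ord_recl big1 ?addr0// => i _.
  by rewrite /= /bump/= P0 /ev big_nil nc0.
apply: (csumE b) => e e0; exists 1%N => -[//|k] _.
rewrite big_ord_recl big1 ?addr0 ?subrr ?nc0// => i _.
by rewrite /= /bump/= P0 /ev big_nil.
Qed.

Lemma PS_add P Q z w : convergent P -> convergent Q -> Omega z w ->
  PS (addPS P Q) z w = PS P z w + PS Q z w.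
Proof.
move=> cP cQ [n K]; have [e e0 Ke] := KK_widen (nc_ge0 _) (nc_ge0 _) K.
have r0 : 0 < nc z + e by rewrite ltr_wpDl ?nc_ge0.
have t0 : 0 < nc w + e by rewrite ltr_wpDl ?nc_ge0.
have [A hA] := cP _ _ _ r0 t0 Ke; have [B hB] := cQ _ _ _ r0 t0 Ke.
have zr : nc z <= nc z + e by rewrite lerDl ltW.
have wt : nc w <= nc w + e by rewrite lerDl ltW.
have E := csum_lin 1 (PS_bounded hA zr wt) (PS_bounded hB zr wt).
rewrite mul1r in E; rewrite /PS -E; apply: eq_csum => k.
by rewrite /addPS ev_cat mul1r.
Qed.

Lemma DZ_add P Q : DZ (addPS P Q) = addPS (DZ P) (DZ Q).
Proof. by apply/funext => n; rewrite /DZ /addPS map_cat. Qed.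

Lemma DW_add P Q : DW (addPS P Q) = addPS (DW P) (DW Q).
Proof. by apply/funext => n; rewrite /DW /addPS map_cat. Qed.

Lemma PS_lin a b c z w : PS (lin_part a b c) z w = a + b * z + c * w.
Proof.
by rewrite PS_fin// /lin_part /ev !big_cons big_nil /=; ring.
Qed.

Lemma PS_DZ_lin a b c z w : PS (DZ (lin_part a b c)) z w = b.
Proof.
by rewrite PS_fin// /DZ /lin_part /ev /= !big_cons big_nil /=; ring.
Qed.

Lemma PS_DW_lin a b c z w : PS (DW (lin_part a b c)) z w = c.
Proof.
by rewrite PS_fin// /DW /lin_part /ev /= !big_cons big_nil /=; ring.
Qed.

End ReinhardtClass.

(** * The curve: regularity, existence of a point, summary *)

Section LabyrinthCurve.
Variable R : realType.
Local Notation C := (cplx R).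
Local Notation F0R := (F0 R).

Lemma convergent_F0 : convergent F0R.
Proof. by move=> n r t r0 t0 K; apply: summ_F0 K; exact: ltW. Qed.

Definition Fabc (a b c : C) := addPS (lin_part a b c) F0R.

Lemma convergent_lin (a b c : C) : convergent (lin_part a b c).
Proof. exact: convergent_fin. Qed.

Lemma convergent_Fabc a b c : convergent (Fabc a b c).
Proof. by apply: convergent_add; [exact: convergent_lin|exact: convergent_F0]. Qed.

Lemma Fabc_val a b c z w : Omega z w ->
  PS (Fabc a b c) z w = a + b * z + c * w + PS F0R z w.
Proof.
move=> O; rewrite PS_add ?PS_lin//; [exact: convergent_lin|exact: convergent_F0].
Qed.

Lemma Fabc_dz a b c z w : Omega z w ->
  PS (DZ (Fabc a b c)) z w = b + PS (DZ F0R) z w.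
Proof.
move=> O; rewrite DZ_add PS_add ?PS_DZ_lin//; apply: convergent_DZ.
  exact: convergent_lin.
exact: convergent_F0.
Qed.

Lemma Fabc_dw a b c z w : Omega z w ->
  PS (DW (Fabc a b c)) z w = c + PS (DW F0R) z w.
Proof.
move=> O; rewrite DW_add PS_add ?PS_DW_lin//; apply: convergent_DW.
  exact: convergent_lin.
exact: convergent_F0.
Qed.

(* A zero [(z, w)] of [a + b z + c w + F0] is singular iff [(a, b, c)] is the
   value at [(z, w)] of a Lipschitz map into C^3. *)
Lemma regular_params (eta : R) : 0 < eta -> exists a b c : C,
  [/\ nc (a - 0) < eta, nc (b - 1) < eta, nc (c - 0) < eta &
  forall z w, Omega z w -> PS (Fabc a b c) z w = 0 ->
    ~ (PS (DZ (Fabc a b c)) z w = 0 /\ PS (DW (Fabc a b c)) z w = 0)].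
Proof.
move=> eta0.
(* Countably many bidiscs with rational radii cover the domain, enumerated by [pickle]; codes of
   unsuitable data get the radius -1, that is, an empty bidisc. *)
pose good (k p q N : nat) := KK k (p.+1%:R / N.+1%:R : R) (q.+1%:R / N.+1%:R).
pose rt (m : nat) : R * R := match unpickle m with
  | Some (k, p, q, N) => if `[< good k p q N >]
       then (p.+1%:R / N.+1%:R, q.+1%:R / N.+1%:R) else (-1, -1)
  | None => (-1, -1) end.
have rtP m : (rt m).1 = -1 \/ [/\ 0 < (rt m).1, 0 < (rt m).2 & exists k, KK k (rt m).1 (rt m).2].
  rewrite /rt; case: (unpickle m) => [[[[k p] q] N]|]; last by left.
  case: asboolP => [g|_]; last by left.
  by right; split; [exact: divr_gt0|exact: divr_gt0|exists k].
have cover z w : Omega z w -> exists m, nc z <= (rt m).1 /\ nc w <= (rt m).2.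
  move=> [k K]; have [e e0 Ke] := KK_widen (nc_ge0 _) (nc_ge0 _) K.
  pose N := Num.trunc e^-1.
  have Ne : N.+1%:R^-1 <= e.
    rewrite -[leRHS]invrK lef_pV2 ?posrE ?invr_gt0//; apply: ltW; exact: truncnS_gt.
  have near (x : R) : 0 <= x -> x <= (Num.trunc (x * N.+1%:R)).+1%:R / N.+1%:R <= x + e.
    move=> x0; have xN : 0 <= x * N.+1%:R by rewrite mulr_ge0.
    have /andP[h1 h2] := truncn_itv xN.
    rewrite ler_pdivlMr// (ltW h2)/= ler_pdivrMr// mulrDl -natr1.
    apply: lerD => //; move: Ne; rewrite -[N.+1%:R^-1]mul1r ler_pdivrMr//.
  set p := Num.trunc (nc z * N.+1%:R); set q := Num.trunc (nc w * N.+1%:R).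
  have /andP[p1 p2] := near _ (nc_ge0 z); have /andP[q1 q2] := near _ (nc_ge0 w).
  have g : good k.+1 p q N.
    by apply: KK_sub Ke; apply/andP; split => //; exact: divr_ge0.
  exists (pickle (k.+1, p, q, N)); by rewrite /rt pickleK; case: asboolP.
(* At a singular zero, [b] and [c] are minus the partial derivatives of [F0], and the equation of
   the curve then reads [a = f z w]. *)
pose f z w := - PS F0R z w + (PS (DZ F0R) z w * z + PS (DW F0R) z w * w).
have lip m : exists2 L : R, 0 <= L & forall z w z' w',
    nc z <= (rt m).1 -> nc w <= (rt m).2 -> nc z' <= (rt m).1 -> nc w' <= (rt m).2 ->
    [/\ nc (f z w - f z' w') <= L * (nc (z - z') + nc (w - w')),
        nc (- PS (DZ F0R) z w - - PS (DZ F0R) z' w') <= L * (nc (z - z') + nc (w - w')) &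
        nc (- PS (DW F0R) z w - - PS (DW F0R) z' w') <= L * (nc (z - z') + nc (w - w'))].
  have [m1|[r0 t0 [k K]]] := rtP m.
    exists 0 => // z w z' w'; rewrite m1 => h.
    by have := nc_ge0 z; move: h; lra.
  set r := (rt m).1 in r0 K *; set t := (rt m).2 in t0 K *.
  have [r1 t1] := KK_le1 (ltW r0) (ltW t0) K.
  have cF := convergent_F0; have cz := convergent_DZ cF; have cw := convergent_DW cF.
  have [L0 L00 h0] := PS_lip cF r0 t0 K.
  have [Lz Lz0 hz] := PS_lip cz r0 t0 K; have [Lw Lw0 hw] := PS_lip cw r0 t0 K.
  have [Bz Bz0 bz] := PS_bd cz r0 t0 K; have [Bw Bw0 bw] := PS_bd cw r0 t0 K.
  pose Dm (z w : C) := nc z <= r /\ nc w <= t.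
  have mz := @mul_lip R (PS (DZ F0R)) (fun z w => z) Dm Bz 1 Lz 1 Bz0 ler01 Lz0 ler01
    (fun z w d => bz z w d.1 d.2) (fun z w d => le_trans d.1 r1)
    (fun z w z' w' d d' => hz z w z' w' d.1 d.2 d'.1 d'.2).
  have mw := @mul_lip R (PS (DW F0R)) (fun z w => w) Dm Bw 1 Lw 1 Bw0 ler01 Lw0 ler01
    (fun z w d => bw z w d.1 d.2) (fun z w d => le_trans d.2 t1)
    (fun z w z' w' d d' => hw z w z' w' d.1 d.2 d'.1 d'.2).
  have {}mz := mz ltac:(by move=> z w z' w' _ _; rewrite mul1r lerDl nc_ge0).
  have {}mw := mw ltac:(by move=> z w z' w' _ _; rewrite mul1r lerDr nc_ge0).
  exists (L0 + (Lz * 1 + Bz * 1) + (Lw * 1 + Bw * 1) + Lz + Lw).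
    by rewrite !addr_ge0 ?mulr1.
  move=> z w z' w' z1 w1 z2 w2.
  have s0 : 0 <= nc (z - z') + nc (w - w') by rewrite addr_ge0 ?nc_ge0.
  have := h0 _ _ _ _ z1 w1 z2 w2; have := hz _ _ _ _ z1 w1 z2 w2.
  have := hw _ _ _ _ z1 w1 z2 w2.
  have := mz z w z' w' (conj z1 w1) (conj z2 w2).
  have := mw z w z' w' (conj z1 w1) (conj z2 w2).
  rewrite /f; move: (PS F0R z w) (PS F0R z' w') (PS (DZ F0R) z w) (PS (DZ F0R) z' w')
    (PS (DW F0R) z w) (PS (DW F0R) z' w') => u u' v v' x x'.
  move: (nc (z - z') + nc (w - w')) s0 => s s0 h1 h2 h3 h4 h5.
  have Q (A B : R) : 0 <= A -> A <= B -> A * s <= B * s.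
    by move=> _ AB; exact: ler_wpM2r.
  split.
  - rewrite (_ : _ - _ = - (u - u') + ((v * z - v' * z') + (x * w - x' * w'))); last by ring.
    have g1 := ncD (- (u - u')) ((v * z - v' * z') + (x * w - x' * w')).
    have g2 := ncD (v * z - v' * z') (x * w - x' * w').
    rewrite ncN in g1; have := mulr_ge0 Lz0 s0; have := mulr_ge0 Lw0 s0; lra.
  - rewrite -opprD ncN; apply: le_trans h4 _; apply: Q => //; lra.
  - rewrite -opprD ncN; apply: le_trans h3 _; apply: Q => //; lra.
have [a [b [c [ha hb hc hg]]]] := generic_params 0 1 0 eta0 lip.
exists a, b, c; split => // z w O; rewrite Fabc_val// Fabc_dz// Fabc_dw//.
move=> E0 [E1 E2]; have [m [zm wm]] := cover z w O.
apply: (hg m z w zm wm).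
have bE := addr0_eq E1; have cE := addr0_eq E2.
split; [|by rewrite -bE opprK|by rewrite -cE opprK].
rewrite /f -bE -cE.
move: E0; move: (PS F0R z w) => u E0.
by rewrite -[RHS]subr0 -E0; ring.
Qed.

Definition deg_ge k (l : seq (C * (nat * nat))) :=
  all (fun u => k <= u.2.1 + u.2.2)%N l.

Lemma ev_00 l : deg_ge 1 l -> ev l 0 0 = 0.
Proof.
rewrite /ev; elim: l => [|[c [i j]] l IH] /=; first by rewrite big_nil.
move=> /andP[h /IH E]; rewrite big_cons E addr0 /= !expr0n.
by case: i h => [|i] /=; case: j => [|j] //=; rewrite ?mulr0 ?mul0r.
Qed.

Lemma PS_00 (P : nat -> seq (C * (nat * nat))) :
  (forall n, deg_ge 1 (P n)) -> PS P 0 0 = 0.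
Proof.
move=> h; have E n : ev (P n) 0 0 = 0 by apply: ev_00; exact: h.
have b : sum_bounded (fun n => ev (P n) 0 0) 0.
  by move=> n; rewrite big1// => i _; rewrite E nc0.
by apply/eqP; rewrite -nc_eq0 eq_le nc_ge0 andbT; exact: csum_le b.
Qed.

Lemma F0_degree n : deg_ge 2 (F0R n).
Proof.
rewrite /deg_ge /F0 all_map; apply/allP => i; rewrite mem_iota => /andP[_ ie] /=.
have [h _ _] := expoP n (AA R n); rewrite -mulnDl subnK//.
by rewrite -[2%N]mul1n leq_mul// edges_gt0.
Qed.

Lemma Omega0 : Omega (0 : C) 0.
Proof.
exists 0%N => i ie; rewrite /gg nc0 !expr0n -mulrA -natrM mulnb.
case: andP => [[h1 /eqP h2]|_]; last by rewrite mulr0.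
by move: h1; rewrite h2 subn0 -leqn0 leqNgt edges_gt0.
Qed.

(** Newton's iteration for [z |-> a + b z + f z 0], started at 0 with slope 1. It applies for [a]
    near 0 and [b] near 1 because [f] has neither a constant term nor a linear term in [z]. *)
Lemma zero_near (f fz fw : C -> C -> C) (d1 L d2 : R) : qder f fz fw 0 0 ->
  0 < d1 -> 0 <= L ->
  (forall z w z' w', nc (z - 0) < d1 -> nc (w - 0) < d1 -> nc (z' - 0) < d1 ->
     nc (w' - 0) < d1 -> nc (fz z' w' - fz z w) <= L * (nc (z' - z) + nc (w' - w))) ->
  f 0 0 = 0 -> fz 0 0 = 0 -> 0 < d2 ->
  exists2 eta : R, 0 < eta & forall a b : C, nc a < eta -> nc (b - 1) < eta ->
  exists z, nc z < d2 /\ a + b * z + f z 0 = 0.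
Proof.
move=> [d d0 [M M0 hM]] d10 L0 hL F00 Fz00 d20.
pose rho := Num.min (Num.min d d1) d2 / 2.
have rho0 : 0 < rho by rewrite divr_gt0// !lt_min d0 d10.
pose rho' := Num.min rho (4 * (2 * M + L + 1))^-1.
have ML : 0 < 4 * (2 * M + L + 1).
  by rewrite mulr_gt0// ltr_wpDl// addr_ge0// mulr_ge0.
have rho'0 : 0 < rho' by rewrite lt_min rho0 invr_gt0.
have rho'1 : rho' * (4 * (2 * M + L + 1)) <= 1.
  by rewrite -ler_pdivlMr// mul1r ge_min lexx orbT.
have : rho' <= rho by rewrite ge_min lexx.
have : rho < Num.min (Num.min d d1) d2.
  by rewrite /rho ltr_pdivrMr// ltr_pMr ?ltr1n// !lt_min d0 d10.
rewrite !lt_min => /andP[/andP[rd rd1] rd2] rr.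
clearbody rho'; clearbody rho.
(* The error of the slope is at most [1 / 4] from [b] and [1 / 4] from [f], by the choice of [rho'];
   [|a| <= rho' / 2] is the starting condition. *)
exists (Num.min (1 / 4) (rho' / 2)); first by rewrite lt_min !divr_gt0.
move=> a b; rewrite !lt_min => /andP[_ ha] /andP[hb _].
pose h z := a + b * z + f z 0.
have [||z] := @solve_near R h 0 1 rho' (oner_neq0 _).
- move=> z z'; rewrite !subr0 => hz hz'; rewrite nc1 mul1r.
  have z00 : nc (0 - 0 : C) < d by rewrite subrr nc0.
  have z01 : nc (0 - 0 : C) < d1 by rewrite subrr nc0.
  have zd (x : C) : nc x <= rho' -> nc (x - 0) < d by rewrite subr0; lra.
  have zd1 (x : C) : nc x <= rho' -> nc (x - 0) < d1 by rewrite subr0; lra.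
  have := hM z' 0 z 0 (zd _ hz') z00 (zd _ hz) z00.
  have := hL 0 0 z' 0 z01 z01 (zd1 _ hz') z01.
  rewrite Fz00 !subrr !subr0 mulr0 subr0 !nc0 !addr0 /h.
  move: (f z 0) (f z' 0) (fz z' 0) => u u' v hv hu.
  rewrite (_ : _ - _ - _ = (b - 1) * (z - z') + ((u - u' - v * (z - z')) + v * (z - z')));
    last by ring.
  have g1 := ncD ((b - 1) * (z - z')) ((u - u' - v * (z - z')) + v * (z - z')).
  have g2 := ncD (u - u' - v * (z - z')) (v * (z - z')).
  apply: le_trans g1 _; rewrite ncM; rewrite ncM in g2.
  have x0 := nc_ge0 (z - z').
  have k1 := ler_wpM2r x0 (ltW hb).
  have k2 : nc v * nc (z - z') <= L * rho' * nc (z - z').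
    by apply: ler_wpM2r => //; apply: le_trans hv _; exact: ler_wpM2l.
  have k3 : M * nc (z - z') ^+ 2 <= M * (2 * rho') * nc (z - z').
    rewrite -mulrA expr2; apply: ler_wpM2l => //; apply: ler_wpM2r => //.
    by have := ncB z z'; lra.
  have k4 := ler_wpM2r x0 rho'1.
  have k5 := mulr_ge0 (ltW rho'0) x0.
  lra.
- by rewrite /h F00 mulr0 !addr0 nc1; lra.
- by rewrite subr0 => hz hz0; exists z; split => //; lra.
Qed.

Lemma zero_exists : exists2 eta : R, 0 < eta & forall a b c : C,
  nc a < eta -> nc (b - 1) < eta ->
  exists z, Omega z 0 /\ PS (Fabc a b c) z 0 = 0.
Proof.
have cF := convergent_F0.
have HolDZ : Hol (PS (DZ F0R)) by exists (DZ F0R) => //; exact: convergent_DZ.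
have [d1 d10 [L L0 hL]] := qder_lip (@Hol_dclosed R) HolDZ Omega0.
have [d2 d20 hO] := Omega_open Omega0.
have F00 : PS F0R 0 0 = 0.
  by apply: PS_00 => n; apply: sub_all (F0_degree n) => u; exact: leq_trans.
have Fz00 : PS (DZ F0R) 0 0 = 0.
  apply: PS_00 => n; rewrite /deg_ge /DZ all_map.
  by apply: sub_all (F0_degree n) => -[? [i j]] /=; lia.
have [eta eta0 h] := zero_near (PS_qder cF Omega0) d10 L0 hL F00 Fz00 d20.
exists eta => // a b c ha hb; have [z [zd E]] := h a b ha hb.
have O : Omega z 0 by apply: hO; rewrite ?subrr ?nc0// subr0.
exists z; split; first exact: O.
rewrite (Fabc_val _ _ _ O); move: E; move: (PS F0R z 0) => u E; rewrite -[RHS]E; ring.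
Qed.

(** All that the geometric part uses of the curve. The family [K] enters by exhausting [Om], by
    keeping limits of points of one [K n] inside [Om], and by bounding how far a path of given
    length can advance. *)
Theorem labyrinth_curve : exists (Om : C -> C -> Prop) (G : set (C -> C -> C))
    (F Fz Fw : C -> C -> C) (K : nat -> C -> C -> Prop),
  [/\ dclosed Om G /\ (forall z0 w0, Om z0 w0 -> exists2 d : R, 0 < d &
        forall z w, nc (z - z0) < d -> nc (w - w0) < d -> Om z w),
      [/\ G F, G Fz, G Fw & forall z w, Om z w -> qder F Fz Fw z w],
      (forall z w, Om z w -> F z w = 0 -> ~ (Fz z w = 0 /\ Fw z w = 0)) /\
      (exists z w, Om z w /\ F z w = 0),
      [/\ forall z w, Om z w -> nc z <= 1 /\ nc w <= 1,
          forall z w, Om z w <-> exists n, K n z w &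
          forall n z w, (forall d : R, 0 < d -> exists z' w', [/\ nc (z' - z) < d,
             nc (w' - w) < d & K n z' w']) -> Om z w] &
      forall n0 (B : R), exists J : nat, forall (z w : R -> C) (len : R -> R),
        continuous (fun s => nc (z s)) -> continuous (fun s => nc (w s)) ->
        (forall s, Om (z s) (w s) /\ F (z s) (w s) = 0) ->
        (forall s s', 0 <= s -> s <= s' -> s' <= 1 ->
           nc (z s - z s') <= len s' - len s /\ nc (w s - w s') <= len s' - len s) ->
        len 1 - len 0 <= B -> K n0 (z 0) (w 0) -> K J (z 1) (w 1)].
Proof.
have [eta eta0 hz] := zero_exists.
have eta1 : 0 < Num.min eta 1 by rewrite lt_min eta0 ltr01.
have [a [b [c [ha hb hc reg]]]] := regular_params eta1.
move: ha hb hc; rewrite !lt_min !subr0 => /andP[ha a1] /andP[hb b1] /andP[hc c1].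
have cP := convergent_Fabc a b c.
exists (@Omega R), (@Hol R), (PS (Fabc a b c)), (PS (DZ (Fabc a b c))),
  (PS (DW (Fabc a b c))), (fun n z w => KK n (nc z) (nc w)).
have lipn (x y : C) : `|nc x - nc y| <= nc (x - y).
  rewrite ler_norml; have := ncD y (x - y); have := ncD x (y - x).
  rewrite ![_ + (_ - _)]addrC !subrK [nc (y - x)]ncBC => h1 h2.
  by apply/andP; split; lra.
split.
- split; [exact: Hol_dclosed|exact: Omega_open].
- split; first by exists (Fabc a b c).
  + by exists (DZ (Fabc a b c)) => //; exact: convergent_DZ.
  + by exists (DW (Fabc a b c)) => //; exact: convergent_DW.
  + by move=> z w; exact: PS_qder.
- split; first exact: reg.
  have [z [dz z0]] := hz a b c ha hb.
  by exists z, 0.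
- split => //; first by move=> z w [n]; apply: KK_le1; exact: nc_ge0.
  move=> n z w h; exists n => i ie; rewrite leNgt; apply/negP => gt.
  (* Points close to [(z, w)] have moduli at least [nc z - s] and [nc w - s]. Truncated at 0, these
     can be compared by [gg_le], so a value of [gg] above 1 persists nearby. *)
  pose a' s := Num.max 0 (nc z - s); pose b' s := Num.max 0 (nc w - s).
  have cm (x : R) : {for (0 : R), continuous (fun s => Num.max 0 (x - s))}.
    apply: (@continuous_max R R (cst 0) (fun s => x - s) 0).
      exact: cst_continuous.
    by apply: continuousB; [exact: cst_continuous|exact: cvg_id].
  have cont : {for (0 : R), continuous (fun s : R => gg n i (a' s) (b' s))}.
    by apply: gg_continuous; exact: cm.
  have gt' : 1 < gg n i (a' 0) (b' 0).
    by rewrite /a' /b' !subr0 !max_r ?nc_ge0.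
  have /nbhs_ballP[d d0 hd] : nbhs (0 : R) [set s | 1 < gg n i (a' s) (b' s)].
    exact: (cont _ (lt_nbhsr gt')).
  have := hd (d / 2); rewrite -ball_normE/= sub0r normrN gtr0_norm ?divr_gt0//.
  rewrite ltr_pdivrMr// ltr_pMr// ltr1n => /(_ isT).
  have [z' [w' [hz' hw' /(_ i ie)]]] := h _ (divr_gt0 d0 (ltr0Sn R 1)).
  move=> le1; apply/negP; rewrite -leNgt; apply: le_trans le1; apply: gg_le.
    rewrite le_max lexx ge_max nc_ge0/=; move: (lipn z' z); rewrite ler_norml => /andP[].
    by lra.
  rewrite le_max lexx ge_max nc_ge0/=; move: (lipn w' w); rewrite ler_norml => /andP[].
  by lra.
move=> n0 B; have [J [_ hJ]] := labyrinth n0 B; exists J.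
move=> z w len cz cw hO hl hB K0; apply: (hJ (fun s => nc (z s)) (fun s => nc (w s)) len) => //=.
- by move=> s; exact: nc_ge0.
- by move=> s; exact: nc_ge0.
- move=> s s' h1 h2 h3; have [k1 k2] := hl s s' h1 h2 h3.
  by split; [apply: le_trans (lipn _ _) k1|apply: le_trans (lipn _ _) k2].
(* At a boundary point outside the gates [|F0| >= 7] by [wall], while on the curve
   [|F0| = |a + b z + c w|], which is at most [1 + 2 + 1]. *)
- move=> n s i Ks ie gi; apply: contrapT => ng.
  have := wall Ks ie gi ng; have [dO Fs] := hO s.
  move: Fs; rewrite Fabc_val//; move: (PS F0R (z s) (w s)) => u E h.
  have [z1 w1] := KK_le1 (nc_ge0 _) (nc_ge0 _) Ks.
  have uE : u = - (a + b * z s + c * w s) by apply/eqP; rewrite -addr_eq0 addrC E.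
  move: h; rewrite uE ncN; apply/negP; rewrite -ltNge.
  have g1 := ncD (a + b * z s) (c * w s); have g2 := ncD a (b * z s).
  rewrite !ncM in g1 g2.
  have b2 : nc b <= 2.
    by have := ncD (b - 1) 1; rewrite subrK nc1; lra.
  have g3 : nc b * nc (z s) <= 2 * 1 by apply: ler_pM; rewrite ?nc_ge0.
  have g4 : nc c * nc (w s) <= 1 * 1 by apply: ler_pM; rewrite ?nc_ge0// ltW.
  lra.
Qed.

End LabyrinthCurve.

(** * The manifold *)

Section Differentials.
Variable R : realType.
Local Notation C := (cplx R).

Lemma mx_entry_le m n (x : 'M[C]_(m, n)) i j : `|x i j| <= `|x|.
Proof. by rewrite -[leLHS]nngE num_le; exact: (le_bigmax _ (fun ij => `|x ij.1 ij.2|%:nng) (i, j)). Qed.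

Lemma mx_norm_le m n (x : 'M[C]_(m, n)) (c : C) : 0 <= c ->
  (forall i j, `|x i j| <= c) -> `|x| <= c.
Proof.
move=> c0 h; change (mx_norm x <= (NngNum c0)%:num).
by rewrite mx_normE [_ <= _%:num]num_le; apply/bigmax_leP; split=> [|[i j] _]//; exact: h.
Qed.

(** The index [a] numbers the components of the map applied to one factor, [j] the factors of the
    product. *)
Definition mkv d k (f : 'I_d -> 'I_k -> C) : 'rV[C]_(d * k) :=
  mxvec (\matrix_(a, j) f a j).

Definition ent d k (p : 'rV[C]_(d * k)) (a : 'I_d) (j : 'I_k) : C :=
  p 0 (mxvec_index a j).

Lemma ent_mkv d k (f : 'I_d -> 'I_k -> C) a j : ent (mkv f) a j = f a j.
Proof. by rewrite /ent /mkv mxvecE mxE. Qed.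

Lemma ent_ext d k (p q : 'rV[C]_(d * k)) :
  (forall a j, ent p a j = ent q a j) -> p = q.
Proof. by move=> h; apply/rowP => i; case/mxvec_indexP: i => a j; exact: h. Qed.

Lemma nbhs_ent d k (p : 'rV[C]_(d * k)) (A : set 'rV[C]_(d * k)) :
  nbhs p A <-> exists2 e : R, 0 < e & forall q : 'rV[C]_(d * k),
    (forall a j, nc (ent q a j - ent p a j) < e) -> A q.
Proof.
rewrite nbhs_rVcplx; split=> -[e e0 h]; exists e => // q hq; apply: h.
  by move=> i; case/mxvec_indexP: i => a j; exact: hq.
by move=> a j; exact: hq.
Qed.

Lemma hder_quad_near f z a (e : R) : 0 < e -> hder f z a ->
  exists2 d : R, 0 < d & forall h : C, nc h < d ->
    nc (f (h + z) - f z - a * h) <= e * nc h.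
Proof.
move=> e0 [d d0 [M M0 hM]].
exists (Num.min d (e / (M + 1))); first by rewrite lt_min d0 divr_gt0// ltr_wpDl.
move=> h; rewrite lt_min => /andP[hd he].
have := hM (h + z); rewrite addrK => /(_ hd) hh; apply: le_trans hh _.
rewrite expr2 mulrA; apply: ler_wpM2r; first exact: nc_ge0.
move: he; rewrite ltr_pdivlMr ?ltr_wpDl//; have := nc_ge0 h; nra.
Qed.

(** The form of every chart expression below: in a product of curves each component depends on the
    parameter of a single factor. *)
Lemma diff_coords n k (c : 'I_n -> 'I_k) (f : 'rV[C]_k -> 'rV[C]_n)
    (psi : 'I_n -> C -> C) (D : 'I_n -> C) (z : 'rV[C]_k) :
  (\forall v \near z, f v = \row_l psi l (v 0 (c l))) ->
  (forall l, hder (psi l) (z 0 (c l)) (D l)) ->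
  differentiable f z /\
  forall h, 'd f z h = \row_l (D l * h 0 (c l)).
Proof.
move=> fE hD.
pose A : 'M[C]_(k, n) := \matrix_(i, l) (D l * (i == c l)%:R).
have AE' (h : 'rV[C]_k) : h *m A = \row_l (D l * h 0 (c l)).
  apply/rowP => l; rewrite !mxE (bigD1 (c l))//= big1 ?addr0.
    by rewrite mxE eqxx mulr1 mulrC.
  by move=> i ij; rewrite mxE (negbTE ij) !mulr0.
have AE h : mulmxr A h = \row_l (D l * h 0 (c l)) := AE' h.
have cA : continuous (mulmxr A : 'rV[C]_k -> 'rV[C]_n).
  move=> x U /= /nbhs_rVcplx[e e0 eU]; apply/nbhs_rVcplx.
  pose B := 1 + \sum_l nc (D l).
  have B0 : 0 < B by rewrite ltr_wpDr// sumr_ge0// => l _; exact: nc_ge0.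
  exists (e / B); first exact: divr_gt0.
  move=> y xy; apply: eU => l; rewrite ?AE ?AE' !mxE -mulrBr ncM.
  have DB : nc (D l) <= B.
    rewrite /B (bigD1 l)//= addrCA lerDl addr_ge0//.
    by apply: sumr_ge0 => *; exact: nc_ge0.
  apply: (@le_lt_trans _ _ (B * nc (y 0 (c l) - x 0 (c l)))).
    by apply: ler_wpM2r => //; exact: nc_ge0.
  by rewrite mulrC -ltr_pdivlMr.
have fz : f z = \row_l psi l (z 0 (c l)) by exact: (nbhs_singleton fE).
pose L : {linear 'rV[C]_k -> 'rV[C]_n} := mulmxr A.
suff key : f \o shift z = cst (f z) + (L : 'rV[C]_k -> 'rV[C]_n) +o_ (0 : 'rV[C]_k) id.
  have dE : 'd f z = L :> ('rV[C]_k -> 'rV[C]_n) by exact: diff_unique cA key.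
  split; last by move=> h; rewrite dE -AE.
  by apply/diff_locallyP; rewrite dE.
apply/eqaddoP => eps /ltc_real[e e0 ->].
have /nbhs_rVcplx[d1 d10 near1] := fE.
have [dd dd0 near2] : exists2 dd : R, 0 < dd & forall l h, nc h < dd ->
    nc (psi l (h + z 0 (c l)) - psi l (z 0 (c l)) - D l * h) <= e * nc h.
  have ex l : exists dd : R, 0 < dd /\ forall h, nc h < dd ->
    nc (psi l (h + z 0 (c l)) - psi l (z 0 (c l)) - D l * h) <= e * nc h.
    by have [dd ? ?] := hder_quad_near e0 (hD l); exists dd.
  pose g l := projT1 (cid (ex l)).
  have gP l : 0 < g l /\ forall h, nc h < g l ->
    nc (psi l (h + z 0 (c l)) - psi l (z 0 (c l)) - D l * h) <= e * nc h.
    by rewrite /g; case: cid.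
  exists (\big[Num.min/1]_l g l).
    by apply: (big_ind (fun y => 0 < y)) => // [x y x0 y0|l _];
      [rewrite lt_min x0|exact: (gP l).1].
  move=> l h hh; have [_] := gP l; apply => //.
  by apply: lt_le_trans hh _; exact: bigmin_le_cond.
apply/nbhs_rVcplx; exists (Num.min d1 dd); first by rewrite lt_min d10.
move=> h hh; apply: mx_norm_le.
  by rewrite mulr_ge0 ?normr_ge0// ltW// (@ltcR R 0).
move=> i l; rewrite ord1.
have hj := hh (c l); rewrite mxE subr0 lt_min in hj; have /andP[hj1 hj2] := hj.
have -> : (f \o shift z - (cst (f z) + (L : 'rV[C]_k -> 'rV[C]_n))) h 0 l =
    psi l (h 0 (c l) + z 0 (c l)) - psi l (z 0 (c l)) - D l * h 0 (c l).
  transitivity (f (h + z) 0 l - (f z 0 l + (mulmxr A h) 0 l)).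
    by rewrite !mxE.
  rewrite near1; last first.
    by move=> j'; have := hh j'; rewrite !mxE subr0 addrK lt_min => /andP[].
  by rewrite fz ?AE ?AE' !mxE opprD addrA.
apply: (@le_trans _ _ (e%:C%C * `|h 0 (c l)|)); last first.
  apply: ler_wpM2l; last exact: mx_entry_le.
  by rewrite (@lecR R 0) ltW.
rewrite -!nc_norm -(rmorphM (real_complex R)) (@lecR R).
exact: near2.
Qed.

Definition mxdec d k (l : 'I_(d * k)) : 'I_d * 'I_k :=
  enum_val (cast_ord (esym (mxvec_cast d k)) l).

Lemma mxdecK d k (a : 'I_d) (j : 'I_k) : mxdec (mxvec_index a j) = (a, j).
Proof. by rewrite /mxdec /mxvec_index cast_ordK enum_rankK. Qed.

Lemma diff_mkv d k (f : 'rV[C]_k -> 'rV[C]_(d * k)) (psi : 'I_d -> 'I_k -> C -> C)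
    (D : 'I_d -> 'I_k -> C) (z : 'rV[C]_k) :
  (\forall v \near z, f v = mkv (fun a j => psi a j (v 0 j))) ->
  (forall a j, hder (psi a j) (z 0 j) (D a j)) ->
  differentiable f z /\
  forall h, 'd f z h = mkv (fun a j => D a j * h 0 j).
Proof.
move=> fE hD.
have E (g : 'I_d -> 'I_k -> C) :
    mkv g = \row_l g (mxdec l).1 (mxdec l).2.
  apply: ent_ext => a j; rewrite ent_mkv /ent mxE mxdecK//.
have [||df dE] := @diff_coords (d * k) k (fun l => (mxdec l).2) f
  (fun l => psi (mxdec l).1 (mxdec l).2) (fun l => D (mxdec l).1 (mxdec l).2) z.
- by apply: filterS fE => v ->; rewrite E.
- by move=> l; exact: hD.
- by split => // h; rewrite dE E.
Qed.

End Differentials.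

(** * Charts on a component of the product of curves *)

Section CurveProduct.
Variables (R : realType) (k : nat).
Local Notation C := (cplx R).
Local Notation T := 'rV[C]_(2 * k).

Lemma hder_cont f z a (e : R) : hder f z a -> 0 < e ->
  exists2 d : R, 0 < d & forall z' : C, nc (z' - z) < d -> nc (f z' - f z) < e.
Proof.
move=> /hder_lip[d d0 [L L0 h]] e0; exists (Num.min d (e / (L + 1))).
  by rewrite lt_min d0 divr_gt0// ltr_wpDl.
move=> z'; rewrite lt_min => /andP[/h h1]; rewrite ltr_pdivlMr ?ltr_wpDl// => h2.
by apply: le_lt_trans h1 _; have := nc_ge0 (z' - z); lra.
Qed.

Definition ib (b : bool) : 'I_2 := if b then ord_max else ord0.
Definition crd (p : T) (j : 'I_k) (b : bool) : C := ent p (ib b) j.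
Definition mk (f : 'I_k -> bool -> C) : T := mkv (fun a j => f j (a == ord_max)).

Lemma crd_mk f j b : crd (mk f) j b = f j b.
Proof. by rewrite /crd /mk ent_mkv; case: b. Qed.

Lemma crd_ext p q : (forall j b, crd p j b = crd q j b) -> p = q.
Proof.
move=> h; apply: ent_ext => a j.
have [->|->] : a = ib false \/ a = ib true; [|exact: h|exact: h].
by case: a => -[|[|//]] i; [left|right]; exact/val_inj.
Qed.

Lemma nbhs_crd (p : T) (A : set T) :
  nbhs p A <-> exists2 e : R, 0 < e & forall q : T,
    (forall j b, nc (crd q j b - crd p j b) < e) -> A q.
Proof.
rewrite nbhs_ent; split=> -[e e0 h]; exists e => // q hq; apply: h.
  move=> a j; have [->|->] : a = ib false \/ a = ib true; [|exact: hq|exact: hq].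
  by case: a => -[|[|//]] i; [left|right]; exact/val_inj.
by move=> j b; exact: hq.
Qed.

(* [c = (e, phi, (r, rho))] as provided by [curve_chart]. *)
Definition local_chart (Gam : (bool -> C) -> Prop) (q : bool -> C)
    (c : bool * (bool -> C -> C) * (R * R)) :=
  [/\ 0 < c.2.1 <= c.2.2, forall v, c.1.2 c.1.1 v = v,
      forall n b, smooth n [set v | nc (v - q c.1.1) < c.2.1] (c.1.2 b),
      forall v, nc (v - q c.1.1) < c.2.1 -> Gam (c.1.2^~ v) /\
         forall b, nc (c.1.2 b v - q b) < c.2.2 &
      forall q' : bool -> C, Gam q' -> nc (q' c.1.1 - q c.1.1) < c.2.1 ->
        (forall b, nc (q' b - q b) < c.2.2) -> forall b, q' b = c.1.2 b (q' c.1.1)].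

Variable Gam : (bool -> C) -> Prop.
Hypothesis hchart : forall q, Gam q -> exists c, local_chart Gam q c.

Definition prodS : set T := [set p | forall j, Gam (crd p j)].

Variable p0 : T.
Definition comp : set T := connected_component prodS p0.
Hypothesis Sp0 : prodS p0.

Lemma compS p : comp p -> prodS p.
Proof. exact: connected_component_sub. Qed.

Definition Mt : topologicalType := comp.

Definition mval (x : Mt) : T := set_val x.

Lemma mvalP (x : Mt) : comp (mval x). Proof. exact: set_valP. Qed.

Lemma mval_inj : injective mval. Proof. exact: val_inj. Qed.

Definition mc (x : Mt) j b : C := crd (mval x) j b.

Lemma mc_ext x y : (forall j b, mc x j b = mc y j b) -> x = y.
Proof. by move=> h; apply: mval_inj; apply: crd_ext. Qed.

Lemma mcG x j : Gam (mc x j). Proof. exact: (compS (mvalP x)). Qed.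

Lemma mval_continuous : continuous mval.
Proof. exact: initial_continuous. Qed.

Lemma nbhs_M (x : Mt) (A : set Mt) :
  nbhs x A <-> exists2 e : R, 0 < e & forall y : Mt,
    (forall j b, nc (mc y j b - mc x j b) < e) -> A y.
Proof.
split=> [|[e e0 eA]].
  rewrite nbhsE => -[B [[V oV VB] Bx] BA].
  have : nbhs (mval x) V by apply: open_nbhs_nbhs; split => //; move: Bx; rewrite -VB.
  move=> /nbhs_crd[e e0 eO]; exists e => // y xy; apply: BA; rewrite -VB; exact: eO.
have h1 : nbhs (mval x) [set q | forall j b, nc (crd q j b - mc x j b) < e].
  by apply/nbhs_crd; exists e.
have h2 : nbhs x (mval @^-1` [set q | forall j b, nc (crd q j b - mc x j b) < e]).
  exact: mval_continuous h1.
by apply: (@filterS _ (nbhs x) _ _ _ _ h2) => y; exact: eA.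
Qed.

(** The inverse of a chart has to be a total function; [x] is its default outside the component. *)
Definition toM (x : Mt) (p : T) : Mt :=
  match pselect (comp p) with left h => SigSub (mem_set h) | right _ => x end.

Lemma toMK x p : comp p -> mval (toM x p) = p.
Proof. by move=> h; rewrite /toM; case: pselect. Qed.

Definition ld (x : Mt) j := projT1 (cid (hchart (mcG x j))).
Definition ce x j := (ld x j).1.1.
Definition cphi x j b v := (ld x j).1.2 b v.
Definition cr x j := (ld x j).2.1.
Definition crho x j := (ld x j).2.2.

Lemma ldP x j : local_chart Gam (mc x j) (ld x j).
Proof. by rewrite /ld; case: cid. Qed.

Definition lpoint x (v : 'rV[C]_k) : T := mk (fun j b => cphi x j b (v 0 j)).

Definition lbox x : set 'rV[C]_k :=
  [set v | forall j, nc (v 0 j - mc x j (ce x j)) < cr x j].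

Lemma cphi_center x j b : cphi x j b (mc x j (ce x j)) = mc x j b.
Proof.
have [/andP[r0 rr] _ _ _ u] := ldP x j; apply/esym; apply: u.
- exact: mcG.
- by rewrite subrr nc0.
- by move=> b'; rewrite subrr nc0; exact: lt_le_trans rr.
Qed.

Lemma cphi_hder x j b v : nc (v - mc x j (ce x j)) < cr x j ->
  exists a, hder (cphi x j b) v a.
Proof.
move=> h; have [_ _ s _ _] := ldP x j; have [f' hf _] := s 1%N b.
by exists (f' v); exact: hf.
Qed.

(** The segment of parameters from the centre to [v] has a connected image in the product, and this
    image contains the point [x]. *)
Lemma lpoint_comp x v : lbox x v -> comp (lpoint x v).
Proof.
move=> bv.
pose c (s : R) : 'rV[C]_k := \row_j (mc x j (ce x j) + s%:C%C * (v 0 j - mc x j (ce x j))).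
have cb s : 0 <= s <= 1 -> lbox x (c s).
  move=> /andP[s0 s1] j; rewrite mxE addrAC subrr add0r ncM nc_real ger0_norm//.
  by apply: le_lt_trans (bv j); rewrite ler_piMl ?nc_ge0.
pose A := [set lpoint x (c s) | s in `[0, 1]%classic].
have Ax : A (mval x).
  exists 0; first by rewrite /= in_itv/= lexx ler01.
  apply: crd_ext => j b; rewrite crd_mk mxE mul0r addr0; exact: cphi_center.
have AS : A `<=` prodS.
  move=> _ [s + <-] j; rewrite /= in_itv/= => /cb/(_ j) hs.
  have [_ _ _ G _] := ldP x j; have [Gs _] := G _ hs.
  by rewrite (_ : crd _ _ = fun b => cphi x j b (c s 0 j))//; apply/funext => b; rewrite crd_mk.
have Ac : connected A.
  apply: connected_continuous_connected; first exact: segment_connected.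
  apply/subspace_continuousP => s; rewrite /= in_itv/= => hs U /nbhs_crd[e e0 eU].
  have ex j b : exists d : R, 0 < d /\ forall z', nc (z' - c s 0 j) < d ->
     nc (cphi x j b z' - cphi x j b (c s 0 j)) < e.
    have [a ha] := cphi_hder b (cb s hs j).
    by have [d ? ?] := hder_cont ha e0; exists d.
  pose g (jb : 'I_k * bool) := projT1 (cid (ex jb.1 jb.2)).
  have gP jb : 0 < g jb /\ forall z', nc (z' - c s 0 jb.1) < g jb ->
     nc (cphi x jb.1 jb.2 z' - cphi x jb.1 jb.2 (c s 0 jb.1)) < e.
    by rewrite /g; case: cid.
  pose d := \big[Num.min/1]_jb g jb.
  have d0 : 0 < d.
    by apply: (big_ind (fun y => 0 < y)) => // [u w u0 w0|jb _];
      [rewrite lt_min u0|exact: (gP jb).1].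
  pose B := 1 + \sum_j nc (v 0 j - mc x j (ce x j)).
  have B0 : 0 < B by rewrite ltr_wpDr// sumr_ge0// => *; exact: nc_ge0.
  apply/nbhs_ballP; exists (d / B); first exact: divr_gt0.
  move=> s' hs' _; apply: eU => j b; rewrite !crd_mk.
  have [_] := gP (j, b); apply => /=.
  apply: (@lt_le_trans _ _ d); last exact: bigmin_le_cond.
  rewrite !mxE opprD addrACA subrr add0r -mulrBl -(rmorphB (real_complex R)) ncM nc_real.
  move: hs'; rewrite -ball_normE/= distrC ltr_pdivlMr// => hs'.
  apply: le_lt_trans hs'; apply: ler_wpM2l => //.
  by rewrite /B (bigD1 j)//= addrCA lerDl addr_ge0// sumr_ge0// => *; exact: nc_ge0.
have : A `<=` comp.
  have -> : comp = connected_component prodS (mval x).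
    by apply: same_connected_component; exact: mvalP.
  exact: connected_component_max.
apply; exists 1; first by rewrite /= in_itv/= lexx ler01.
apply: crd_ext => j b; rewrite !crd_mk mxE mul1r addrCA subrr addr0//.
Qed.

(** The bound [crho] on all coordinates selects the sheet on which the implicit function gives the
    only solution. *)
Definition cdom (x : Mt) : set Mt := [set y |
  (forall j, nc (mc y j (ce x j) - mc x j (ce x j)) < cr x j) /\
  (forall j b, nc (mc y j b - mc x j b) < crho x j)].

Definition cmap (x : Mt) (y : Mt) : 'rV[C]_k := \row_j mc y j (ce x j).

Definition cinv (x : Mt) (v : 'rV[C]_k) : Mt := toM x (lpoint x v).

Lemma mc_cinv x v j b : lbox x v -> mc (cinv x v) j b = cphi x j b (v 0 j).
Proof. by move=> h; rewrite /mc /cinv toMK ?crd_mk//; exact: lpoint_comp. Qed.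

Lemma cmap_cinv x v : lbox x v -> cmap x (cinv x v) = v.
Proof.
move=> h; apply/rowP => j; rewrite mxE mc_cinv//.
by have [_ E _ _ _] := ldP x j; exact: E.
Qed.

Lemma cdom_cinv x v : lbox x v -> cdom x (cinv x v).
Proof.
move=> h; split=> j; first by have := h j; rewrite -[in X in X -> _](cmap_cinv h) mxE.
move=> b; rewrite mc_cinv//; have [_ _ _ g _] := ldP x j; exact: (g _ (h j)).2.
Qed.

Lemma cmap_box x y : cdom x y -> lbox x (cmap x y).
Proof. by move=> [h _] j; rewrite mxE. Qed.

Lemma cinv_cmap x y : cdom x y -> cinv x (cmap x y) = y.
Proof.
move=> d; apply: mc_ext => j b; rewrite mc_cinv; last exact: cmap_box.
rewrite mxE; have [_ _ _ _ u] := ldP x j; apply/esym; apply: u; first exact: mcG.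
  exact: d.1.
by move=> b'; exact: d.2.
Qed.

Lemma cimg x : cmap x @` cdom x = lbox x.
Proof.
apply/seteqP; split=> [_ [y dy <-]|v bv]; first exact: cmap_box.
by exists (cinv x v); [exact: cdom_cinv|exact: cmap_cinv].
Qed.

Lemma lbox_open x : open (lbox x).
Proof.
rewrite openE => v bv; apply/nbhs_rVcplx.
pose e := \big[Num.min/1]_j (cr x j - nc (v 0 j - mc x j (ce x j))).
exists e.
  apply: (big_ind (fun y => 0 < y)) => // [u w u0 w0|j _]; first by rewrite lt_min u0.
  by rewrite subr_gt0; exact: bv.
move=> q hq j; have : e <= cr x j - nc (v 0 j - mc x j (ce x j)) by exact: bigmin_le_cond.
have := hq j; have := ncD (q 0 j - v 0 j) (v 0 j - mc x j (ce x j)).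
by rewrite addrA subrK; lra.
Qed.

Lemma cdom_open x : open (cdom x).
Proof.
rewrite openE => y [d1 d2]; apply/nbhs_M.
pose e := Num.min (\big[Num.min/1]_j (cr x j - nc (mc y j (ce x j) - mc x j (ce x j))))
  (\big[Num.min/1]_jb (crho x jb.1 - nc (mc y jb.1 jb.2 - mc x jb.1 jb.2))).
exists e.
  rewrite /e lt_min; apply/andP; split;
  apply: (big_ind (fun y => 0 < y)) => // [u w u0 w0|j _]; rewrite ?lt_min ?u0// subr_gt0;
    [exact: d1|exact: d2].
move=> q hq; split=> [j|j b].
  have : e <= cr x j - nc (mc y j (ce x j) - mc x j (ce x j)).
    by rewrite /e ge_min; apply/orP; left; exact: bigmin_le_cond.
  have := hq j (ce x j).
  have := ncD (mc q j (ce x j) - mc y j (ce x j)) (mc y j (ce x j) - mc x j (ce x j)).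
  by rewrite addrA subrK; lra.
have : e <= crho x j - nc (mc y j b - mc x j b).
  rewrite /e ge_min; apply/orP; right.
  exact: (bigmin_le_cond _ (fun jb => crho x jb.1 - nc (mc y jb.1 jb.2 - mc x jb.1 jb.2))
    (j := (j, b))).
have := hq j b; have := ncD (mc q j b - mc y j b) (mc y j b - mc x j b).
by rewrite addrA subrK; lra.
Qed.

Lemma cmap_continuous x : {within cdom x, continuous (cmap x)}.
Proof.
apply/subspace_continuousP => y _ U /nbhs_rVcplx[e e0 eU]; apply/nbhs_M.
by exists e => // q hq _; apply: eU => j; rewrite !mxE.
Qed.

Lemma cinv_continuous x : {within cmap x @` cdom x, continuous (cinv x)}.
Proof.
rewrite cimg; apply/subspace_continuousP => v bv U /nbhs_M[e e0 eU].
have ex j b : exists d : R, 0 < d /\ forall z', nc (z' - v 0 j) < d ->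
   nc (cphi x j b z' - cphi x j b (v 0 j)) < e.
  have [a ha] := cphi_hder b (bv j).
  by have [d ? ?] := hder_cont ha e0; exists d.
pose g (jb : 'I_k * bool) := projT1 (cid (ex jb.1 jb.2)).
have gP jb : 0 < g jb /\ forall z', nc (z' - v 0 jb.1) < g jb ->
   nc (cphi x jb.1 jb.2 z' - cphi x jb.1 jb.2 (v 0 jb.1)) < e.
  by rewrite /g; case: cid.
apply/nbhs_rVcplx; exists (\big[Num.min/1]_jb g jb).
  by apply: (big_ind (fun y => 0 < y)) => // [u w u0 w0|jb _];
    [rewrite lt_min u0|exact: (gP jb).1].
move=> q hq bq; apply: eU => j b; rewrite !mc_cinv//.
have [_] := gP (j, b); apply => /=.
by apply: lt_le_trans (hq j) _; exact: bigmin_le_cond.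
Qed.

Lemma cimg_open x : open (cmap x @` cdom x).
Proof. by rewrite cimg; exact: lbox_open. Qed.

Definition pchart (x : Mt) : chart R k Mt :=
  @Chart R k Mt (cdom x) (cmap x) (cinv x) (@cdom_open x)
    (@cimg_open x) (@cinv_cmap x) (@cmap_continuous x) (@cinv_continuous x).

End CurveProduct.
Arguments mval {R k Gam p0} x.

Section CurveProductManifold.
Variables (R : realType) (k : nat).
Local Notation C := (cplx R).
Variable Gam : (bool -> C) -> Prop.
Hypothesis hchart : forall q, Gam q -> exists c, local_chart Gam q c.
Variable p0 : 'rV[C]_(2 * k).
Hypothesis Sp0 : prodS Gam p0.
Local Notation M := (Mt Gam p0).
Local Notation pchart := (pchart hchart (p0 := p0)).

Lemma M_nonempty : [set: M] !=set0.
Proof.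
have h : comp Gam p0 p0 by exact: connected_component_refl.
by exists (SigSub (mem_set h)).
Qed.

(** [mval] carries a clopen subset of the subtype to a relatively clopen subset of the component. *)
Lemma M_connected : connected [set: M].
Proof.
move=> B [b Bb] [U oU BU] [V cV BV].
have [U' oU' UU'] : exists2 U', open U' & mval @^-1` U' = U by case: oU => W oW <-; exists W.
have [V' oV' VV'] : exists2 V', open V' & mval @^-1` V' = ~` V.
  by have := closed_openC cV; case=> W oW <-; exists W.
have E : mval @` B = comp Gam p0.
  apply: (@component_connected _ (prodS Gam) p0).
  - by exists (mval b), b.
  - exists U' => //; apply/seteqP; split=> [_ [y By <-]|q [Dq Uq]].
      split; first exact: mvalP.
      by move: By; rewrite BU -UU' => -[].
    exists (SigSub (mem_set Dq)) => //; rewrite BU -UU'; split => //.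
  - exists (~` V'); first exact: open_closedC.
    apply/seteqP; split=> [_ [y By <-]|q [Dq Vq]].
      split; first exact: mvalP.
      move: By; rewrite BV => -[_ Vy] V'y.
      have : (mval @^-1` V') y by [].
      by rewrite VV'.
    exists (SigSub (mem_set Dq)) => //; rewrite BV; split => //.
    apply: contrapT => nV; have : (~` V) (SigSub (mem_set Dq)) by [].
    by rewrite -VV'.
apply/seteqP; split=> // y _.
have : (mval @` B) (mval y) by rewrite E; exact: mvalP.
by move=> [y' By' /mval_inj <-].
Qed.

Lemma M_hausdorff : hausdorff_space M.
Proof.
move=> p q h; apply: mc_ext => j b; apply/eqP; rewrite -subr_eq0 -nc_eq0.
rewrite eq_le nc_ge0 andbT; apply/ler_addgt0Pr => e e0; rewrite add0r.
have e20 : 0 < e / 2 by rewrite divr_gt0.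
have [||y [h1 h2]] := h [set y | forall j b, nc (mc y j b - mc p j b) < e / 2]
  [set y | forall j b, nc (mc y j b - mc q j b) < e / 2].
- by apply/nbhs_M; exists (e / 2).
- by apply/nbhs_M; exists (e / 2).
rewrite (_ : _ - _ = (mc y j b - mc q j b) - (mc y j b - mc p j b)); last by ring.
apply: le_trans (ncB _ _) _; have := h1 j b; have := h2 j b; lra.
Qed.

Lemma M_second_countable : @second_countable M.
Proof.
pose ctr (c : {ffun 'I_k * bool -> rat * rat}) j b : C :=
  (ratr (c (j, b)).1 +i* ratr (c (j, b)).2)%C.
pose U (cn : {ffun 'I_k * bool -> rat * rat} * nat) : set M :=
  [set y | forall j b, nc (mc y j b - ctr cn.1 j b) < cn.2.+1%:R^-1].
exists (range U).
  by apply: (sub_countable (card_image_le _ _)); exact: countableP.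
split.
  move=> _ [[c n] _ <-]; rewrite openE => y hy; apply/nbhs_M.
  exists (\big[Num.min/1]_jb (n.+1%:R^-1 - nc (mc y jb.1 jb.2 - ctr c jb.1 jb.2))).
    apply: (big_ind (fun y => 0 < y)) => // [u w u0 w0|jb _]; first by rewrite lt_min u0.
    by rewrite subr_gt0; exact: hy.
  move=> z hz j b; have := ncD (mc z j b - mc y j b) (mc y j b - ctr c j b).
  have h1 : \big[Num.min/1]_jb (n.+1%:R^-1 - nc (mc y jb.1 jb.2 - ctr c jb.1 jb.2)) <=
     n.+1%:R^-1 - nc (mc y j b - ctr c j b).
    exact: (bigmin_le_cond _ (fun jb => n.+1%:R^-1 - nc (mc y jb.1 jb.2 - ctr c jb.1 jb.2))
      (j := (j, b))).
  have := hz j b; rewrite /= addrA subrK; move: (n.+1%:R^-1) h1 => v; lra.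
move=> x A /nbhs_M[e e0 eA].
pose n := Num.trunc (2 / e).
have n0 : 0 < n.+1%:R^-1 :> R by rewrite invr_gt0.
have ne : 2 * n.+1%:R^-1 <= e.
  rewrite ler_pdivrMr// mulrC -ler_pdivrMr//; apply: ltW; exact: truncnS_gt.
have [v vE] : exists v : R, v = n.+1%:R^-1 by exists n.+1%:R^-1.
rewrite -vE in n0 ne.
have ex (y : R) : exists q : rat, `|y - ratr q| < v / 2.
  have [q] := @rat_in_itvoo R (y - v / 2) (y + v / 2)
    ltac:(by move: n0; lra).
  rewrite in_itv/= => /andP[q1 q2]; exists q.
  by rewrite ltr_norml; apply/andP; split; lra.
pose c : {ffun 'I_k * bool -> rat * rat} := [ffun jb =>
  (projT1 (cid (ex (complex.Re (mc x jb.1 jb.2)))),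
   projT1 (cid (ex (complex.Im (mc x jb.1 jb.2)))))].
have cP j b : nc (mc x j b - ctr c j b) < v.
  apply: le_lt_trans (nc_ReIm _) _; rewrite [ltRHS]splitr cReD cImD cReN cImN /ctr /c !ffunE /=.
  by apply: ltrD; case: cid.
exists (U (c, n)).
  split; first by exists (c, n).
  by move=> j b; rewrite -vE; exact: cP.
move=> y hy; apply: eA => j b.
rewrite (_ : _ - _ = (mc y j b - ctr c j b) - (mc x j b - ctr c j b)); last by ring.
apply: le_lt_trans (ncB _ _) _; have := hy j b; have := cP j b.
by rewrite /= -vE; lra.
Qed.

Definition M_atlas : set (chart R k M) := range pchart.

Lemma M_cover (p : M) : exists c, M_atlas c /\ chart_dom c p.
Proof.
exists (pchart p); split; first by exists p.
have rp j := ldP hchart p j.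
split=> [j|j b]; rewrite subrr nc0; have [/andP[r0 rr] _ _ _ _] := rp j => //.
exact: lt_le_trans rr.
Qed.

Lemma lbox_near (x : M) v : lbox hchart x v -> \forall v' \near v, lbox hchart x v'.
Proof. by move=> h; apply: open_nbhs_nbhs; split => //; exact: lbox_open. Qed.

Lemma M_holomorphic c c' : M_atlas c -> M_atlas c' -> holomorphic_transition c c'.
Proof.
move=> [x _ <-] [x' _ <-] p dp dp'.
have bp : lbox hchart x (cmap hchart x p) by exact: cmap_box.
have ex j : exists a, hder (cphi hchart x j (ce hchart x' j)) (cmap hchart x p 0 j) a.
  by apply: cphi_hder; exact: bp.
have [||//] := @diff_coords R k k id (cmap hchart x' \o cinv hchart x)
  (fun j => cphi hchart x j (ce hchart x' j)) (fun j => projT1 (cid (ex j)))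
  (cmap hchart x p).
- apply: filterS (lbox_near bp) => v bv.
  by apply/rowP => j; rewrite !mxE mc_cinv.
- by move=> j; case: cid.
Qed.

Definition curve_manifold : complex_manifold R k :=
  @ComplexManifold R k M M_atlas M_nonempty M_connected M_hausdorff
    M_second_countable M_cover M_holomorphic.

End CurveProductManifold.

(** * Lengths and completeness *)

Section RealDerivatives.
Variable R : realType.
Local Notation C := (cplx R).

Lemma mul_half (e x : R) : e * x = e / 2 * x + e / 2 * x.
Proof. by field. Qed.

Lemma is_derive_eps (g : R -> R) (t a : R) : is_derive t 1 g a <->
  forall e, 0 < e -> exists2 d : R, 0 < d & forall s, `|s - t| < d ->
    `|g s - g t - (s - t) * a| <= e * `|s - t|.
Proof.
split=> [[dg ga] e e0|h].
  have : h^-1 *: (g (h *: 1 + t) - g t) @[h --> 0^'] --> a.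
    by rewrite -ga; exact: dg.
  move=> /cvgrPdist_le/(_ e e0)/nbhs_ballP[d d0 hd]; exists d => // s sd.
  have [->|st] := eqVneq s t; first by rewrite !subrr mul0r subrr normr0 mulr0.
  have st0 : s - t != 0 by rewrite subr_eq0.
  have := hd (s - t); rewrite -ball_normE/= sub0r normrN => /(_ sd st0).
  rewrite /GRing.scale/= mulr1 subrK => hh.
  have -> : g s - g t - (s - t) * a = - ((a - (s - t)^-1 * (g s - g t)) * (s - t)).
    by field.
  by rewrite normrN normrM; apply: ler_wpM2r.
have c : h^-1 *: (g (h *: 1 + t) - g t) @[h --> 0^'] --> a.
  apply/cvgrPdist_le => e e0; have [d d0 hd] := h e e0.
  apply/nbhs_ballP; exists d => // s; rewrite -ball_normE/= sub0r normrN => sd s0.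
  have := hd (s + t); rewrite addrK => /(_ sd).
  rewrite /GRing.scale/= mulr1 -(ler_pM2l (_ : 0 < `|s^-1|)); last first.
    by rewrite normr_gt0 invr_neq0.
  rewrite -normrM mulrCA -normrM mulVf// normr1 mulr1; congr (_ <= _).
  by rewrite distrC; congr (`|_|); field.
by split; [apply/cvg_ex; exists a|exact: cvg_lim c].
Qed.

(** One complex estimate in place of the two real derivatives in [real_derivable], so that it
    composes with [hder]. *)
Definition eder (f : R -> C) (t : R) (a : C) := forall e : R, 0 < e ->
  exists2 d : R, 0 < d & forall s, `|s - t| < d ->
    nc (f s - f t - ((s - t)%:C%C : C) * a) <= e * `|s - t|.

Lemma eder_is_derive f t a : eder f t a <->
  is_derive t 1 (@complex.Re R \o f) (complex.Re a) /\
  is_derive t 1 (@complex.Im R \o f) (complex.Im a).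
Proof.
have E s : complex.Re (f s - f t - ((s - t)%:C%C : C) * a) =
    complex.Re (f s) - complex.Re (f t) - (s - t) * complex.Re a.
  by rewrite !cReD !cReN cReM /= mul0r subr0.
have E' s : complex.Im (f s - f t - ((s - t)%:C%C : C) * a) =
    complex.Im (f s) - complex.Im (f t) - (s - t) * complex.Im a.
  by rewrite !cImD !cImN cImM /= mul0r addr0.
split=> [h|[hr hi] e e0].
  split; apply/is_derive_eps => e e0; have [d d0 hd] := h e e0; exists d => // s sd.
    by apply: le_trans (hd s sd); rewrite -E; exact: nc_Re.
  by apply: le_trans (hd s sd); rewrite -E'; exact: nc_Im.
have e20 : 0 < e / 2 by rewrite divr_gt0.
have [d1 d10 h1] := (is_derive_eps _ _ _).1 hr _ e20.
have [d2 d20 h2] := (is_derive_eps _ _ _).1 hi _ e20.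
exists (Num.min d1 d2); first by rewrite lt_min d10.
move=> s; rewrite lt_min => /andP[/h1 {}h1 /h2 {}h2].
by apply: le_trans (nc_ReIm _) _; rewrite E E' [leRHS]mul_half; apply: lerD.
Qed.

Lemma eder_derivable f t a : eder f t a -> real_derivable f t.
Proof. by move=> /eder_is_derive[h1 h2]; split; exact: ex_derive. Qed.

Lemma eder_val f t a : eder f t a -> real_derive f t = a.
Proof.
move=> /eder_is_derive[h1 h2]; rewrite /real_derive !derive1E !derive_val.
by case: a {h1 h2}.
Qed.

Lemma derivable_eder f t : real_derivable f t -> eder f t (real_derive f t).
Proof.
move=> [h1 h2]; apply/eder_is_derive; rewrite /real_derive /= !derive1E.
by split; exact: derivableP.
Qed.

Lemma eder_near f g t a (d : R) : 0 < d ->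
  (forall s, `|s - t| < d -> f s = g s) -> eder f t a -> eder g t a.
Proof.
move=> d0 fg h e e0; have [d' d'0 hd] := h e e0.
exists (Num.min d d'); first by rewrite lt_min d0.
move=> s; rewrite lt_min => /andP[s1 s2].
by rewrite -!fg ?hd// subrr normr0.
Qed.

Lemma eder_lip f t a : eder f t a -> exists2 d : R, 0 < d & forall s, `|s - t| < d ->
  nc (f s - f t) <= (nc a + 1) * `|s - t|.
Proof.
move=> h; have [d d0 hd] := h 1 ltr01; exists d => // s /hd hh.
rewrite (_ : f s - f t = (f s - f t - ((s - t)%:C%C : C) * a) + ((s - t)%:C%C : C) * a); last by ring.
apply: le_trans (ncD _ _) _; rewrite ncM nc_real mulrDl addrC mulrC.
exact: lerD.
Qed.

Lemma eder_cst (c : C) t : eder (fun=> c) t 0.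
Proof.
move=> e e0; exists 1 => // s _.
by rewrite subrr mulr0 subrr nc0 mulr_ge0// ltW.
Qed.

Lemma eder_line (z v : C) t : eder (fun s => z + (s%:C%C : C) * v) t v.
Proof.
move=> e e0; exists 1 => // s _.
rewrite (_ : _ - _ - _ = 0); first by rewrite nc0 mulr_ge0// ltW.
by rewrite rmorphB; ring.
Qed.

Lemma ederD f g t a b : eder f t a -> eder g t b -> eder (fun s => f s + g s) t (a + b).
Proof.
move=> hf hg e e0; have e20 : 0 < e / 2 by rewrite divr_gt0.
have [d d0 h1] := hf _ e20; have [d' d'0 h2] := hg _ e20.
exists (Num.min d d'); first by rewrite lt_min d0.
move=> s; rewrite lt_min => /andP[/h1 {}h1 /h2 {}h2].
rewrite (_ : _ - _ - _ = (f s - f t - ((s - t)%:C%C : C) * a) + (g s - g t - ((s - t)%:C%C : C) * b));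
  last by ring.
by apply: le_trans (ncD _ _) _; rewrite [leRHS]mul_half lerD.
Qed.

Lemma eder_sum (I : Type) (r : seq I) (f : I -> R -> C) t (a : I -> C) :
  (forall i, eder (f i) t (a i)) ->
  eder (fun s => \sum_(i <- r) f i s) t (\sum_(i <- r) a i).
Proof.
move=> h; elim: r => [|i r IH].
  rewrite big_nil (_ : (fun s => _) = fun=> 0); first exact: eder_cst.
  by apply/funext => s; rewrite big_nil.
rewrite big_cons (_ : (fun s => _) = fun s => f i s + \sum_(j <- r) f j s).
  exact: ederD.
by apply/funext => s; rewrite big_cons.
Qed.

Lemma eder_conj f t a : eder f t a -> eder (fun s => (f s)^*) t a^*.
Proof.
move=> h e e0; have [d d0 hd] := h e e0; exists d => // s /hd.
have -> : (f s)^* - (f t)^* - ((s - t)%:C%C : C) * a^* = (f s - f t - ((s - t)%:C%C : C) * a)^*.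
  rewrite !rmorphB rmorphM/=; congr (_ - _ * _).
  apply/esym/CrealP; rewrite -(rmorphB (real_complex R)).
  by apply/(@complex_realP R); exists (s - t).
by rewrite /nc norm_conjC.
Qed.

Lemma eder_hder (psi : C -> C) f t a v : hder psi (f t) a -> eder f t v ->
  eder (fun s => psi (f s)) t (a * v).
Proof.
move=> [d d0 [M M0 h]] hf e e0.
have [d1 d10 lf] := eder_lip hf.
set L := nc v + 1 in lf; have L0 : 0 < L by rewrite /L ltr_wpDl ?nc_ge0.
have e1 : 0 < e / 2 / (nc a + 1) by rewrite !divr_gt0// ltr_wpDl ?nc_ge0.
have [d2 d20 hd] := hf _ e1.
have ML0 : 0 < 2 * (M * L ^+ 2 + 1).
  by rewrite mulr_gt0// ltr_wpDl// mulr_ge0// sqr_ge0.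
exists (Num.min (Num.min d1 d2) (Num.min (d / L) (e / (2 * (M * L ^+ 2 + 1))))).
  by rewrite !lt_min d10 d20 !divr_gt0.
move=> s; rewrite !lt_min => /andP[/andP[s1 s2] /andP[s3 s4]].
have {}lf := lf _ s1; have {}hd := hd _ s2.
have x0 : 0 <= `|s - t| by [].
have fd : nc (f s - f t) < d.
  by apply: le_lt_trans lf _; rewrite mulrC -ltr_pdivlMr.
have hh := h _ fd.
rewrite (_ : _ - _ - _ = (psi (f s) - psi (f t) - a * (f s - f t)) +
   a * (f s - f t - ((s - t)%:C%C : C) * v)); last by ring.
apply: le_trans (ncD _ _) _; rewrite ncM [leRHS]mul_half; apply: lerD.
  apply: le_trans hh _.
  have h1 : nc (f s - f t) ^+ 2 <= (L * `|s - t|) ^+ 2.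
    by rewrite lerXn2r ?nnegrE ?nc_ge0// mulr_ge0// ltW.
  have h2 := ler_wpM2l M0 h1; apply: le_trans h2 _.
  move: s4; rewrite ltr_pdivlMr// => s4.
  rewrite exprMn mulrA expr2 mulrA; apply: ler_wpM2r => //.
  have := mulr_ge0 M0 (sqr_ge0 L); lra.
have h1 := ler_wpM2l (nc_ge0 a) hd; apply: le_trans h1 _.
rewrite mulrA; apply: ler_wpM2r => //.
rewrite mulrA ler_pdivrMr ?ltr_wpDl ?nc_ge0//.
by have := nc_ge0 a; nra.
Qed.

Lemma ederM f g t a b : eder f t a -> eder g t b ->
  eder (fun s => f s * g s) t (a * g t + f t * b).
Proof.
move=> hf hg.
have sq h c : eder h t c -> eder (fun s => h s * h s) t ((h t + h t) * c).
  move=> hh; apply: (@eder_hder (fun z => z * z)) hh.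
  by have := hderM (hder_id (h t)) (hder_id (h t)); rewrite mul1r mulr1.
have cm (c : C) h a' : eder h t a' -> eder (fun s => c * h s) t (c * a').
  move=> hh; apply: (@eder_hder (fun z => c * z)) hh.
  by have := hderM (hder_cst c (h t)) (hder_id (h t)); rewrite mul0r add0r mulr1.
(* Polarization. *)
have h1 := ederD hf hg.
have h2 := ederD hf (cm (-1) _ _ hg).
have := ederD (cm 4^-1 _ _ (sq _ _ h1)) (cm (- 4^-1) _ _ (sq _ _ h2)).
rewrite (_ : 4^-1 * _ + _ = a * g t + f t * b); last by field.
by apply: (@eder_near _ _ _ _ 1) => // s _; field.
Qed.

End RealDerivatives.

Lemma sum_mxvec (V : nmodType) d k (f : 'I_(d * k) -> V) :
  \sum_l f l = \sum_a \sum_j f (mxvec_index a j).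
Proof.
rewrite pair_big/= (reindex _ (curry_mxvec_bij d k))/=.
by apply: eq_bigr => -[a j].
Qed.

(** * The maps to affine space and their pull-back metrics *)

Section Immersion.
Variables (R : realType) (k : nat).
Local Notation C := (cplx R).
Variable Gam : (bool -> C) -> Prop.
Hypothesis hchart : forall q, Gam q -> exists c, local_chart Gam q c.
Variable p0 : 'rV[C]_(2 * k).
Hypothesis Sp0 : prodS Gam p0.
Local Notation M := (curve_manifold hchart Sp0).

Variables (d : nat) (Phi : 'I_d -> (bool -> C) -> C) (iota : bool -> 'I_d).
Hypothesis Phi_iota : forall b q, Phi (iota b) q = q b.
Hypothesis Phi_smooth : forall a n (U : set C) (phi : bool -> C -> C),
  (forall b, smooth n U (phi b)) -> smooth n U (fun z => Phi a (phi^~ z)).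
Hypothesis Phi_bounded : exists B : R, forall a q, Gam q -> nc (Phi a q) <= B.

Implicit Types x y : M.

(** [Phi] is a list of [d] functions that contains the two coordinates, at the places given by
    [iota]. Both parts of the theorem are instances, with [d = 2] and [d = 4]. *)
Definition Xmap y : 'rV[C]_(d * k) := mkv (fun a j => Phi a (mc y j)).

Definition psi x (a : 'I_d) j (v : C) : C := Phi a (fun b => cphi hchart x j b v).

Local Notation cpar x j := (mc x j (ce hchart x j)).
Local Notation disc x j := [set v : C | nc (v - cpar x j) < cr hchart x j].

(** Three derivatives, because the curvature differentiates [mP], which already contains second
    ones. *)
Lemma psi_derivs x a j : exists D : nat -> C -> C, forall v, disc x j v ->
  [/\ hder (psi x a j) v (D 1%N v), hder (D 1%N) v (D 2 v) & hder (D 2) v (D 3 v)].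
Proof.
have [_ _ s _ _] := ldP hchart x j.
have [D1 h1 [D2 h2 [D3 h3 _]]] := Phi_smooth a (s 3).
exists (fun n => if n is 1%N then D1 else if n is 2 then D2 else D3).
by move=> v hv; split; [exact: h1|exact: h2|exact: h3].
Qed.

Definition dpsi x a j : nat -> C -> C := projT1 (cid (psi_derivs x a j)).

Lemma dpsiP x a j v : disc x j v ->
  [/\ hder (psi x a j) v (dpsi x a j 1 v), hder (dpsi x a j 1) v (dpsi x a j 2 v) &
     hder (dpsi x a j 2) v (dpsi x a j 3 v)].
Proof. by move=> hv; rewrite /dpsi; case: cid => D /= hD; exact: hD. Qed.

(** One component is the local parameter itself; this makes the differential injective and the
    metric coefficient positive. *)
Lemma psi_param x j v : psi x (iota (ce hchart x j)) j v = v.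
Proof. by rewrite /psi Phi_iota; have [_ E _ _ _] := ldP hchart x j; exact: E. Qed.

Lemma hder_uniq f v (a b : C) : hder f v a -> hder f v b -> a = b.
Proof.
move=> [d1 d10 [M1 M10 h1]] [d2 d20 [M2 M20 h2]].
apply/eqP; rewrite -subr_eq0 -nc_eq0 eq_le nc_ge0 andbT; apply/ler_addgt0Pr => e e0.
rewrite add0r.
pose t := Num.min (Num.min d1 d2) (e / (M1 + M2 + 1)) / 2.
have M0 : 0 < M1 + M2 + 1 by rewrite ltr_wpDl// addr_ge0.
have m0 : 0 < Num.min (Num.min d1 d2) (e / (M1 + M2 + 1)).
  by rewrite !lt_min d10 d20 divr_gt0.
have t0 : 0 < t by rewrite divr_gt0.
have : t < Num.min (Num.min d1 d2) (e / (M1 + M2 + 1)).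
  by rewrite /t ltr_pdivrMr// ltr_pMr// ltr1n.
rewrite !lt_min => /andP[/andP[t1 t2] t3]; clearbody t.
have nt : nc (t%:C%C : C) = t by rewrite nc_real gtr0_norm.
have := h1 (v + t%:C%C); have := h2 (v + t%:C%C).
rewrite addrAC subrr add0r nt => /(_ t2) k2 /(_ t1) k1.
have h : nc (a - b) * t <= (M1 + M2) * t ^+ 2.
  rewrite -{1}nt -ncM.
  rewrite (_ : _ * _ = (f (v + t%:C%C) - f v - b * t%:C%C)
    - (f (v + t%:C%C) - f v - a * t%:C%C)); last by ring.
  by apply: le_trans (ncB _ _) _; lra.
move: h; rewrite expr2 mulrA ler_pM2r// => h.
by move: t3; rewrite ltr_pdivlMr// => t3; lra.
Qed.

Lemma dpsi_param x j v : disc x j v -> dpsi x (iota (ce hchart x j)) j 1 v = 1.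
Proof.
move=> hv; have [h _ _] := dpsiP (iota (ce hchart x j)) hv.
apply: hder_uniq h _; rewrite (_ : psi _ _ _ = id); first exact: hder_id.
by apply/funext => v'; exact: psi_param.
Qed.

Lemma in_chart_Xmap x v : lbox hchart x v ->
  in_chart Xmap (pchart hchart x) v = mkv (fun a j => psi x a j (v 0 j)).
Proof.
move=> bv; rewrite /in_chart /Xmap /=; apply: ent_ext => a j; rewrite !ent_mkv /psi.
by congr (Phi a _); apply/funext => b; rewrite mc_cinv.
Qed.

Lemma diff_X x v : lbox hchart x v ->
  differentiable (in_chart Xmap (pchart hchart x)) v /\
  forall h, 'd (in_chart Xmap (pchart hchart x)) v h =
    mkv (fun a j => dpsi x a j 1 (v 0 j) * h 0 j).
Proof.
move=> bv; apply: (@diff_mkv R d k _ (psi x)).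
  by apply: filterS (lbox_near bv) => w; exact: in_chart_Xmap.
by move=> a j; have [h _ _] := dpsiP a (bv j).
Qed.

Lemma atlasP (c : chart R k M) : atlas c -> exists x : M, c = pchart hchart x.
Proof. by move=> [x _ <-]; exists x. Qed.

Lemma Xmap_immersion : holomorphic_immersion Xmap.
Proof.
split=> c /atlasP[x ->] z; rewrite /chart_img cimg => bz; first exact: (diff_X bz).1.
move=> h h' E; apply/rowP => j.
have := congr1 (fun w => ent w (iota (ce hchart x j)) j) E.
by rewrite !(diff_X bz).2 !ent_mkv dpsi_param ?mul1r//; exact: bz.
Qed.

Lemma Xmap_entries y j b : ent (Xmap y) (iota b) j = mc y j b.
Proof. by rewrite /Xmap ent_mkv Phi_iota. Qed.

Lemma Xmap_continuous : continuous (Xmap : M -> 'rV[C]_(d * k)).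
Proof.
move=> y U /nbhs_ent[e e0 eU].
have [c [/atlasP[x ->] dy]] := M_cover hchart y.
have bv := cmap_box dy.
have ex a j : exists s : R, 0 < s /\ forall z', nc (z' - cmap hchart x y 0 j) < s ->
    nc (psi x a j z' - psi x a j (cmap hchart x y 0 j)) < e.
  have [h _ _] := dpsiP a (bv j).
  by have [s ? ?] := hder_cont h e0; exists s.
pose g (aj : 'I_d * 'I_k) := projT1 (cid (ex aj.1 aj.2)).
have gP aj : 0 < g aj /\ forall z', nc (z' - cmap hchart x y 0 aj.2) < g aj ->
   nc (psi x aj.1 aj.2 z' - psi x aj.1 aj.2 (cmap hchart x y 0 aj.2)) < e.
  by rewrite /g; case: cid.
have psiE z a j : cdom hchart x z -> ent (Xmap z) a j = psi x a j (cmap hchart x z 0 j).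
  move=> dz; rewrite /Xmap ent_mkv /psi; congr (Phi a _); apply/funext => b.
  by rewrite -{1}(cinv_cmap dz) mc_cinv//; exact: cmap_box.
have : nbhs y (cdom hchart x) by apply: open_nbhs_nbhs; split => //; exact: cdom_open.
move=> /nbhs_M[e1 e10 h1]; apply/nbhs_M.
exists (Num.min e1 (\big[Num.min/1]_aj g aj)).
  rewrite lt_min e10; apply: (big_ind (fun r : R => 0 < r)) => // [u w u0 w0|aj _];
    [by rewrite lt_min u0|exact: (gP aj).1].
move=> z hz; apply: eU => a j.
have dz : cdom hchart x z.
  by apply: h1 => j' b; have := hz j' b; rewrite lt_min => /andP[].
rewrite !psiE//; have [_] := gP (a, j); apply => /=; rewrite !mxE.
have := hz j (ce hchart x j); rewrite lt_min => /andP[_ h].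
by apply: lt_le_trans h _; exact: bigmin_le_cond.
Qed.

(** The inverse reads off the components at the places [iota]. *)
Lemma Xmap_embedding : topological_embedding Xmap.
Proof.
split; first exact: Xmap_continuous.
have [c0 _] := M_nonempty Sp0.
pose Y (q : 'rV[C]_(d * k)) : M := toM c0 (mk (fun j b => ent q (iota b) j)).
have XY : cancel Xmap Y.
  move=> y; rewrite /Y (_ : mk _ = mval y).
    by apply: mval_inj; rewrite toMK//; exact: mvalP.
  by apply: crd_ext => j b; rewrite crd_mk Xmap_entries.
exists Y => //; apply/subspace_continuousP => _ [y _ <-] U hU.
have /nbhs_M[e e0 eU] : nbhs y U := eq_rect _ (fun z => nbhs z U) hU _ (XY y).
apply/nbhs_ent; exists e => // q hq [z _ zq].
have Uz : U z by apply: eU => j b; have := hq (iota b) j; rewrite -zq !Xmap_entries.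
exact: eq_rect _ U Uz _ (etrans (esym (XY z)) (congr1 Y zq)).
Qed.

Lemma Xmap_bounded : bounded_set (range Xmap).
Proof.
have [B hB] := Phi_bounded.
exists (Num.max 0 B)%:C%C; split.
  by apply/(@complex_realP R); exists (Num.max 0 B).
move=> c Bc _ [y _ <-]; apply: le_trans (ltW Bc); apply: mx_norm_le.
  by rewrite (@lecR R 0) le_max lexx.
move=> i l; rewrite ord1; case/mxvec_indexP: l => a j.
rewrite -[Xmap y _ _]/(ent (Xmap y) a j) -nc_norm (@lecR R) /Xmap ent_mkv le_max hB ?orbT//.
exact: mcG.
Qed.

Definition metric x j (v : C) : C :=
  \sum_a dpsi x a j 1 v * (dpsi x a j 1 v)^*.

(** Distinct factors are orthogonal, so the metric is diagonal in product charts. *)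
Lemma pullbackE x v : lbox hchart x v ->
  pullback_metric Xmap (pchart hchart x) v =
    \matrix_(i, j) ((i == j)%:R * metric x j (v 0 j)).
Proof.
move=> bv; apply/matrixP => i j; rewrite !mxE /herm.
transitivity (\sum_l 'd (in_chart Xmap (pchart hchart x)) v (delta_mx 0 i) 0 l *
   ('d (in_chart Xmap (pchart hchart x)) v (delta_mx 0 j) 0 l)^*).
  apply: eq_bigr => l _; rewrite (bigD1 l)//= mxE eqxx mul1r big1 ?addr0// => l' ll.
  by rewrite mxE eq_sym (negbTE ll) !mul0r.
rewrite !(diff_X bv).2 sum_mxvec /metric.
have [<-|ij] := eqVneq i j.
  rewrite mul1r; apply: eq_bigr => a _; rewrite (bigD1 i)//= big1 ?addr0.
    by rewrite -!/(ent _ _ _) !ent_mkv mxE !eqxx mulr1.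
  move=> l li; rewrite -!/(ent _ _ _) !ent_mkv mxE (negbTE li) andbF.
  by rewrite mulr0 mul0r.
rewrite mul0r big1// => a _; rewrite big1// => l _.
rewrite -!/(ent _ _ _) !ent_mkv !mxE !eqxx /=.
have [->|li] := eqVneq l i; last by rewrite mulr0 mul0r.
by rewrite (negbTE ij) mulr0 rmorph0 mulr0.
Qed.

Lemma sqnorm_pullback x v h : lbox hchart x v ->
  sqnorm (pullback_metric Xmap (pchart hchart x) v) h =
  \sum_a \sum_j nc (dpsi x a j 1 (v 0 j)) ^+ 2 * nc (h 0 j) ^+ 2.
Proof.
move=> bv; rewrite /sqnorm /herm pullbackE//.
rewrite (_ : \sum_i _ = ((\sum_a \sum_j nc (dpsi x a j 1 (v 0 j)) ^+ 2 * nc (h 0 j) ^+ 2)%:C)%C)//.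
have E j : \sum_l (\matrix_(i, j) ((i == j)%:R * metric x j (v 0 j))) j l * h 0 j * (h 0 l)^*
   = metric x j (v 0 j) * h 0 j * (h 0 j)^*.
  rewrite (bigD1 j)//= big1 ?addr0; first by rewrite mxE eqxx mul1r.
  by move=> l lj; rewrite mxE eq_sym (negbTE lj) !mul0r.
rewrite (eq_bigr _ (fun j _ => E j)) exchange_big/= rmorph_sum/=.
apply: eq_bigr => j _; rewrite rmorph_sum/= /metric mulr_suml mulr_suml.
apply: eq_bigr => a _; rewrite rmorphM/= !rmorphXn/= !nc_norm.
by rewrite !normCK; ring.
Qed.

End Immersion.

Section Primitives.
Variable R : realType.
Implicit Types f L u : R -> R.

Lemma nbhs_real (t : R) (P : set R) :
  nbhs t P <-> exists2 e : R, 0 < e & forall s, `|s - t| < e -> P s.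
Proof.
split=> [/nbhs_ballP[e e0 h]|[e e0 h]].
  by exists e => // s hs; apply: h; rewrite -ball_normE/= distrC.
by apply/nbhs_ballP; exists e => // s; rewrite -ball_normE/= distrC; exact: h.
Qed.

Lemma primitive_ex f : continuous f -> exists L : R -> R,
  (forall t : R, 0 <= t <= 1 -> is_derive t 1 L (f t)) /\
  (\int[lebesgue_measure]_(t in `[0%R, 1%R]) (f t)%:E = (L 1 - L 0)%:E)%E.
Proof.
move=> cf.
(* The lower bound -1, and the upper bound 2 used below, make 0 and 1 interior points, where [L] has
   two-sided derivatives. *)
pose L x := (\int[lebesgue_measure]_(t in [set` `[(-1 : R), x]]) (f t))%R.
have dL (t : R) : 0 <= t <= 1 -> is_derive t 1 L (f t).
  move=> /andP[t0 t1].
  have [|||dL L'] := @continuous_FTC1_closed R f (-1) t 2 _ _ _ (cf t).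
  - by lra.
  - apply: continuous_compact_integrable; first exact: segment_compact.
    exact: continuous_subspaceT.
  - by lra.
  by split; [exact: dL|rewrite -derive1E; exact: L'].
exists L; split => //.
have cL (t : R) : 0 <= t <= 1 -> {for t, continuous L}.
  by move=> /dL[d _]; apply: differentiable_continuous; exact/derivable1_diffP.
rewrite (@continuous_FTC2 R f L 0 1)//.
- exact: continuous_subspaceT.
- split.
  + by move=> t; rewrite in_itv/= => /andP[/ltW t0 /ltW t1]; case: (dL t); rewrite ?t0.
  + by apply: cvg_at_right_filter; apply: cL; rewrite lexx ler01.
  + by apply: cvg_at_left_filter; apply: cL; rewrite lexx ler01.
- move=> t; rewrite in_itv/= => /andP[/ltW t0 /ltW t1].
  by rewrite derive1E; apply: derive_val; apply: dL; rewrite t0.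
Qed.

(** Both [L - u] and [L + u] have nonnegative derivatives. *)
Lemma le_primitive f L u u' : (forall t : R, 0 <= t <= 1 -> is_derive t 1 L (f t)) ->
  (forall t : R, is_derive t 1 u (u' t)) -> (forall t, `|u' t| <= f t) ->
  forall s s', 0 <= s -> s <= s' -> s' <= 1 -> `|u s - u s'| <= L s' - L s.
Proof.
move=> dL du uf s s' s0 ss s1.
have key (v v' : R -> R) : (forall t : R, is_derive t 1 v (v' t)) ->
    (forall t, `|v' t| <= f t) -> L s - v s <= L s' - v s'.
  move=> dv vf.
  have d (t : R) : s <= t <= s' -> is_derive t 1 (L - v) (f t - v' t).
    move=> /andP[h1 h2]; have hL : is_derive t 1 L (f t) by apply: dL; apply/andP; split; lra.
    have hv := dv t; exact: is_deriveB.
  apply: (@ger0_derive1_le_cc R (L - v) s s') => //; rewrite ?in_itv/= ?lexx ?ss//.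
  - by move=> t; rewrite in_itv/= => /andP[/ltW t0 /ltW t1]; case: (d t); rewrite ?t0.
  - move=> t; rewrite in_itv/= => /andP[/ltW t0 /ltW t1].
    rewrite derive1E (derive_val (is_derive := d t _)) ?t0// subr_ge0.
    exact: le_trans (ler_norm _) (vf t).
  - apply: derivable_within_continuous => t; rewrite in_itv/= => h.
    by case: (d t h).
have h1 := key u u' du uf.
have h2 : L s + u s <= L s' + u s'.
  have dN (t : R) : is_derive t 1 (- u) (- u' t) by have := du t; exact: is_deriveN.
  by have := key _ _ dN; rewrite /= !opprK; apply=> t; rewrite normrN.
by rewrite ler_norml; apply/andP; split; lra.
Qed.

End Primitives.

Section Lengths.
Variables (R : realType) (k : nat).
Local Notation C := (cplx R).
Variable Gam : (bool -> C) -> Prop.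
Hypothesis hchart : forall q, Gam q -> exists c, local_chart Gam q c.
Variable p0 : 'rV[C]_(2 * k).
Hypothesis Sp0 : prodS Gam p0.
Local Notation M := (curve_manifold hchart Sp0).

Variables (d : nat) (Phi : 'I_d -> (bool -> C) -> C) (iota : bool -> 'I_d).
Hypothesis Phi_iota : forall b q, Phi (iota b) q = q b.
Hypothesis Phi_smooth : forall a n (U : set C) (phi : bool -> C -> C),
  (forall b, smooth n U (phi b)) -> smooth n U (fun z => Phi a (phi^~ z)).

Local Notation dpsi := (dpsi Phi_smooth).
Local Notation pchart := (pchart hchart (p0 := p0)).
Local Notation g := (@pullback_metric R k (d * k) M (Xmap Phi)).

Implicit Types (x y : M) (gamma : R -> M).

Definition path_coord gamma a j (s : R) : C := Phi a (mc (gamma s) j).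

Lemma chart_atE y : exists2 x : M, chart_at y = pchart x & cdom hchart x y.
Proof.
rewrite /chart_at; case: cid => c /= [/atlasP[x ->] h]; by exists x.
Qed.

Lemma near_cdom gamma x (t : R) : C1_curve gamma -> cdom hchart x (gamma t) ->
  exists2 e : R, 0 < e & forall s, `|s - t| < e -> cdom hchart x (gamma s).
Proof.
move=> [cg _] h.
have : nbhs (gamma t) (cdom hchart x) by apply: open_nbhs_nbhs; split => //; exact: cdom_open.
move=> /(cg t)/nbhs_real[e e0 he]; exists e => // s; exact: he.
Qed.

Lemma path_coordE x a j gamma s : cdom hchart x (gamma s) ->
  path_coord gamma a j s = psi Phi x a j (mc (gamma s) j (ce hchart x j)).
Proof.
move=> h; rewrite /path_coord /psi; congr (Phi a _); apply/funext => b.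
by rewrite -[in LHS](cinv_cmap h) mc_cinv ?mxE//; exact: cmap_box.
Qed.

Lemma velocityE gamma x t j :
  velocity gamma (pchart x) t 0 j = real_derive (fun s => mc (gamma s) j (ce hchart x j)) t.
Proof. by rewrite mxE; congr (real_derive _ t); apply/funext => s; rewrite mxE. Qed.

Lemma C1_coord gamma x t j : C1_curve gamma -> cdom hchart x (gamma t) ->
  let f := fun s => mc (gamma s) j (ce hchart x j) in
  real_derivable f t /\ {for t, continuous (real_derive f)}.
Proof.
move=> [_ h] dx; have := h (pchart x) _ t dx j.
rewrite (_ : (fun s => _) = fun s => mc (gamma s) j (ce hchart x j)).
  by apply; exists x.
by apply/funext => s; rewrite mxE.
Qed.

Lemma path_coord_eder gamma x a j t : C1_curve gamma -> cdom hchart x (gamma t) ->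
  eder (path_coord gamma a j) t
    (dpsi x a j 1 (mc (gamma t) j (ce hchart x j)) * velocity gamma (pchart x) t 0 j).
Proof.
move=> cg dx; have [e e0 he] := near_cdom cg dx.
apply: (eder_near e0 (f := fun s => psi Phi x a j (mc (gamma s) j (ce hchart x j)))).
  by move=> s /he h; rewrite (path_coordE _ _ h).
have [h _ _] := dpsiP Phi_smooth a (dx.1 j : [set v | _] _).
apply: eder_hder h _; rewrite velocityE; apply: derivable_eder.
by have [] := C1_coord j cg dx.
Qed.

Lemma path_coord_derivable gamma a j t : C1_curve gamma ->
  real_derivable (path_coord gamma a j) t.
Proof.
move=> cg; have [x _ dx] := chart_atE (gamma t).
exact: eder_derivable (path_coord_eder a j cg dx).
Qed.

(** The chain rule turns the speed into the Euclidean norm of the derivative of the image path,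
    which no longer depends on the chart chosen at each time. *)
Lemma speedE gamma t : C1_curve gamma ->
  speed g gamma t =
    Num.sqrt (\sum_a \sum_j nc (real_derive (path_coord gamma a j) t) ^+ 2).
Proof.
move=> cg; rewrite /speed; have [x -> dx] := chart_atE (gamma t).
rewrite (sqnorm_pullback Phi_smooth); last exact: cmap_box.
congr Num.sqrt; apply: eq_bigr => a _; apply: eq_bigr => j _.
by rewrite (eder_val (path_coord_eder a j cg dx)) ncM exprMn mxE.
Qed.

Lemma eder_continuous (f : R -> C) t a : eder f t a -> forall e : R, 0 < e ->
  exists2 dd : R, 0 < dd & forall s, `|s - t| < dd -> nc (f s - f t) < e.
Proof.
move=> /eder_lip[dd d0 h] e e0.
have a0 : 0 < nc a + 1 by rewrite ltr_wpDl// nc_ge0.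
exists (Num.min dd (e / (nc a + 1))); first by rewrite lt_min d0 divr_gt0.
move=> s; rewrite lt_min => /andP[/h h1]; rewrite ltr_pdivlMr// => h2.
by apply: le_lt_trans h1 _; rewrite mulrC.
Qed.

Lemma nc_dist (z w : C) : `|nc z - nc w| <= nc (z - w).
Proof.
have := ncD (z - w) w; have := ncD (w - z) z; rewrite !subrK (ncBC w z).
by rewrite ler_norml => h1 h2; apply/andP; split; lra.
Qed.

Lemma path_coord_derive_continuous gamma a j : C1_curve gamma ->
  continuous (fun t => nc (real_derive (path_coord gamma a j) t)).
Proof.
move=> cg t; have [x _ dx] := chart_atE (gamma t).
have [e e0 he] := near_cdom cg dx.
pose f s := mc (gamma s) j (ce hchart x j).
have [df cf] := C1_coord j cg dx.
have [_ h2 _] := dpsiP Phi_smooth a (dx.1 j : [set v | _] _).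
pose D := dpsi x a j 1.
have E s : `|s - t| < e -> nc (real_derive (path_coord gamma a j) s) =
    nc (D (f s)) * nc (real_derive f s).
  by move=> /he h; rewrite (eder_val (path_coord_eder a j cg h)) velocityE ncM.
have c1 : (fun s => nc (D (f s))) x0 @[x0 --> t] --> nc (D (f t)).
  apply/cvgrPdist_lt => r r0.
  have [d1 d10 k1] := hder_cont h2 r0.
  have [d2 d20 k2] := eder_continuous (derivable_eder df) d10.
  apply/nbhs_real; exists d2 => // s /k2/k1 h.
  by rewrite distrC; apply: le_lt_trans h; exact: nc_dist.
have c2 : (fun s => nc (real_derive f s)) x0 @[x0 --> t] --> nc (real_derive f t).
  apply/cvgrPdist_lt => r r0.
  have /nbhs_real[d2 d20 k2] : nbhs t [set s | nc (real_derive f s - real_derive f t) < r].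
    have hn : nbhs (real_derive f t) [set w : C | nc (w - real_derive f t) < r].
      by apply/nbhs_cplx; exists r.
    exact: cf hn.
  apply/nbhs_real; exists d2 => // s /k2 /= h.
  by rewrite distrC; apply: le_lt_trans h; exact: nc_dist.
have c3 := cvgM c1 c2.
rewrite /continuous_at E ?subrr ?normr0//.
have : \forall s \near t, nc (D (f s)) * nc (real_derive f s) =
    nc (real_derive (path_coord gamma a j) s).
  by apply/nbhs_real; exists e => // s /E ->.
move=> hn; apply: (cvg_trans (near_eq_cvg hn)).
exact: c3.
Qed.

Lemma speed_continuous gamma : C1_curve gamma -> continuous (speed g gamma).
Proof.
move=> cg; rewrite (_ : speed g gamma = fun t =>
    Num.sqrt (\sum_a \sum_j nc (real_derive (path_coord gamma a j) t) ^+ 2)); last first.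
  by apply/funext => t; exact: speedE.
move=> t; apply: (@continuous_comp _ _ _ _ Num.sqrt); last exact: sqrt_continuous.
have addc : continuous (fun z : R^o * R^o => z.1 + z.2) by exact: add_continuous.
apply: (cvg_big addc) => a _; apply: (cvg_big addc) => j _.
have h := @path_coord_derive_continuous gamma a j cg t.
exact: (cvgM h h).
Qed.

Lemma coord_le_speed gamma a j t : C1_curve gamma ->
  nc (real_derive (path_coord gamma a j) t) <= speed g gamma t.
Proof.
move=> cg; rewrite speedE// -[leLHS](ger0_norm (nc_ge0 _)) -sqrtr_sqr; apply: ler_wsqrtr.
rewrite (bigD1 a)//= (bigD1 j)//= -addrA lerDl addr_ge0//; apply: sumr_ge0 => i _.
  exact: sqr_ge0.
by apply: sumr_ge0 => l _; exact: sqr_ge0.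
Qed.

(** The factor 2 arises because real and imaginary parts are bounded separately. *)
Lemma C1_length gamma : C1_curve gamma -> exists2 L : R -> R,
  curve_length g gamma = (L 1 - L 0)%:E &
  forall s s', 0 <= s -> s <= s' -> s' <= 1 -> forall j b,
    nc (mc (gamma s) j b - mc (gamma s') j b) <= 2 * L s' - 2 * L s.
Proof.
move=> cg; have [L [dL LE]] := primitive_ex (speed_continuous cg).
exists L => // s s' s0 ss s1 j b.
have cE r : mc (gamma r) j b = path_coord gamma (iota b) j r.
  by rewrite /path_coord Phi_iota.
have h t := (eder_is_derive _ _ _).1 (derivable_eder (path_coord_derivable (iota b) j t cg)).
have h1 := le_primitive dL (fun t => (h t).1)
   (fun t => le_trans (nc_Re _) (coord_le_speed (iota b) j t cg)) s0 ss s1.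
have h2 := le_primitive dL (fun t => (h t).2)
   (fun t => le_trans (nc_Im _) (coord_le_speed (iota b) j t cg)) s0 ss s1.
rewrite !cE.
apply: le_trans (nc_ReIm _) _; rewrite cReD cReN cImD cImN.
by move: h1 h2 => /=; lra.
Qed.

Lemma dist_lt_curve x y (e : R) : (riemannian_dist g x y < e%:E)%E ->
  exists gamma (L : R -> R),
  [/\ C1_curve gamma, gamma 0 = x /\ gamma 1 = y, L 1 - L 0 < e &
   forall s s', 0 <= s -> s <= s' -> s' <= 1 -> forall j b,
    nc (mc (gamma s) j b - mc (gamma s') j b) <= 2 * L s' - 2 * L s].
Proof.
move=> /ereal_inf_lt[_ [gamma [cg g0 g1] <-]] h.
have [L LE hL] := C1_length cg; exists gamma, L; split => //.
by move: h; rewrite LE lte_fin.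
Qed.

End Lengths.

Section Reparametrization.
Variable R : realType.
Local Notation C := (cplx R).

(* [C1_curve] asks for curves defined on the whole line, so segments are
   reparametrized by a function that stays in [-1, 1]. *)
Definition theta (t : R) : R := cos (pi / 2 * t).
Definition theta' (t : R) : R := - sin (pi / 2 * t) * (pi / 2).

Lemma theta0 : theta 0 = 1. Proof. by rewrite /theta mulr0 cos0. Qed.
Lemma theta1 : theta 1 = 0. Proof. by rewrite /theta mulr1 cos_pihalf. Qed.
Lemma theta_le1 t : `|theta t| <= 1. Proof. exact: cos_max. Qed.

Lemma theta'_le t : `|theta' t| <= pi / 2.
Proof.
have p0 : 0 < pi / 2 :> R by rewrite divr_gt0// pi_gt0.
by rewrite /theta' normrM normrN (gtr0_norm p0) ler_piMl ?sin_max// ltW.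
Qed.

Lemma theta'_continuous : continuous theta'.
Proof.
move=> t; apply: cvgM; last exact: cvg_cst.
apply: cvgN; apply: (@continuous_comp _ _ _ (fun t : R => pi / 2 * t)).
  by apply: cvgM; [exact: cvg_cst|exact: cvg_id].
exact: continuous_sin.
Qed.

Lemma theta_eder (a b : C) (t : R) :
  eder (fun s => a + ((theta s)%:C%C : C) * b) t (((theta' t)%:C%C : C) * b).
Proof.
have d1 : is_derive t 1 (fun s : R => pi / 2 * s) (pi / 2).
  have h := @is_deriveZ R R^o R^o id (pi / 2) t 1 1 (is_derive_id _ _).
  by rewrite /GRing.scale/= mulr1 in h.
have d2 : is_derive t 1 theta (theta' t).
  exact: (@is_derive1_comp _ _ _ _ _ _ (is_derive_cos _) d1).
have d3 : eder (fun s => (theta s)%:C%C : C) t ((theta' t)%:C%C : C).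
  by apply/eder_is_derive; split => //=; exact: is_derive_cst.
have h := hderD (hder_cst a ((theta t)%:C%C : C))
   (hderM (hder_id ((theta t)%:C%C : C)) (hder_cst b ((theta t)%:C%C : C))).
by have := @eder_hder R (fun z => a + z * b) (fun s => (theta s)%:C%C : C) t _ _ h d3; rewrite mul1r mulr0 addr0 add0r mulrC.
Qed.

End Reparametrization.

Section UpperBound.
Variables (R : realType) (k : nat).
Local Notation C := (cplx R).
Variable Gam : (bool -> C) -> Prop.
Hypothesis hchart : forall q, Gam q -> exists c, local_chart Gam q c.
Variable p0 : 'rV[C]_(2 * k).
Hypothesis Sp0 : prodS Gam p0.
Local Notation M := (curve_manifold hchart Sp0).

Variables (d : nat) (Phi : 'I_d -> (bool -> C) -> C).
Hypothesis Phi_smooth : forall a n (U : set C) (phi : bool -> C -> C),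
  (forall b, smooth n U (phi b)) -> smooth n U (fun z => Phi a (phi^~ z)).

Local Notation dpsi := (dpsi Phi_smooth).
Local Notation pchart := (pchart hchart (p0 := p0)).
Local Notation g := (@pullback_metric R k (d * k) M (Xmap Phi)).
Implicit Types (x y : M).

Definition seg x y (j : 'I_k) (t : R) : C := mc x j (ce hchart x j) +
  ((theta t)%:C%C : C) * (mc y j (ce hchart x j) - mc x j (ce hchart x j)).

Definition seg_curve x y (t : R) : M := cinv hchart x (\row_j seg x y j t).

Lemma seg_dist x y j t : nc (seg x y j t - mc x j (ce hchart x j)) <=
  nc (mc y j (ce hchart x j) - mc x j (ce hchart x j)).
Proof.
rewrite /seg addrAC subrr add0r ncM nc_real.
by rewrite ler_piMl ?theta_le1 ?nc_ge0.
Qed.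

Lemma seg_eder x y j t : eder (seg x y j) t
  (((theta' t)%:C%C : C) * (mc y j (ce hchart x j) - mc x j (ce hchart x j))).
Proof. exact: theta_eder. Qed.

Section OneSegment.
Variables x y : M.
Hypothesis dy : cdom hchart x y.
Local Notation w j := (mc y j (ce hchart x j) - mc x j (ce hchart x j)).

Lemma seg_box t : lbox hchart x (\row_j seg x y j t).
Proof. by move=> j; rewrite mxE; apply: le_lt_trans (seg_dist _ _ _ _) _; exact: dy.1. Qed.

Lemma mc_seg t j b : mc (seg_curve x y t) j b = cphi hchart x j b (seg x y j t).
Proof. by rewrite mc_cinv ?mxE//; exact: seg_box. Qed.

Lemma seg_curve0 : seg_curve x y 0 = y.
Proof.
rewrite -[RHS](cinv_cmap dy); congr cinv; apply/rowP => j; rewrite !mxE /seg theta0 mul1r.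
by rewrite addrCA subrr addr0.
Qed.

Lemma seg_curve1 : seg_curve x y 1 = x.
Proof.
apply: mc_ext => j b; rewrite mc_seg /seg theta1 mul0r addr0; exact: cphi_center.
Qed.

Lemma seg_comp_C1 (D f : C -> C) j t :
  (forall v, nc (v - mc x j (ce hchart x j)) < cr hchart x j -> hder f v (D v)) ->
  (exists a, hder D (seg x y j t) a) ->
  eder (f \o seg x y j) t (D (seg x y j t) * (((theta' t)%:C%C : C) * w j)) /\
  {for t, continuous (real_derive (f \o seg x y j))}.
Proof.
move=> fD [a Da].
have E s : eder (f \o seg x y j) s (D (seg x y j s) * (((theta' s)%:C%C : C) * w j)).
  apply: eder_hder; last exact: seg_eder.
  by apply: fD; have := seg_box s j; rewrite mxE.
split; first exact: E.
have -> : real_derive (f \o seg x y j) =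
    fun s => D (seg x y j s) * (((theta' s)%:C%C : C) * w j).
  by apply/funext => s; exact: eder_val.
have c1 : {for t, continuous (fun s => D (seg x y j s))}.
  move=> U /nbhs_cplx[e e0 eU]; apply/nbhs_real.
  by have [r r0 h] := eder_continuous (eder_hder Da (seg_eder x y j t)) e0; exists r => // s /h /eU.
have c2 : {for t, continuous (fun s => ((theta' s)%:C%C : C))}.
  move=> U /nbhs_cplx[e e0 eU].
  have /cvgrPdist_lt/(_ e e0)/nbhs_real[r r0 h] := @theta'_continuous R t.
  apply/nbhs_real; exists r => // s /h hs; apply: eU.
  by rewrite -(rmorphB (real_complex R)) nc_real distrC.
have c3 : {for t, continuous (fun s : R => w j)} by exact: cvg_cst.
exact: (cvgM c1 (cvgM c2 c3)).
Qed.

Lemma cphi_derivs b j : exists D : C -> C,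
  forall v, nc (v - mc x j (ce hchart x j)) < cr hchart x j ->
    hder (cphi hchart x j b) v (D v) /\ exists a, hder D v a.
Proof.
have [_ _ s _ _] := ldP hchart x j; have [D h1 [D2 h2 _]] := s 2 b.
by exists D => v hv; split; [exact: h1|exists (D2 v); exact: h2].
Qed.

Lemma seg_curve_C1 : C1_curve (seg_curve x y).
Proof.
have key j b t : let f := fun s => mc (seg_curve x y s) j b in
    (exists a, eder f t a) /\ {for t, continuous (real_derive f)}.
  move=> f; have -> : f = cphi hchart x j b \o seg x y j by apply/funext => s; exact: mc_seg.
  have [D hD] := cphi_derivs b j.
  have bt := seg_box t j; rewrite mxE in bt.
  have [h1 h2] := seg_comp_C1 (fun v hv => (hD v hv).1) (hD _ bt).2.
  by split => //; eexists; exact: h1.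
split.
  move=> t U /nbhs_M[e e0 eU]; apply/nbhs_real.
  have ex (jb : 'I_k * bool) : exists r : R, 0 < r /\ forall s, `|s - t| < r ->
     nc (mc (seg_curve x y s) jb.1 jb.2 - mc (seg_curve x y t) jb.1 jb.2) < e.
    have [[a ha] _] := key jb.1 jb.2 t.
    by have [r ? ?] := eder_continuous ha e0; exists r.
  pose r jb := projT1 (cid (ex jb)).
  have rP jb : 0 < r jb /\ forall s, `|s - t| < r jb ->
     nc (mc (seg_curve x y s) jb.1 jb.2 - mc (seg_curve x y t) jb.1 jb.2) < e.
    by rewrite /r; case: cid.
  exists (\big[Num.min/1]_jb r jb).
    by apply: (big_ind (fun u : R => 0 < u)) => // [u v u0 v0|jb _];
      [rewrite lt_min u0|exact: (rP jb).1].
  move=> s hs; apply: eU => j b; have [_] := rP (j, b); apply.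
  by apply: lt_le_trans hs _; exact: bigmin_le_cond.
move=> c /atlasP[x' ->] t dt j.
rewrite (_ : (fun s => _) = fun s => mc (seg_curve x y s) j (ce hchart x' j)).
  by have [[a ha] h] := key j (ce hchart x' j) t; split => //; exact: eder_derivable ha.
by apply/funext => s; rewrite mxE.
Qed.

Lemma seg_path_coord a j t : real_derive (path_coord Phi (seg_curve x y) a j) t =
  dpsi x a j 1 (seg x y j t) * (((theta' t)%:C%C : C) * w j).
Proof.
have -> : path_coord Phi (seg_curve x y) a j = psi Phi x a j \o seg x y j.
  by apply/funext => s; rewrite /path_coord /psi /=; congr (Phi a _); apply/funext => b; exact: mc_seg.
have bt := seg_box t j; rewrite mxE in bt.
apply: eder_val; apply: eder_hder; last exact: seg_eder.
by have [] := dpsiP Phi_smooth a (bt : [set v | _] _).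
Qed.

(** [pi / 2] bounds [theta'], and [d k + 1] is a crude bound for the square root of the number [d k]
    of terms in the speed. *)
Lemma seg_length (B e : R) : 0 <= B -> 0 <= e ->
  (forall a j t, nc (dpsi x a j 1 (seg x y j t)) <= B) -> (forall j, nc (w j) <= e) ->
  (riemannian_dist g y x <= (((d * k)%:R + 1) * (B * (pi / 2 * e)))%:E)%E.
Proof.
move=> B0 e0 hB he; have cg := seg_curve_C1.
have p0' : 0 < pi / 2 :> R by rewrite divr_gt0// pi_gt0.
set m := B * (pi / 2 * e).
have m0 : 0 <= m by rewrite mulr_ge0// mulr_ge0// ltW.
have sp t : speed g (seg_curve x y) t <= ((d * k)%:R + 1) * m.
  rewrite (speedE Phi_smooth)//.
  have h : \sum_a \sum_j nc (real_derive (path_coord Phi (seg_curve x y) a j) t) ^+ 2 <=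
      (((d * k)%:R + 1) * m) ^+ 2.
    apply: (@le_trans _ _ (\sum_(a < d) \sum_(j < k) m ^+ 2)).
      apply: ler_sum => a _; apply: ler_sum => j _; rewrite seg_path_coord.
      rewrite lerXn2r ?nnegrE ?nc_ge0// !ncM nc_real /m.
      apply: ler_pM; rewrite ?mulr_ge0 ?nc_ge0// .
      by apply: ler_pM; rewrite ?nc_ge0// theta'_le.
    rewrite !sumr_const !card_ord -mulrnA mulnC -[leLHS]mulr_natl [leRHS]exprMn.
    apply: ler_wpM2r; first exact: sqr_ge0.
    have : 0 <= (d * k)%:R :> R by []. 
    by move: ((d * k)%:R) => n n0; nra.
  by have := ler_wsqrtr h; rewrite sqrtr_sqr ger0_norm// mulr_ge0// addr_ge0.
have [L [dL LE]] := primitive_ex (speed_continuous Phi_smooth cg).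
apply: (@le_trans _ _ (curve_length g (seg_curve x y))).
  apply: ereal_inf_lbound; exists (seg_curve x y) => //.
  by split => //; [exact: seg_curve0|exact: seg_curve1].
rewrite /curve_length LE lee_fin.
have [|||t _ ->] := @MVT_segment R L (speed g (seg_curve x y)) 0 1.
- exact: ler01.
- by move=> t; rewrite in_itv/= => /andP[/ltW t0 /ltW t1]; apply: dL; rewrite t0.
- apply: derivable_within_continuous => t; rewrite in_itv/= => h.
  by case: (dL t h).
by rewrite subr0 mulr1.
Qed.

End OneSegment.

(** Makes a limit of coordinates a limit for the Riemannian distance: near [x] the first derivatives
    are bounded, so a short segment of parameters is a short curve. *)
Lemma dist_small x (e : R) : 0 < e -> exists2 r : R, 0 < r &
  forall y, (forall j b, nc (mc y j b - mc x j b) < r) ->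
    (riemannian_dist g y x < e%:E)%E.
Proof.
move=> e0.
have : nbhs x (cdom hchart x).
  apply: open_nbhs_nbhs; split; first exact: cdom_open.
  have rp j := ldP hchart x j.
  split=> [j|j b]; rewrite subrr nc0; have [/andP[r0 rr] _ _ _ _] := rp j => //.
  exact: lt_le_trans rr.
move=> /nbhs_M[r1 r10 hr1].
pose c j := mc x j (ce hchart x j).
have ex (aj : 'I_d * 'I_k) : exists r : R, 0 < r /\ forall v, nc (v - c aj.2) < r ->
   nc (dpsi x aj.1 aj.2 1 v - dpsi x aj.1 aj.2 1 (c aj.2)) < 1.
  have hc : nc (c aj.2 - c aj.2) < cr hchart x aj.2.
    by rewrite subrr nc0; have [/andP[]] := ldP hchart x aj.2.
  have [_ h _] := dpsiP Phi_smooth aj.1 (hc : [set v | _] _).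
  by have [r ? ?] := hder_cont h ltr01; exists r.
pose r aj := projT1 (cid (ex aj)).
have rP aj : 0 < r aj /\ forall v, nc (v - c aj.2) < r aj ->
   nc (dpsi x aj.1 aj.2 1 v - dpsi x aj.1 aj.2 1 (c aj.2)) < 1.
  by rewrite /r; case: cid.
pose B := 1 + \sum_aj nc (dpsi x aj.1 aj.2 1 (c aj.2)).
have B0 : 0 < B by rewrite ltr_wpDr// sumr_ge0// => *; exact: nc_ge0.
have p0' : 0 < pi / 2 :> R by rewrite divr_gt0// pi_gt0.
pose A := ((d * k)%:R + 1) * (B * (pi / 2)).
have A0 : 0 < A by rewrite mulr_gt0 ?ltr_wpDl// mulr_gt0.
pose r2 := \big[Num.min/1]_aj r aj.
have r20 : 0 < r2.
  by apply: (big_ind (fun u : R => 0 < u)) => // [u v u0 v0|aj _];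
    [rewrite lt_min u0|exact: (rP aj).1].
have e1 : 0 < e / (2 * A) by rewrite divr_gt0// mulr_gt0.
exists (Num.min (Num.min r1 r2) (e / (2 * A))); first by rewrite !lt_min r10 r20.
move=> y hy.
have dy : cdom hchart x y.
  by apply: hr1 => j b; have := hy j b; rewrite !lt_min => /andP[/andP[]].
have hB a j t : nc (dpsi x a j 1 (seg x y j t)) <= B.
  have [_ h] := rP (a, j).
  have {}h : nc (dpsi x a j 1 (seg x y j t) - dpsi x a j 1 (c j)) < 1.
    apply: h; apply: le_lt_trans (seg_dist _ _ _ _) _.
    have := hy j (ce hchart x j); rewrite !lt_min => /andP[/andP[_ h] _].
    by apply: lt_le_trans h _; exact: bigmin_le_cond.
  rewrite -[dpsi _ _ _ _ _](subrK (dpsi x a j 1 (c j))).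
  apply: le_trans (ncD _ _) _; apply: lerD; first exact: ltW.
  rewrite (bigD1 (a, j))//= lerDl; apply: sumr_ge0 => *; exact: nc_ge0.
have he j : nc (mc y j (ce hchart x j) - mc x j (ce hchart x j)) <= e / (2 * A).
  by have := hy j (ce hchart x j); rewrite !lt_min => /andP[_ /ltW].
apply: le_lt_trans (seg_length dy (ltW B0) (ltW e1) hB he) _.
rewrite lte_fin (_ : _ * _ = e / 2).
  by rewrite ltr_pdivrMr// ltr_pMr// ltr1n.
rewrite (_ : _ * _ = A * (e / (2 * A))); last by rewrite /A !mulrA.
by move: (A) A0 => A' A0'; field; rewrite gt_eqF.
Qed.

End UpperBound.

Lemma cauchy_cplx (R : realType) (z : nat -> cplx R) :
  (forall e : R, 0 < e -> exists N, forall i j, (N <= i)%N -> (N <= j)%N ->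
     nc (z i - z j) < e) ->
  exists l, forall e : R, 0 < e -> exists N, forall i, (N <= i)%N -> nc (z i - l) < e.
Proof.
move=> hz.
have key (f : cplx R -> R) : (forall i j, `|f (z i) - f (z j)| <= nc (z i - z j)) ->
    exists l : R, forall e : R, 0 < e -> exists N, forall i, (N <= i)%N -> `|f (z i) - l| < e.
  move=> hf.
  have : cvg ((fun i => f (z i)) @ \oo).
    apply/cauchy_cvgP/cauchy_ballP => e e0; have [N hN] := hz e e0.
    exists ([set x | exists2 i, (N <= i)%N & x = f (z i)],
            [set x | exists2 i, (N <= i)%N & x = f (z i)]).
      by split; exists N => // i /= Ni; exists i.
    move=> [x y] [/= [i Ni ->] [j Nj ->]]; rewrite -ball_normE/=.
    exact: le_lt_trans (hf i j) (hN i j Ni Nj).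
  move=> /cvg_ex[l /cvgrPdist_lt hl]; exists l => e /hl[N _ hN]; exists N => i Ni.
  by rewrite distrC; exact: hN.
have [|a ha] := key (@complex.Re R).
  by move=> i j; rewrite -cReN -cReD; exact: nc_Re.
have [|b hb] := key (@complex.Im R).
  by move=> i j; rewrite -cImN -cImD; exact: nc_Im.
exists (a +i* b)%C => e e0; have e20 : 0 < e / 2 by rewrite divr_gt0.
have [N1 h1] := ha _ e20; have [N2 h2] := hb _ e20.
exists (maxn N1 N2) => i; rewrite geq_max => /andP[/h1 i1 /h2 i2].
apply: le_lt_trans (nc_ReIm _) _; rewrite cReD cImD cReN cImN /= [ltRHS](splitr e).
exact: ltrD.
Qed.

(** * Completeness of the pull-back metric *)

Section Completeness.
Variables (R : realType) (k : nat).
Local Notation C := (cplx R).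
Variable Gam : (bool -> C) -> Prop.
Hypothesis hchart : forall q, Gam q -> exists c, local_chart Gam q c.
Variable p0 : 'rV[C]_(2 * k).
Hypothesis Sp0 : prodS Gam p0.
Local Notation M := (curve_manifold hchart Sp0).

Variables (d : nat) (Phi : 'I_d -> (bool -> C) -> C) (iota : bool -> 'I_d).
Hypothesis Phi_iota : forall b q, Phi (iota b) q = q b.
Hypothesis Phi_smooth : forall a n (U : set C) (phi : bool -> C -> C),
  (forall b, smooth n U (phi b)) -> smooth n U (fun z => Phi a (phi^~ z)).
Local Notation g := (@pullback_metric R k (d * k) M (Xmap Phi)).

Variable K : nat -> (bool -> C) -> Prop.
Hypothesis K_cover : forall q, Gam q -> exists n, K n q.
Hypothesis K_closed : forall n q, (forall e : R, 0 < e -> exists q', [/\ Gam q', K n q' &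
  forall b, nc (q' b - q b) < e]) -> Gam q.
Hypothesis K_labyrinth : forall n0 (B : R), exists J, forall (q : R -> bool -> C) (len : R -> R),
  (forall b, continuous (fun s => nc (q s b))) -> (forall s, Gam (q s)) ->
  (forall s s', 0 <= s -> s <= s' -> s' <= 1 -> forall b,
     nc (q s b - q s' b) <= len s' - len s) ->
  len 1 - len 0 <= B -> K n0 (q 0) -> K J (q 1).

(** A connected set remains connected when one limit point is added, and components are maximal. *)
Lemma comp_closed (p : 'rV[C]_(2 * k)) : prodS Gam p ->
  (forall e : R, 0 < e -> exists x : M, forall j b, nc (mc x j b - crd p j b) < e) ->
  comp Gam p0 p.
Proof.
move=> Sp hp.
have pU (U : set 'rV[C]_(2 * k)) : nbhs p U -> exists2 q, comp Gam p0 q & U q.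
  move=> /nbhs_crd[e e0 eU]; have [x hx] := hp e e0.
  by exists (mval x); [exact: mvalP|exact: eU].
suff : connected (comp Gam p0 `|` [set p]).
  move=> cD; have : comp Gam p0 `|` [set p] `<=` comp Gam p0.
    apply: connected_component_max => //.
      by left; exact: connected_component_refl.
    by move=> q [/compS//|->].
  by apply; right.
have cc : connected (comp Gam p0) by exact: component_connected.
move=> B [b Bb] [V oV BV] [F cF BF].
have sub : forall q, comp Gam p0 q -> B q -> comp Gam p0 `<=` B.
  move=> q cq Bq; have <- : comp Gam p0 `&` B = comp Gam p0.
    apply: cc; first by exists q.
    - exists V => //; rewrite BV; apply/seteqP; split=> z [cz]; first by move=> [].
      by split => //; split => //; left.
    - exists F => //; rewrite BF; apply/seteqP; split=> z [cz]; first by move=> [].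
      by split => //; split => //; left.
  by move=> ? [].
have [q cq Bq] : exists2 q, comp Gam p0 q & B q.
  have Bb' := Bb; rewrite BV in Bb'; case: Bb' => -[cb|bp] Vb; first by exists b.
  have [|q cq Uq] := pU V; first by apply: open_nbhs_nbhs; split => //; rewrite -bp.
  by exists q => //; rewrite BV; split => //; left.
have cB := sub q cq Bq.
apply/seteqP; split=> [y|y [/cB//|->]]; first by rewrite BV => -[].
rewrite BF; split; first by right.
apply: cF => U /pU[z cz Uz]; exists z; split => //.
by have := cB z cz; rewrite BF => -[].
Qed.

Lemma C1_curve_continuous_coord (gamma : R -> M) j b : C1_curve gamma ->
  continuous (fun s => nc (mc (gamma s) j b)).
Proof.
move=> [cg _] t; apply/cvgrPdist_lt => e e0; apply/nbhs_real.
have hn : nbhs (gamma t) [set y : M | forall j b, nc (mc y j b - mc (gamma t) j b) < e].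
  by apply/nbhs_M; exists e.
have /nbhs_real[r r0 h] := cg t _ hn.
exists r => // s /h /(_ j b) hs; rewrite distrC; apply: le_lt_trans hs; exact: nc_dist.
Qed.

(** From some index on, all terms are joined to one of them by curves of length less than 1. In each
    factor the labyrinth, with the bound 2, then confines all these terms to a single [K J], so the
    limit of the coordinates cannot leave the curve. *)
Lemma M_complete : complete_metric g.
Proof.
move=> u hu.
have [N0 hN0] := hu 1 ltr01.
have stay j : exists J, forall i, (N0 <= i)%N -> K J (mc (u i) j).
  have [n hn] := K_cover (mcG (u N0) j).
  have [J hJ] := K_labyrinth n 2; exists J => i Ni.
  have [gamma [L [cg [g0 g1] L1 hL]]] :=
    dist_lt_curve Phi_iota Phi_smooth (hN0 _ _ (leqnn N0) Ni).
  have := hJ (fun s => mc (gamma s) j) (fun s => 2 * L s).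
  rewrite /= g0 g1; apply => //.
  - by move=> b; exact: C1_curve_continuous_coord.
  - by move=> s; exact: mcG.
  - by move=> s s' s0 ss s1 b; exact: hL.
  - by lra.
have cau j b : exists l, forall e : R, 0 < e -> exists N, forall i, (N <= i)%N ->
    nc (mc (u i) j b - l) < e.
  apply: cauchy_cplx => e e0.
  have e20 : 0 < e / 2 by rewrite divr_gt0.
  have [N hN] := hu _ e20; exists N => i i' Ni Ni'.
  have [gamma [L [cg [g0 g1] L1 hL]]] :=
    dist_lt_curve Phi_iota Phi_smooth (hN _ _ Ni Ni').
  have := hL 0 1 (lexx _) ler01 (lexx _) j b; rewrite g0 g1.
  by move=> h; apply: le_lt_trans h _; lra.
pose l j b := projT1 (cid (cau j b)).
have lP j b e : 0 < e -> exists N, forall i, (N <= i)%N -> nc (mc (u i) j b - l j b) < e.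
  by rewrite /l; case: cid => l' h; exact: h.
have lim (e : R) : 0 < e -> exists N, forall i, (N <= i)%N -> forall j b,
    nc (mc (u i) j b - l j b) < e.
  move=> e0; pose N jb := projT1 (cid (lP jb.1 jb.2 e e0)).
  have NP jb : forall i, (N jb <= i)%N -> nc (mc (u i) jb.1 jb.2 - l jb.1 jb.2) < e.
    by rewrite /N; case: cid.
  exists (\max_(jb : 'I_k * bool) N jb) => i hi j b; apply: (NP (j, b)).
  by apply: leq_trans hi; exact: leq_bigmax.
pose p := mk l.
have Sp : prodS Gam p.
  move=> j; have [J hJ] := stay j; rewrite (_ : crd p j = l j); last first.
    by apply/funext => b; exact: crd_mk.
  apply: (@K_closed J) => e /lim[N hN]; exists (mc (u (maxn N N0)) j); split.
  - exact: mcG.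
  - by apply: hJ; exact: leq_maxr.
  - by move=> b; apply: hN; exact: leq_maxl.
have cp : comp Gam p0 p.
  apply: comp_closed => // e /lim[N hN]; exists (u N) => j b; rewrite crd_mk.
  exact: hN.
exists (toM (u 0%N) p) => e e0.
have [r r0 hr] := dist_small Phi_smooth (toM (u 0%N) p : M) e0.
have [N hN] := lim r r0; exists N => i Ni; apply: hr => j b.
by rewrite {2}/mc toMK// crd_mk; exact: hN.
Qed.

End Completeness.

(** * Curvature *)

Section Wirtinger.
Variables (R : realType).
Local Notation C := (cplx R).

(** [A] and [B] are the derivatives by [z] and by [zbar] at [v], encoded by all directional
    derivatives at once so that the rules for [eder] carry over. *)
Definition wirt (h : C -> C) (v A B : C) := forall c : C,
  eder (fun t => h (v + (t%:C%C : C) * c)) 0 (A * c + B * c^*).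

Lemma wirt_hder h v a : hder h v a -> wirt h v a 0.
Proof.
move=> hh c; rewrite mul0r addr0.
apply: (@eder_hder R h (fun t => v + (t%:C%C : C) * c)); last exact: eder_line.
by rewrite mul0r addr0.
Qed.

Lemma wirt_conj h v A B : wirt h v A B -> wirt (fun z => (h z)^*) v B^* A^*.
Proof.
move=> hh c; have := eder_conj (hh c).
by rewrite rmorphD !rmorphM/= conjCK addrC.
Qed.

Lemma wirtM f h v A B A' B' : wirt f v A B -> wirt h v A' B' ->
  wirt (fun z => f z * h z) v (A * h v + f v * A') (B * h v + f v * B').
Proof.
move=> hf hh c; have := ederM (hf c) (hh c); rewrite !mul0r !addr0.
by rewrite (_ : (A * c + B * c^*) * h v + _ = (A * h v + f v * A') * c + (B * h v + f v * B') * c^*)//; ring.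
Qed.

Lemma wirt_sum (I : Type) (r : seq I) (f : I -> C -> C) v (A B : I -> C) :
  (forall i, wirt (f i) v (A i) (B i)) ->
  wirt (fun z => \sum_(i <- r) f i z) v (\sum_(i <- r) A i) (\sum_(i <- r) B i).
Proof.
move=> hf c; rewrite !mulr_suml -big_split/=.
exact: (@eder_sum R I r (fun i t => f i (v + (t%:C%C : C) * c)) 0 _ (fun i => hf i c)).
Qed.

Lemma wirtV h v A B : h v != 0 -> wirt h v A B ->
  wirt (fun z => (h z)^-1) v (- A / h v ^+ 2) (- B / h v ^+ 2).
Proof.
move=> h0 hh c.
have hv : hder (fun z : C => z^-1) (h v) (- 1 / h v ^+ 2) by exact: hderV (hder_id _).
have := @eder_hder R (fun z => z^-1) (fun t => h (v + (t%:C%C : C) * c)) 0 _ _ _ (hh c).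
rewrite mul0r addr0 => /(_ _ hv).
rewrite (_ : -1 / h v ^+ 2 * (A * c + B * c^*) = - A / h v ^+ 2 * c + - B / h v ^+ 2 * c^*)//.
by field.
Qed.

Lemma wirt_dz k (f : 'rV[C]_k -> C) (h : C -> C) (z : 'rV[C]_k) j l A B :
  (\forall w \near z, f w = h (w 0 j)) -> wirt h (z 0 j) A B ->
  dz l f z = (l == j)%:R * A /\ dzbar l f z = (l == j)%:R * B.
Proof.
move=> /nbhs_rVcplx[e e0 fh] hh.
have key (c : C) : nc c = 1 -> real_derive_along f z (c *: delta_mx 0 l) =
    (l == j)%:R * (A * c + B * c^*).
  move=> c1; apply: eder_val.
  pose c' := c * (l == j)%:R.
  have cE : c'^* = c^* * (l == j)%:R by rewrite rmorphM/= conjC_nat.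
  have := hh c'; rewrite (_ : A * c' + B * c'^* = (l == j)%:R * (A * c + B * c^*)); last first.
    by rewrite cE /c'; ring.
  apply: (eder_near e0) => t; rewrite subr0 => te.
  rewrite fh; last first.
    move=> i; rewrite !mxE eqxx/= addrAC subrr add0r !ncM c1 mul1r nc_real nc_nat.
    by case: eqP => _ /=; rewrite ?mulr1// mulr0.
  by rewrite !mxE eqxx/= /c' (eq_sym l).
rewrite /dz /dzbar -{1 3}(scale1r (delta_mx 0 l)) !key ?nc1//; last first.
  by rewrite ncE /= expr0n add0r expr1n sqrtr1.
have ii : ('i : C) * 'i = -1 by rewrite -expr2 sqrCi.
rewrite rmorph1 conjCi !mulr1.
have E1 : 'i * ((l == j)%:R * (A * 'i + B * - 'i)) = (l == j)%:R * (B - A).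
  by rewrite mulrN -mulrBl mulrC -!mulrA ii; ring.
by rewrite E1; split; field.
Qed.

Definition dgm k (f : 'I_k -> C) : 'M[C]_k := \matrix_(i, j) ((i == j)%:R * f j).

Lemma dgm_mul k (f h : 'I_k -> C) : dgm f *m dgm h = dgm (fun j => f j * h j).
Proof.
apply/matrixP => i j; rewrite !mxE (bigD1 i)//= big1 ?addr0.
  rewrite !mxE eqxx mul1r; have [->//|] := eqVneq i j; first by rewrite !mul1r.
  by rewrite !mul0r mulr0.
by move=> l li; rewrite mxE eq_sym (negbTE li) !mul0r.
Qed.

Lemma dgm_unit k (f : 'I_k -> C) : (forall j, f j != 0) -> dgm f \in unitmx.
Proof.
move=> f0; have h : dgm f *m dgm (fun j => (f j)^-1) = 1%:M.
  rewrite dgm_mul; apply/matrixP => i j; rewrite !mxE divff ?mulr1//.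
by case: (mulmx1_unit h).
Qed.

Lemma herm_dgm k (f : 'I_k -> C) (v : 'rV[C]_k) :
  herm (dgm f) v v = \sum_j f j * (v 0 j * (v 0 j)^*).
Proof.
apply: eq_bigr => i _; rewrite (bigD1 i)//= big1 ?addr0.
  by rewrite mxE eqxx mul1r mulrA.
by move=> l li; rewrite mxE eq_sym (negbTE li) !mul0r.
Qed.

End Wirtinger.

Section Curvature.
Variables (R : realType) (k : nat).
Local Notation C := (cplx R).
Variable Gam : (bool -> C) -> Prop.
Hypothesis hchart : forall q, Gam q -> exists c, local_chart Gam q c.
Variable p0 : 'rV[C]_(2 * k).
Hypothesis Sp0 : prodS Gam p0.
Local Notation M := (curve_manifold hchart Sp0).

Variables (d : nat) (Phi : 'I_d -> (bool -> C) -> C) (iota : bool -> 'I_d).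
Hypothesis Phi_iota : forall b q, Phi (iota b) q = q b.
Hypothesis Phi_smooth : forall a n (U : set C) (phi : bool -> C -> C),
  (forall b, smooth n U (phi b)) -> smooth n U (fun z => Phi a (phi^~ z)).

Local Notation dpsi := (dpsi Phi_smooth).
Local Notation pchart := (pchart hchart (p0 := p0)).
Variable x : M.
Local Notation G := (@pullback_metric R k (d * k) M (Xmap Phi) (pchart x)).
Local Notation disc j := [set v : C | nc (v - mc x j (ce hchart x j)) < cr hchart x j].

Local Notation mm := (metric Phi_smooth x).
(** [mP] is the [z]-derivative of the metric coefficient and [mS] its mixed second derivative;
    [mS mm - |mP|^2] is the Gram determinant of the first two derivatives of the curve. *)
Definition mP j v : C := \sum_a dpsi x a j 2 v * (dpsi x a j 1 v)^*.
Definition mS j v : C := \sum_a dpsi x a j 2 v * (dpsi x a j 2 v)^*.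

Lemma mmE j v : mm j v = (\sum_a nc (dpsi x a j 1 v) ^+ 2)%:C%C.
Proof. by rewrite rmorph_sum; apply: eq_bigr => a _; rewrite rmorphXn/= nc_norm normCK. Qed.

Lemma mSE j v : mS j v = (\sum_a nc (dpsi x a j 2 v) ^+ 2)%:C%C.
Proof. by rewrite rmorph_sum; apply: eq_bigr => a _; rewrite rmorphXn/= nc_norm normCK. Qed.

Lemma mm_gt0 j v : disc j v -> 0 < \sum_a nc (dpsi x a j 1 v) ^+ 2.
Proof.
move=> hv; rewrite (bigD1 (iota (ce hchart x j)))//= dpsi_param// nc1 expr1n.
by rewrite ltr_wpDr// sumr_ge0// => a _; exact: sqr_ge0.
Qed.

Lemma mm_neq0 j v : disc j v -> mm j v != 0.
Proof. by move=> /mm_gt0 h; rewrite mmE gt_eqF// (@ltcR R 0). Qed.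

Lemma mm_wirt j v : disc j v -> wirt (mm j) v (mP j v) (mP j v)^*.
Proof.
move=> hv; have -> : (mP j v)^* = \sum_a dpsi x a j 1 v * (dpsi x a j 2 v)^*.
  by rewrite rmorph_sum; apply: eq_bigr => a _; rewrite rmorphM/= conjCK mulrC.
apply: wirt_sum => a; have [_ h _] := dpsiP Phi_smooth a hv.
have := wirtM (wirt_hder h) (wirt_conj (wirt_hder h)).
by rewrite rmorph0 mulr0 addr0 mul0r add0r.
Qed.

Lemma mP_wirt j v : disc j v -> exists A, wirt (mP j) v A (mS j v).
Proof.
move=> hv; exists (\sum_a dpsi x a j 3 v * (dpsi x a j 1 v)^*).
apply: wirt_sum => a; have [_ h1 h2] := dpsiP Phi_smooth a hv.
have := wirtM (wirt_hder h2) (wirt_conj (wirt_hder h1)).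
by rewrite rmorph0 mulr0 addr0 mul0r add0r.
Qed.

Lemma metricE v : lbox hchart x v -> G v = dgm (fun j => mm j (v 0 j)).
Proof. by move=> bv; rewrite (pullbackE Phi_smooth). Qed.

Lemma near_entry (z : 'rV[C]_k) (F : 'rV[C]_k -> 'M[C]_k) (h : 'I_k -> C -> C) i j :
  lbox hchart x z -> (forall w, lbox hchart x w -> F w = dgm (fun j => h j (w 0 j))) ->
  \forall w \near z, F w i j = (fun v => (i == j)%:R * h j v) (w 0 j).
Proof. by move=> bz hF; apply: filterS (lbox_near bz) => w /hF ->; rewrite mxE. Qed.

Lemma wirt_scale (c : C) (h : C -> C) v A B :
  wirt h v A B -> wirt (fun z => c * h z) v (c * A) (c * B).
Proof.
move=> hh; have := wirtM (wirt_hder (hder_cst c v)) hh.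
by rewrite !mul0r !add0r.
Qed.

Lemma dz_dgm (F : 'rV[C]_k -> 'M[C]_k) (h A B : 'I_k -> C -> C) l z : lbox hchart x z ->
  (forall w, lbox hchart x w -> F w = dgm (fun j => h j (w 0 j))) ->
  (forall j v, disc j v -> wirt (h j) v (A j v) (B j v)) ->
  dz_mx l F z = dgm (fun j => (l == j)%:R * A j (z 0 j)) /\
  dzbar_mx l F z = dgm (fun j => (l == j)%:R * B j (z 0 j)).
Proof.
move=> bz hF hh.
have key i j := wirt_dz l (near_entry i j bz hF) (wirt_scale (i == j)%:R (hh j _ (bz j))).
split; apply/matrixP => i j; rewrite !mxE; have [e1 e2] := key i j.
  by rewrite e1; ring.
by rewrite e2; ring.
Qed.

Lemma christoffelE l z : lbox hchart x z ->
  christoffel G l z = dgm (fun j => (l == j)%:R * (mP j (z 0 j) / mm j (z 0 j))).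
Proof.
move=> bz; rewrite /christoffel.
have [-> _] := @dz_dgm G mm mP (fun j v => (mP j v)^*) l z bz metricE mm_wirt.
rewrite metricE//; set D := dgm (fun j => mm j _).
have uD : D \in unitmx by apply: dgm_unit => j; apply: mm_neq0; exact: bz.
apply: (canLR (mulmxK uD)); rewrite dgm_mul; congr dgm; apply/funext => j.
by rewrite -mulrA divfK//; apply: mm_neq0; exact: bz.
Qed.

(** The curvature is diagonal like the metric: each factor contributes minus [mm] times the
    [zbar]-derivative of its Christoffel symbol [mP / mm]. *)
Lemma kahlerE l m z : lbox hchart x z ->
  kahler_curvature G l m z = dgm (fun j => (l == j)%:R * (m == j)%:R *
    - ((mS j (z 0 j) * mm j (z 0 j) - mP j (z 0 j) * (mP j (z 0 j))^*) / mm j (z 0 j))).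
Proof.
move=> bz; rewrite /kahler_curvature.
have ex j v : exists A, disc j v ->
    wirt (fun v => (l == j)%:R * (mP j v / mm j v)) v A
      ((l == j)%:R * ((mS j v * mm j v - mP j v * (mP j v)^*) / mm j v ^+ 2)).
  have [hv|hv] := pselect (disc j v); last by exists 0.
  have [A hA] := mP_wirt hv.
  have h0 := mm_neq0 hv.
  have := wirtM hA (wirtV h0 (mm_wirt hv)) => h.
  have {}h := wirt_scale (l == j)%:R h; eexists => _.
  rewrite (_ : (mS j v * mm j v - mP j v * (mP j v)^*) / mm j v ^+ 2 =
    mS j v * (mm j v)^-1 + mP j v * (- (mP j v)^* / mm j v ^+ 2)); first exact: h.
  by field.
pose A j v := projT1 (cid (ex j v)).
have hA j v : disc j v -> wirt (fun v => (l == j)%:R * (mP j v / mm j v)) v (A j v)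
      ((l == j)%:R * ((mS j v * mm j v - mP j v * (mP j v)^*) / mm j v ^+ 2)).
  by rewrite /A; case: cid.
have [_ ->] := @dz_dgm (christoffel G l) _ _ _ m z bz (@christoffelE l) hA.
rewrite metricE// dgm_mul; apply/matrixP => i j; rewrite !mxE.
have h0 := mm_neq0 (bz j); move: (mm j (z 0 j)) h0 => t t0.
by field.
Qed.

Lemma hscE z v : lbox hchart x z ->
  holomorphic_sectional_curvature G z v =
  - 2 * (\sum_j (((\sum_a nc (dpsi x a j 2 (z 0 j)) ^+ 2) * (\sum_a nc (dpsi x a j 1 (z 0 j)) ^+ 2) -
      nc (mP j (z 0 j)) ^+ 2) / (\sum_a nc (dpsi x a j 1 (z 0 j)) ^+ 2)) * (nc (v 0 j) ^+ 2) ^+ 2)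
   / (\sum_j (\sum_a nc (dpsi x a j 1 (z 0 j)) ^+ 2) * nc (v 0 j) ^+ 2) ^+ 2.
Proof.
move=> bz; rewrite /holomorphic_sectional_curvature.
congr (_ / _ ^+ 2); last first.
  rewrite (sqnorm_pullback Phi_smooth)// exchange_big/=; apply: eq_bigr => j _.
  by rewrite mulr_suml.
rewrite mulNr -mulrN; congr (2 * _).
have sqE (w : C) : (nc w ^+ 2)%:C%C = w * w^* :> C by rewrite rmorphXn/= nc_norm normCK.
pose r j := ((\sum_a nc (dpsi x a j 2 (z 0 j)) ^+ 2) * (\sum_a nc (dpsi x a j 1 (z 0 j)) ^+ 2) -
      nc (mP j (z 0 j)) ^+ 2) / (\sum_a nc (dpsi x a j 1 (z 0 j)) ^+ 2).
rewrite -[RHS]/(complex.Re ((- \sum_j r j * (nc (v 0 j) ^+ 2) ^+ 2)%:C%C)); congr complex.Re.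
have rE j : (r j)%:C%C = (mS j (z 0 j) * mm j (z 0 j) - mP j (z 0 j) * (mP j (z 0 j))^*) / mm j (z 0 j) :> C.
  by rewrite mmE mSE -sqE /r rmorphM/= rmorphB rmorphM/= fmorphV.
rewrite rmorphN rmorph_sum/= -sumrN.
transitivity (\sum_l \sum_m \sum_j (l == j)%:R * (m == j)%:R *
     (v 0 l * (v 0 m)^* * (v 0 j * (v 0 j)^*) * - (r j)%:C%C)).
  apply: eq_bigr => l _; apply: eq_bigr => m _; rewrite kahlerE// herm_dgm mulr_sumr.
  by apply: eq_bigr => j _; rewrite -rE; move: ((r j)%:C%C : C) => rj; ring.
under eq_bigr => l _ do rewrite exchange_big/=.
rewrite exchange_big/=; apply: eq_bigr => j _.
rewrite (bigD1 j)//= [X in _ + X]big1 ?addr0; last first.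
  by move=> l lj; apply: big1 => m _; rewrite (negbTE lj) !mul0r.
rewrite (bigD1 j)//= [X in _ + X]big1 ?addr0; last first.
  by move=> m mj; rewrite (negbTE mj) mulr0 mul0r.
rewrite !eqxx !mul1r; move: (r j) => rj.
rewrite (rmorphM (real_complex R)) (rmorphXn (real_complex R))/= sqE.
by rewrite expr2; ring.
Qed.

End Curvature.

(** * Algebraic inequalities for the curvature bound *)

Section Inequalities.
Variable R : realType.
Local Notation C := (cplx R).

(* Lagrange's identity expresses the difference as the sum of the squares of
   all six minors. *)
Lemma lagrange4 (u0 u1 u2 u3 w0 w1 w2 w3 : C) :
  nc (u0 * w2 - u2 * w0) ^+ 2 + nc (u1 * w3 - u3 * w1) ^+ 2 <=
  (nc w0 ^+ 2 + nc w1 ^+ 2 + nc w2 ^+ 2 + nc w3 ^+ 2) *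
    (nc u0 ^+ 2 + nc u1 ^+ 2 + nc u2 ^+ 2 + nc u3 ^+ 2) -
  nc (w0 * u0^* + w1 * u1^* + w2 * u2^* + w3 * u3^*) ^+ 2.
Proof.
suff -> : (nc w0 ^+ 2 + nc w1 ^+ 2 + nc w2 ^+ 2 + nc w3 ^+ 2) *
    (nc u0 ^+ 2 + nc u1 ^+ 2 + nc u2 ^+ 2 + nc u3 ^+ 2) -
  nc (w0 * u0^* + w1 * u1^* + w2 * u2^* + w3 * u3^*) ^+ 2 =
  nc (u0 * w2 - u2 * w0) ^+ 2 + nc (u1 * w3 - u3 * w1) ^+ 2 +
  (nc (u0 * w1 - u1 * w0) ^+ 2 + nc (u0 * w3 - u3 * w0) ^+ 2 +
   nc (u1 * w2 - u2 * w1) ^+ 2 + nc (u2 * w3 - u3 * w2) ^+ 2).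
  by rewrite lerDl !addr_ge0// sqr_ge0.
apply: (fmorph_inj (real_complex R)).
have sqE (w : C) : (nc w ^+ 2)%:C%C = w * w^* :> C.
  by rewrite (rmorphXn (real_complex R))/= nc_norm normCK.
rewrite (rmorphB (real_complex R)) (rmorphM (real_complex R)) !(rmorphD (real_complex R)) /= !sqE.
rewrite !(rmorphD, rmorphB, rmorphM)/= !conjCK.
by ring.
Qed.

Lemma sqr_sum_le k (b : 'I_k -> R) : (\sum_j b j) ^+ 2 <= k%:R * \sum_j b j ^+ 2.
Proof.
case: k b => [|k] b; first by rewrite !big_ord0 expr0n mulr0.
set S := \sum_j b j; set Q := \sum_j b j ^+ 2.
have n0 : 0 < k.+1%:R :> R by rewrite ltr0n.
have : 0 <= \sum_j (k.+1%:R * b j - S) ^+ 2 by apply: sumr_ge0 => j _; exact: sqr_ge0.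
rewrite (eq_bigr (fun j => k.+1%:R ^+ 2 * b j ^+ 2 + (- (2 * k.+1%:R * S) * b j + S ^+ 2))).
  rewrite !big_split/= -!mulr_sumr sumr_const card_ord -/S -/Q -[S *+ k.+1]mulr_natl.
  clearbody S Q; move: (k.+1%:R) n0 => n n0 h; rewrite -(ler_pM2l n0); lra.
by move=> j _; ring.
Qed.

(* With [p = |a0|^2] and [q = |a1|^2] the two minors kept are [2 a0^3] and
   [2 a1^3], and [(p + q)^3 <= 4 (p^3 + q^3)]. *)
Lemma square_map_curvature (f0 f1 a0 a1 b0 b1 : C) : nc f0 <= 1 -> nc f1 <= 1 ->
  let m := nc a0 ^+ 2 + nc a1 ^+ 2 + nc (2 * f0 * a0) ^+ 2 + nc (2 * f1 * a1) ^+ 2 in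
  let c0 := 2 * a0 ^+ 2 + 2 * f0 * b0 in
  let c1 := 2 * a1 ^+ 2 + 2 * f1 * b1 in
  0 < m ->
  m ^+ 2 / 125 <= ((nc b0 ^+ 2 + nc b1 ^+ 2 + nc c0 ^+ 2 + nc c1 ^+ 2) * m -
    nc (b0 * a0^* + b1 * a1^* + c0 * (2 * f0 * a0)^* + c1 * (2 * f1 * a1)^*) ^+ 2) / m.
Proof.
move=> F0 F1 m c0 c1 m0; rewrite ler_pdivlMr//.
have := lagrange4 a0 a1 (2 * f0 * a0) (2 * f1 * a1) b0 b1 c0 c1.
apply: le_trans.
rewrite /c0 /c1 (_ : a0 * (2 * a0 ^+ 2 + 2 * f0 * b0) - 2 * f0 * a0 * b0 = 2 * a0 ^+ 3); last by ring.
rewrite (_ : a1 * (2 * a1 ^+ 2 + 2 * f1 * b1) - 2 * f1 * a1 * b1 = 2 * a1 ^+ 3); last by ring.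
have mE : m = nc a0 ^+ 2 * (1 + 4 * nc f0 ^+ 2) + nc a1 ^+ 2 * (1 + 4 * nc f1 ^+ 2).
  by rewrite /m !ncM nc_nat; ring.
clearbody m; clear c0 c1.
rewrite (ncM 2 (a0 ^+ 3)) (ncM 2 (a1 ^+ 3)) !ncX nc_nat.
rewrite (_ : (2 * nc a0 ^+ 3) ^+ 2 + (2 * nc a1 ^+ 3) ^+ 2 =
   4 * ((nc a0 ^+ 2) ^+ 3 + (nc a1 ^+ 2) ^+ 3)); last by ring.
have p0 := sqr_ge0 (nc a0); have q0 := sqr_ge0 (nc a1).
have f00 : nc f0 ^+ 2 <= 1 by rewrite expr_le1// nc_ge0.
have f10 : nc f1 ^+ 2 <= 1 by rewrite expr_le1// nc_ge0.
move: (nc a0 ^+ 2) (nc a1 ^+ 2) (nc f0 ^+ 2) (nc f1 ^+ 2) p0 q0 f00 f10 mE => p q s t p0 q0 s1 t1 mE.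
(* Because [1 + 4 |f|^2 <= 5]; the cube of this 5 is the constant 125. *)
have m5 : m <= 5 * (p + q) by rewrite mE; nra.
have m3 : m ^+ 3 <= (5 * (p + q)) ^+ 3.
  by rewrite lerXn2r ?nnegrE//; [exact: ltW|rewrite mulr_ge0// addr_ge0].
have pq : (p + q) ^+ 3 <= 4 * (p ^+ 3 + q ^+ 3).
  rewrite -subr_ge0 (_ : _ - _ = 3 * (p + q) * (p - q) ^+ 2); last by ring.
  by rewrite mulr_ge0 ?sqr_ge0// mulr_ge0// addr_ge0.
rewrite (_ : m ^+ 2 / 125 * m = m ^+ 3 / 125); last by field.
by move: m3; rewrite exprMn; lra.
Qed.

End Inequalities.

Section SquareMap.
Variable R : realType.
Local Notation C := (cplx R).

(** [s] tells whether the component is squared, [b] which coordinate it comes from. *)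
Definition o4 (s b : bool) : 'I_4 := inord (2 * s + b).

Lemma o4E (s b : bool) : o4 s b = (2 * s + b)%N :> nat.
Proof. by rewrite inordK//; case: s; case: b. Qed.

Lemma sum_I4 (V : nmodType) (f : 'I_4 -> V) :
  \sum_a f a = f (o4 false false) + f (o4 false true) + f (o4 true false) + f (o4 true true).
Proof.
rewrite !big_ord_recl big_ord0 addr0 !addrA.
by congr (f _ + f _ + f _ + f _); apply: val_inj; rewrite /= o4E.
Qed.

Definition Phi4 (a : 'I_4) (q : bool -> C) : C :=
  if (a < 2)%N then q (odd a) else q (odd a) ^+ 2.

Lemma Phi4E s b q : Phi4 (o4 s b) q = if s then q b ^+ 2 else q b.
Proof. by rewrite /Phi4 o4E; case: s; case: b. Qed.

Lemma Phi4_smooth a n (U : set C) (phi : bool -> C -> C) :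
  (forall b, smooth n U (phi b)) -> smooth n U (fun z => Phi4 a (phi^~ z)).
Proof. by move=> h; rewrite /Phi4; case: (a < 2)%N; [exact: h|exact: (smoothM (h _) (h _))]. Qed.

Variable k : nat.
Variable Gam : (bool -> C) -> Prop.
Hypothesis hchart : forall q, Gam q -> exists c, local_chart Gam q c.
Variable p0 : 'rV[C]_(2 * k).
Hypothesis Sp0 : prodS Gam p0.
Hypothesis Gam_bounded : forall q b, Gam q -> nc (q b) <= 1.
Local Notation M := (curve_manifold hchart Sp0).
Local Notation dpsi := (dpsi Phi4_smooth).

Lemma Phi4_iota b q : Phi4 (o4 false b) q = q b.
Proof. exact: Phi4E. Qed.

Section Local.
Variables (x : M) (j : 'I_k).
Local Notation disc := [set v : C | nc (v - mc x j (ce hchart x j)) < cr hchart x j].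
Local Notation f b := (cphi hchart x j b).
Local Notation D b n := (dpsi x (o4 false b) j n).

Lemma disc_near v : disc v -> exists2 e : R, 0 < e & forall v', nc (v' - v) < e -> disc v'.
Proof.
move=> hv; exists (cr hchart x j - nc (v - mc x j (ce hchart x j))); first by rewrite subr_gt0.
move=> v' h; have := ncD (v' - v) (v - mc x j (ce hchart x j)); rewrite addrA subrK /=.
by move: h; lra.
Qed.

Lemma f_hder b v : disc v -> hder (f b) v (D b 1 v).
Proof.
move=> /(dpsiP Phi4_smooth (o4 false b))[h _ _].
by rewrite (_ : f b = psi Phi4 x (o4 false b) j)//; apply/funext => z; rewrite /psi Phi4E.
Qed.

Lemma dpsi_sq1 b v : disc v -> dpsi x (o4 true b) j 1 v = 2 * f b v * D b 1 v.
Proof.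
move=> hv; have [h _ _] := dpsiP Phi4_smooth (o4 true b) hv.
have h' := hderM (f_hder b hv) (f_hder b hv).
rewrite (_ : psi _ _ _ _ = fun z => f b z * f b z) in h; last first.
  by apply/funext => z; rewrite /psi Phi4E expr2.
by rewrite (hder_uniq h h'); ring.
Qed.

(** Differentiates [dpsi_sq1], an identity on the whole disc, and concludes by uniqueness of the
    derivative. *)
Lemma dpsi_sq2 b v : disc v ->
  dpsi x (o4 true b) j 2 v = 2 * D b 1 v ^+ 2 + 2 * f b v * D b 2 v.
Proof.
move=> hv; have [_ h _] := dpsiP Phi4_smooth (o4 true b) hv.
have [_ h2 _] := dpsiP Phi4_smooth (o4 false b) hv.
have h' := hderM (hderM (hder_cst 2 v) (f_hder b hv)) h2.
have [e e0 he] := disc_near hv.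
have {}h := hder_near e0 (fun v' hv' => dpsi_sq1 b (he v' hv')) h.
by rewrite (hder_uniq h h'); ring.
Qed.

End Local.

(** With no mixed terms, each factor contributes at least [(m_j t_j)^2 / 125], and the
    Cauchy-Schwarz inequality over the [k] factors accounts for [k] in the constant. *)
Lemma hsc_Phi4 : (0 < k)%N ->
  strongly_negative_hsc (@pullback_metric R k (4 * k) M (Xmap Phi4)).
Proof.
move=> k0; have k0' : 0 < k%:R :> R by rewrite ltr0n.
exists (2 / (125 * k%:R)); first by rewrite divr_gt0// mulr_gt0.
move=> c /atlasP[x ->] z; rewrite /chart_img cimg => bz v v0.
rewrite (hscE Phi4_iota Phi4_smooth)//.
pose m j := \sum_a nc (dpsi x a j 1 (z 0 j)) ^+ 2.
have m0 j : 0 < m j by exact: (mm_gt0 Phi4_iota Phi4_smooth (bz j)).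
pose t j := nc (v 0 j) ^+ 2.
have t0 j : 0 <= t j by exact: sqr_ge0.
pose r j := ((\sum_a nc (dpsi x a j 2 (z 0 j)) ^+ 2) * m j -
  nc (mP Phi4_smooth x j (z 0 j)) ^+ 2) / m j.
change (- 2 * (\sum_j r j * t j ^+ 2) / (\sum_j m j * t j) ^+ 2 <= - (2 / (125 * k%:R))).
have rm j : m j ^+ 2 / 125 <= r j.
  have hb := bz j; have Gb b : nc (cphi hchart x j b (z 0 j)) <= 1.
    have [_ _ _ h _] := ldP hchart x j.
    exact: (Gam_bounded b (h _ hb).1).
  have := @square_map_curvature R _ _ (dpsi x (o4 false false) j 1 (z 0 j))
    (dpsi x (o4 false true) j 1 (z 0 j)) (dpsi x (o4 false false) j 2 (z 0 j))
    (dpsi x (o4 false true) j 2 (z 0 j)) (Gb false) (Gb true).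
  have := m0 j; rewrite /r /m /mP !sum_I4 !dpsi_sq1// !dpsi_sq2// => h hh.
  exact: hh h.
have S0 : 0 < \sum_j m j * t j.
  have [j vj] : exists j, v 0 j != 0.
    apply/existsP; apply: contraNT v0; rewrite negb_exists => /forallP h.
    by apply/eqP/rowP => j; rewrite mxE; apply/eqP; have := h j; rewrite negbK.
  rewrite (bigD1 j)//= ltr_pwDl//; last by apply: sumr_ge0 => i _; rewrite mulr_ge0// ltW.
  by rewrite mulr_gt0// exprn_gt0// nc_gt0.
have h1 : \sum_j (m j * t j) ^+ 2 / 125 <= \sum_j r j * t j ^+ 2.
  apply: ler_sum => j _; rewrite exprMn mulrAC; apply: ler_wpM2r => //; exact: sqr_ge0.
have h2 := sqr_sum_le (fun j => m j * t j).
rewrite -mulr_suml in h1.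
rewrite mulNr mulNr lerN2 ler_pdivlMr ?exprn_gt0//.
move: (\sum_j (m j * t j) ^+ 2) (\sum_j m j * t j) (\sum_j r j * t j ^+ 2) h1 h2 => Q S T h1 h2.
rewrite -mulrA ler_pM2l// mulrC ler_pdivrMr ?mulr_gt0//.
by apply: le_trans h2 _; move: h1; rewrite ler_pdivrMr// => h1; nra.
Qed.

End SquareMap.

Lemma qder_zero_closed (R : realType) (F Fz Fw : cplx R -> cplx R -> cplx R) z w :
  qder F Fz Fw z w ->
  (forall e : R, 0 < e -> exists z' w', [/\ nc (z' - z) < e, nc (w' - w) < e & F z' w' = 0]) ->
  F z w = 0.
Proof.
move=> [d d0 [M M0 hM]] h.
apply/eqP; rewrite -nc_eq0 eq_le nc_ge0 andbT; apply/ler_addgt0Pr => e e0; rewrite add0r.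
pose B := nc (Fz z w) + nc (Fw z w) + 4 * M + 1.
have B0 : 0 < B by rewrite ltr_wpDl// !addr_ge0 ?nc_ge0// mulr_ge0.
have m0 : 0 < Num.min (Num.min d 1) (e / B) by rewrite !lt_min d0 ltr01 divr_gt0.
have [z' [w' [hz hw F0]]] := h _ m0.
move: hz hw; rewrite !lt_min => /andP[/andP[z1 z2] z3] /andP[/andP[w1 w2] w3].
have dz : nc (z - z) < d by rewrite subrr nc0.
have dw : nc (w - w) < d by rewrite subrr nc0.
have := hM z w z' w' dz dw z1 w1; rewrite F0 => hh.
have E : F z w = - ((0 - F z w - Fz z w * (z' - z) - Fw z w * (w' - w)) +
  (Fz z w * (z' - z) + Fw z w * (w' - w))) by ring.
rewrite E ncN; apply: le_trans (ncD _ _) _.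
apply: le_trans (lerD hh (ncD _ _)) _; rewrite !ncM.
have r0 : 0 < e / B by rewrite divr_gt0.
rewrite [leRHS](_ : e = B * (e / B)); last by rewrite mulrC divfK// gt_eqF.
rewrite /B; move: (e / B) r0 z3 w3 => r r0 z3 w3.
have sq : (nc (z' - z) + nc (w' - w)) ^+ 2 <= 4 * r.
  have := nc_ge0 (z' - z); have := nc_ge0 (w' - w); nra.
have := ler_wpM2l M0 sq.
have := ler_wpM2l (nc_ge0 (Fz z w)) (ltW z3).
have := ler_wpM2l (nc_ge0 (Fw z w)) (ltW w3).
lra.
Qed.

Section Phi2.
Variable R : realType.
Local Notation C := (cplx R).

Definition Phi2 (a : 'I_2) (q : bool -> C) : C := q (a == ord_max).

Lemma Phi2_iota b q : Phi2 (ib b) q = q b.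
Proof. by case: b. Qed.

Lemma Phi2_smooth a n (U : set C) (phi : bool -> C -> C) :
  (forall b, smooth n U (phi b)) -> smooth n U (fun z => Phi2 a (phi^~ z)).
Proof. by move=> h; exact: h. Qed.

End Phi2.

Theorem corollary1p2 (R : realType) (k : nat) (hk : (1 <= k)%N) :
  (exists (M : complex_manifold R k) (X : M -> 'rV[cplx R]_(2 * k)),
     complete_bounded_embedding X)
  /\
  (exists (M : complex_manifold R k) (X : M -> 'rV[cplx R]_(4 * k)),
     complete_bounded_embedding X /\
     strongly_negative_hsc (pullback_metric X)).
Proof.
have [Om [G [F [Fz [Fw [K [[dG oOm] [GF GFz GFw hq] [reg [z0 [w0 [Om0 F0]]]]
  [bnd KOm Kc] lab]]]]]]] := labyrinth_curve R.
pose Gam (q : bool -> cplx R) := Om (q false) (q true) /\ F (q false) (q true) = 0.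
have hchart q : Gam q -> exists c, local_chart Gam q c.
  move=> [Omq Fq].
  have [e [phi [r [rho [h1 h2 h3 h4 h5]]]]] :=
    curve_chart dG oOm GF GFz GFw hq Omq Fq (reg _ _ Omq Fq).
  exists (e, phi, (r, rho)); split => //=.
  - by move=> v /h4[].
  - by move=> q' [_ Fq']; exact: h5.
pose p0 := mk (fun (j : 'I_k) b => if b then w0 else z0).
have Sp0 : prodS Gam p0 by move=> j; rewrite /Gam !crd_mk.
have Gb q b : Gam q -> nc (q b) <= 1 by move=> [/bnd[? ?] _]; case: b.
pose K' n (q : bool -> cplx R) := K n (q false) (q true).
have K_cover q : Gam q -> exists n, K' n q by move=> [/KOm].
have K_closed n q : (forall e : R, 0 < e -> exists q', [/\ Gam q', K' n q' &
    forall b, nc (q' b - q b) < e]) -> Gam q.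
  (* The limit is first placed in [Om]; only then is [F] known to be continuous there and the
     equation can pass to the limit. *)
  move=> h; have Oq : Om (q false) (q true).
    by apply: (Kc n) => e /h[q' [_ Kq hq']]; exists (q' false), (q' true).
  split => //; apply: qder_zero_closed (hq _ _ Oq) _ => e /h[q' [[_ Fq'] _ hq']].
  by exists (q' false), (q' true).
have K_lab n0 (B : R) : exists J, forall (q : R -> bool -> cplx R) (len : R -> R),
  (forall b, continuous (fun s => nc (q s b))) -> (forall s, Gam (q s)) ->
  (forall s s', 0 <= s -> s <= s' -> s' <= 1 -> forall b,
     nc (q s b - q s' b) <= len s' - len s) ->
  len 1 - len 0 <= B -> K' n0 (q 0) -> K' J (q 1).
  have [J hJ] := lab n0 B; exists J => q len cq Gq hl lB; apply: (hJ (q^~ false) (q^~ true) len) => //.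
  by move=> s s' s0 ss s1; split; exact: hl.
(* One manifold serves both claims; only the map [Phi] varies. *)
have hk2 d (Phi : 'I_d -> (bool -> cplx R) -> cplx R) iota
    (Phi_iota : forall b q, Phi (iota b) q = q b)
    (Phi_smooth : forall a n (U : set (cplx R)) (phi : bool -> cplx R -> cplx R),
       (forall b, smooth n U (phi b)) -> smooth n U (fun z => Phi a (phi^~ z)))
    (Phi_bounded : exists B : R, forall a q, Gam q -> nc (Phi a q) <= B) :
    complete_bounded_embedding (Xmap Phi : curve_manifold hchart Sp0 -> _).
  split.
  - exact: Xmap_immersion Phi_iota Phi_smooth.
  - exact: Xmap_embedding Phi_iota Phi_smooth.
  - exact: Xmap_bounded Phi_bounded.
  - exact: (@M_complete R k Gam hchart p0 Sp0 d Phi iota Phi_iota Phi_smooth K' K_cover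
      K_closed K_lab).
split; exists (curve_manifold hchart Sp0).
  exists (Xmap (@Phi2 R)); apply: hk2 (@Phi2_iota R) (@Phi2_smooth R) _.
  by exists 1 => a q Gq; exact: Gb.
exists (Xmap (@Phi4 R)); split; last exact: hsc_Phi4.
apply: hk2 (@Phi4_iota R) (@Phi4_smooth R) _.
exists 1 => a q Gq; rewrite /Phi4; case: ifP => _; first exact: Gb.
by rewrite ncX expr_le1 ?nc_ge0//; exact: Gb.
Qed.
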